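(* Let $T\in(0,\infty)$, let $(\pi^n)_n$ be a sequence of partitions of $[0,T]$ with $|\pi^n|\to0$, let $p\in[1,\infty]$, $q\in[1,\infty)$ with $1/p+1/q\le 1$, let $x\in\mathbb{L}_p((\pi^n)_n)$ with occupation local time $L$, and let $f\in W^{2,q}(\mathbb{R})$. Then: (a) for every $t\in[0,T]$ the series $J_t^f(x)=\sum_{0<s\le t}\big(\Delta f(x_s)-f'(x_{s-})\Delta x_s\big)$ is absolutely convergent; (b) for every $t\in[0,T]$ and every mollifier $\rho$, with $f_n:=\rho_n*f$, the integrals $\int_0^t f_n'(x_{s-})\,\mathrm{d}x_s$ converge as $n\to\infty$ to a finite limit $$\int_0^t f'(x_{s-})\,\mathrm{d}x_s:=\lim_{n\to\infty}\int_0^t f_n'(x_{s-})\,\mathrm{d}x_s ,$$ which does not depend on the choice of $\rho$; (c) with this definition of $\int_0^t f'(x_{s-})\,\mathrm{d}x_s$, the pathwise Tanaka--Meyer formula $$f(x_t)-f(x_0)=\int_0^t f'(x_{s-})\,\mathrm{d}x_s+\frac12\int_{\mathbb{R}}L_t(x,u)\,f''(u)\,\mathrm{d}u+J_t^f(x),\qquad t\in[0,T],$$ holds. The same statements hold for $q=\infty$ provided $f''$ is continuous.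
   Context: $D([0,T];\mathbb{R})$ is the space of càdlàg functions $x:[0,T]\to\mathbb{R}$; $x_{t-}$ is the left limit, $x_{0-}:=x_0$, $\Delta x_t:=x_t-x_{t-}$, $\Delta f(x_s):=f(x_s)-f(x_{s-})$. A partition is a finite sequence $\pi=(t_j)_{j=0}^N$, $0=t_0<\dots<t_N=T$, with mesh $|\pi|=\max_j|t_j-t_{j-1}|$. Quadratic variation: $x\in D([0,T];\mathbb{R})$ belongs to $\mathbb{Q}((\pi^n)_n)$ if the discrete measures $\mu_n:=\sum_{t_j\in\pi^n}(x_{t_{j+1}}-x_{t_j})^2\delta_{t_j}$ (sum over $j$ such that $t_{j+1}\in\pi^n$ exists) converge weakly (tested against continuous functions on $[0,T]$) to a finite measure $\mu$ such that $[x]_t:=\mu([0,t])$ satisfies $\Delta[x]_t=(\Delta x_t)^2$ for all $t\in[0,T]$. Let $[x]^c$ be the continuous part of the increasing càdlàg function $[x]$. For $a,b\in\mathbb{R}$ put $\langle a,b\rangle:=[a,b)$ if $a\le b$ and $\langle a,b\rangle:=[b,a)$ if $a>b$ (so $\langle a,a\rangle=\emptyset$). Set $J_t(x,u):=\sum_{0<s\le t}|x_s-u|\,\mathbf{1}_{\langle x_{s-},x_s\rangle}(u)$, $u\in\mathbb{R}$. Occupation local time: for $x\in\mathbb{Q}((\pi^n)_n)$, a Borel function $L:[0,T]\times\mathbb{R}\to[0,\infty)$, written $L_t(x,u)$, is an occupation local time of $x$ if $\int_{\mathbb{R}}g(u)L_t(x,u)\,\mathrm{d}u=\int_0^t g(x_s)\,\mathrm{d}[x]^c_s$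 for all $t\in[0,T]$ and all Borel $g:\mathbb{R}\to[0,\infty)$. $\mathbb{L}_p((\pi^n)_n)$ is the set of $x\in\mathbb{Q}((\pi^n)_n)$ having an occupation local time $L$ and such that $K_t(x,\cdot):=L_t(x,\cdot)/2+J_t(x,\cdot)\in L^p(\mathbb{R})$ for all $t\in[0,T]$. $W^{2,q}(\mathbb{R})$ is the Sobolev space of functions twice weakly differentiable in $L^q(\mathbb{R})$; $f$ denotes the continuously differentiable representative and $f'$ its derivative. $\int_0^t$ stands for $\int_{(0,t]}$. For $h\in C^2(\mathbb{R})$ and $x\in\mathbb{Q}((\pi^n)_n)$, $\int_0^t h'(x_{s-})\,\mathrm{d}x_s:=\lim_{n\to\infty}\sum_{t_j\in\pi^n}h'(x_{t_j})(x_{t_{j+1}\wedge t}-x_{t_j\wedge t})$ (this limit exists, by Föllmer's pathwise Itô formula). A mollifier is a nonnegative $\rho\in C^\infty(\mathbb{R})$ with $\int_{\mathbb{R}}\rho=1$, and $\rho_n(u):=n\rho(nu)$; it is used that $f_n=\rho_n*f\in C^2(\mathbb{R})$.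
   Formalization: In (b) the mollifier is either compactly supported or such that every f_n is C^2 (otherwise the integrals of f_n' are undefined), and the quadratic variation measure is required to have no mass at time 0, i.e. the jump condition at t=0 is read with [x]_{0-}=0. *)

(* Defs.v *)
From HB Require Import structures.
From mathcomp Require Import all_boot all_order all_algebra.
From mathcomp Require Import finmap.
From mathcomp Require Import all_classical all_reals all_analysis.
From mathcomp Require Import measurable_realfun.

Set Implicit Arguments.
Unset Strict Implicit.
Unset Printing Implicit Defensive.
Import Order.TTheory GRing.Theory Num.Theory.
Import numFieldNormedType.Exports.
Local Open Scope classical_set_scope.
Local Open Scope ring_scope.

Section paths.
Context {R : realType}.
Implicit Types (T t : R) (x : R -> R) (s : seq R).

(* A path on [0, T] is a total function R -> R; nothing below depends on its
   values outside of [0, T]. *)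
Definition cadlag T x :=
  (forall t, 0 <= t < T -> x r @[r --> t^'+] --> x t) /\
  (forall t, 0 < t <= T -> cvg (x r @[r --> t^'-])).

Definition left_value x t : R := if t == 0 then x 0 else lim (x r @[r --> t^'-]).

(* A partition 0 = t_0 < t_1 < ... < t_N = T is encoded as in the library
   (itv_partition 0 T s) by the sequence s = [:: t_1; ...; t_N]. *)
Definition pt s j : R := nth 0 (0 :: s) j.

Definition mesh s : R := \big[Num.max/0]_(j < size s) (pt s j.+1 - pt s j).

End paths.

Section continuous_part.
Context {R : realType}.
Implicit Types (F : R -> R) (t : R).

(* Here F is defined on the whole line, so that the jump at 0 sees F(0-). *)
Definition jump F t : R := F t - lim (F r @[r --> t^'-]).

Definition continuous_part F t : R :=
  F t - fine (\esum_(s in `[0, t]) (jump F s)%:E).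

End continuous_part.

Section continuous_part_cumulative.
Context {R : realType}.
Variable F : cumulative R R.

Let ndF a b : a <= b -> F a <= F b.
Proof. exact: cumulative_is_nondecreasing. Qed.

Let cvgF t : cvg (F r @[r --> t^'-]).
Proof.
apply: nondecreasing_at_left_is_cvgr.
  by near=> s => a b _ _; exact: ndF.
near=> s; exists (F t) => _ /= [r + <-].
by rewrite in_itv/= => /andP[_ /ltW]; exact: ndF.
Unshelve. all: by end_near. Qed.

Let jump_ge0 t : 0 <= jump F t.
Proof.
rewrite subr_ge0; apply: limr_le; first exact: cvgF.
by near=> r; apply/ndF/ltW; near: r; exact: nbhs_left_lt.
Unshelve. all: by end_near. Qed.

Let jump_le a t : a < t -> jump F t <= F t - F a.
Proof.
move=> lat; rewrite lerD2l lerN2; apply: limr_ge; first exact: cvgF.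
by near=> r; apply/ndF/ltW; near: r; exact: nbhs_left_gt.
Unshelve. all: by end_near. Qed.

Let sum_jump_le a b (s : seq R) : path <%R a s -> last a s <= b ->
  \sum_(t <- s) jump F t <= F b - F a.
Proof.
elim: s a => [|t s ih] a /=; first by move=> _ ab; rewrite big_nil subr_ge0 ndF.
move=> /andP[lat ps] lb; rewrite big_cons.
rewrite (_ : F b - F a = (F t - F a) + (F b - F t)); last first.
  by rewrite [RHS]addrC addrA subrK.
by rewrite lerD// ?jump_le// ih.
Qed.

Let esum_jump_le a b (D : set R) : a <= b -> D `<=` `]a, b] ->
  (\esum_(t in D) (jump F t)%:E <= (F b - F a)%:E)%E.
Proof.
move=> leab Dab; apply: ge_ereal_sup => _ [X [finX XD]] <-.
rewrite fsbig_finite//= sumEFin lee_fin.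
set s := fset_set X.
rewrite -(perm_big _ (permEl (perm_sort <=%R s))) /=.
have sab t : t \in sort <=%R s -> a < t <= b.
  by rewrite mem_sort in_fset_set// inE => /XD/Dab; rewrite /= in_itv.
apply: sum_jump_le.
  rewrite lt_path_sortedE sort_lt_sorted fset_uniq andbT.
  by apply/allP => t /sab/andP[].
have := mem_last a (sort <=%R s); rewrite inE => /predU1P[->//|].
by move=> /sab/andP[].
Qed.

Let jumps (a b : R) : 0 <= a -> a <= b -> (\esum_(t in `[0%R, b]) (jump F t)%:E =
  \esum_(t in `[0%R, a]) (jump F t)%:E + \esum_(t in `]a, b]) (jump F t)%:E)%E.
Proof.
move=> a0 ab; rewrite (esumID `[0%R, a])//; last first.
  by move=> ? _; rewrite lee_fin jump_ge0.
congr (_ + _)%E; congr esum; apply/seteqP; split => t /=; rewrite !in_itv/=.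
- by case.
- by move=> /andP[-> ta]; split => //=; exact: le_trans ab.
- by case=> /andP[-> ->] /= /negP; rewrite andbT -ltNge.
- move=> /andP[lat ->]; rewrite andbT (le_trans a0 (ltW lat)); split => //.
  by apply/negP; rewrite /= -ltNge.
Qed.

Let jumps_fin t : (\esum_(s in `[0%R, t]) (jump F s)%:E \is a fin_num)%E.
Proof.
rewrite ge0_fin_numE; last by apply: esum_ge0 => ? _; rewrite lee_fin jump_ge0.
have [t0|t0] := leP 0 t; last first.
  by rewrite set_itv_ge ?esum_set0// bnd_simp -ltNge.
apply: le_lt_trans (ltry (F t - F (- 1))).
apply: esum_jump_le; first by rewrite (le_trans _ t0)// lerN10.
move=> s /=; rewrite !in_itv/= => /andP[s0 ->]; rewrite andbT.
by rewrite (lt_le_trans _ s0)// ltrN10.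
Qed.

Let continuous_part_sub a b : a <= b ->
  0 <= continuous_part F b - continuous_part F a <= F b - F a.
Proof.
move=> ab; rewrite /continuous_part opprD opprK addrACA.
pose S t := fine (\esum_(s in `[0, t]) (jump F s)%:E).
rewrite -/(S a) -/(S b).
suff /andP[Sab Sba] : S a <= S b <= S a + (F b - F a).
  rewrite [- S b + S a]addrC -[S a - S b]opprB gerBl !subr_ge0 Sab andbT.
  by rewrite lerBlDl.
have [a0|a0] := ltP a 0.
  have -> : S a = 0.
    by rewrite /S set_itv_ge ?esum_set0// bnd_simp -ltNge.
  rewrite /S add0r fine_ge0 /=; last first.
    by apply: esum_ge0 => ? _; rewrite lee_fin jump_ge0.
  rewrite -lee_fin fineK//; apply: esum_jump_le => // s /=.
  by rewrite !in_itv/= => /andP[s0 ->]; rewrite (lt_le_trans a0 s0).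
have fab : (\esum_(t in `]a, b]) (jump F t)%:E \is a fin_num)%E.
  rewrite ge0_fin_numE; last by apply: esum_ge0 => ? _; rewrite lee_fin jump_ge0.
  by apply: le_lt_trans (ltry (F b - F a)); exact: esum_jump_le.
rewrite /S (jumps a0 ab) fineD// lerDl lerD2l fine_ge0/=; last first.
  by apply: esum_ge0 => ? _; rewrite lee_fin jump_ge0.
by rewrite -lee_fin fineK//; exact: esum_jump_le.
Qed.

Let nd_continuous_part : nondecreasing (continuous_part F).
Proof.
by move=> a b /continuous_part_sub/andP[+ _]; rewrite subr_ge0.
Qed.

Let rc_continuous_part : right_continuous (continuous_part F).
Proof.
move=> a; apply/cvgrPdist_le => e e0.
have /cvgrPdist_le/(_ _ e0) := @cumulative_is_right_continuous _ _ _ F a.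
move=> Fa; near=> b.
have ab : a <= b by apply/ltW; near: b; exact: nbhs_right_gt.
have /andP[cge0 cle] := continuous_part_sub ab.
rewrite distrC ger0_norm//; apply: (le_trans cle).
rewrite -(ger0_norm (_ : 0 <= F b - F a)) ?subr_ge0 ?ndF// distrC.
by near: b; exact: Fa.
Unshelve. all: by end_near. Qed.

HB.instance Definition _ := isCumulative.Build R _ R (continuous_part F)
  nd_continuous_part rc_continuous_part.

End continuous_part_cumulative.

Section quadratic_variation_function.
Context {R : realType}.
Variable mu : {finite_measure set (measurableTypeR R) -> \bar R}.

(* t |-> mu([0, t]), which is 0 for t < 0: hence [jump (qv mu) 0 = mu {0}],
   i.e. the value of [x] at 0- is 0. *)
Definition qv (t : R) : R := fine (mu `[0%R, t]%classic).

Let fin_mu (t : R) : mu `[0%R, t]%classic \is a fin_num.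
Proof. by rewrite fin_num_measure. Qed.

Let nd_qv : nondecreasing qv.
Proof.
move=> a b ab; rewrite /qv fine_le// le_measure ?inE//.
by apply: subset_itvl; rewrite bnd_simp.
Qed.

Let rc_qv : right_continuous qv.
Proof.
move=> a; apply/cvgrPdist_lt => e e0.
pose A n : set (measurableTypeR R) := `[0, a + n.+1%:R^-1]%classic.
have capA : \bigcap_n A n = `[0, a]%classic.
  apply/seteqP; split => [t At|t]; rewrite /= in_itv/=; last first.
    move=> /andP[t0 ta] n _; rewrite /A/= in_itv/= t0/=.
    by rewrite (le_trans ta)// lerDl invr_ge0.
  have := At 0%N I; rewrite /A/= in_itv/= => /andP[-> _]/=.
  apply/ler_addgt0Pr => d d0.
  have := At (Num.truncn d^-1) I; rewrite /A/= in_itv/= => /andP[_ /le_trans]; apply.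
  rewrite lerD2l invf_ple ?posrE//; exact/ltW/truncnS_gt.
have : mu (A n) @[n --> \oo] --> mu (\bigcap_n A n).
  apply: nonincreasing_cvg_mu.
  - by have := fin_mu (a + 1%:R^-1); rewrite ge0_fin_numE.
  - by move=> n; exact: measurable_itv.
  - by rewrite capA; exact: measurable_itv.
  - move=> m n mn; apply/subsetPset; apply: subset_itvl.
    by rewrite bnd_simp lerD2l lef_pV2 ?posrE// ler_nat.
rewrite capA -[X in _ --> X]fineK// => /fine_cvg/cvgrPdist_lt/(_ _ e0)[n _ An].
near=> b.
have ab : a <= b by apply/ltW; near: b; exact: nbhs_right_gt.
apply: le_lt_trans (An n (leqnn n)).
have ndb := nd_qv ab.
have bn : b <= a + n.+1%:R^-1.
  by near: b; apply: nbhs_right_le; rewrite ltrDl.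
have := nd_qv bn; rewrite /= -/(qv a) -/(qv (a + n.+1%:R^-1)) => bnle.
rewrite !(distrC (qv a)) !ger0_norm ?subr_ge0//; first by rewrite lerD2r.
exact: le_trans bnle.
Unshelve. all: by end_near. Qed.

HB.instance Definition _ := isCumulative.Build R _ R qv nd_qv rc_qv.

End quadratic_variation_function.

Section quadratic_variation.
Context {R : realType}.
Implicit Types (T : R) (pi : nat -> seq R) (x : R -> R).

(* mu_n: the masses sit at the left endpoints t_j, for 0 <= j < N. *)
Definition discrete_qv x (s : seq R) : {measure set (measurableTypeR R) -> \bar R} :=
  msum (fun j => mscale (NngNum (sqr_ge0 (x (pt s j.+1) - x (pt s j))))
                        (dirac (pt s j : measurableTypeR R))) (size s).

Definition is_qv_measure T pi x (mu : {finite_measure set (measurableTypeR R) -> \bar R}) :=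
  (forall g : R -> R, {within `[0, T], continuous g} ->
     (\int[discrete_qv x (pi n)]_(s in `[0%R, T]) (g s)%:E)%E @[n --> \oo]
     --> (\int[mu]_(s in `[0%R, T]) (g s)%:E)%E) /\
  (forall t, 0 <= t <= T -> jump (qv mu) t = (x t - left_value x t) ^+ 2).

Definition has_qv T pi x := cadlag T x /\ exists mu, is_qv_measure T pi x mu.

End quadratic_variation.

Section local_time.
Context {R : realType}.
Implicit Types (T t u : R) (pi : nat -> seq R) (x : R -> R) (L : R -> R -> R).

Definition between (a b : R) : set R := if a <= b then `[a, b[%classic else `[b, a[%classic.

Definition jump_local_time x t u : \bar R :=
  \esum_(s in `]0, t]) (`|x s - u| * \1_(between (left_value x s) (x s)) u)%:E.

(* The continuous part of [x] is integrated as a Lebesgue-Stieltjes measure. *)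
Definition occupation_local_time T pi x L :=
  [/\ cadlag T x,
      measurable_fun (`[0, T] `*` [set: R]) (fun z : R * R => L z.1 z.2),
      forall t u, 0 <= t <= T -> 0 <= L t u &
      exists2 mu, is_qv_measure T pi x mu &
        forall t, 0 <= t <= T ->
        forall g : R -> R, measurable_fun setT g -> (forall u, 0 <= g u) ->
          (\int[lebesgue_measure]_u (g u * L t u)%:E =
           \int[lebesgue_stieltjes_measure (continuous_part (qv mu))]_(s in `]0%R, t])
              (g (x s))%:E)%E].

(* K_t(x, u) = L_t(x, u) / 2 + J_t(x, u); J may be infinite on a null set. *)
Definition local_time_density x L t u : \bar R :=
  ((L t u / 2)%:E + jump_local_time x t u)%E.

Definition has_Lp_local_time T pi (p : \bar R) x :=
  has_qv T pi x /\
  exists2 L, occupation_local_time T pi x L &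
    forall t, 0 <= t <= T ->
      measurable_fun setT (local_time_density x L t) /\
      (Lnorm lebesgue_measure p (local_time_density x L t) < +oo)%E.

End local_time.

Section functions.
Context {R : realType}.
Implicit Types (f g h phi rho : R -> R).

Definition class_C k h :=
  (forall i u, (i < k)%N -> derivable (derive1n i h) u 1) /\ continuous (derive1n k h).

Definition smooth h := forall k, class_C k h.

Definition compact_support h := compact (closure [set u | h u != 0]).

Definition weak_derivative f g :=
  forall phi, smooth phi -> compact_support phi ->
    \int[lebesgue_measure]_u (f u * derive1 phi u) =
    - \int[lebesgue_measure]_u (g u * phi u).

(* f in W^{2,q}, with first and second weak derivatives f1 and f2 *)
Definition sobolev2 (q : \bar R) f f1 f2 :=
  [/\ f \in Lfun lebesgue_measure q, f1 \in Lfun lebesgue_measure q,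
      f2 \in Lfun lebesgue_measure q,
      weak_derivative f f1 & weak_derivative f1 f2].

Definition mollifier rho :=
  [/\ smooth rho, forall u, 0 <= rho u &
      (\int[lebesgue_measure]_u (rho u)%:E = 1)%E].

Definition convolution g f u : R := \int[lebesgue_measure]_v (g (u - v) * f v).

(* rho_n * f with rho_n(u) = n rho(n u); the term n = 0 is the zero function. *)
Definition mollify rho f (n : nat) : R -> R :=
  convolution (fun u => n%:R * rho (n%:R * u)) f.

End functions.

Section pathwise_integral.
Context {R : realType}.
Implicit Types (t : R) (pi : nat -> seq R) (x f h : R -> R).

Definition riemann_sum x h t (s : seq R) : R :=
  \sum_(j < size s)
    derive1 h (x (pt s j)) * (x (Num.min (pt s j.+1) t) - x (Num.min (pt s j) t)).

(* Int_0^t h'(x_{s-}) dx_s; meaningful for h of class C^2, since [limn] returns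
   an arbitrary value on sequences without a limit. *)
Definition follmer_integral pi x h t : R := limn (fun n => riemann_sum x h t (pi n)).

Definition jump_term x f s : R :=
  f (x s) - f (left_value x s) - derive1 f (left_value x s) * (x s - left_value x s).

(* The sum of an absolutely convergent series is that of its positive part
   minus that of its negative part, [\esum] being for nonnegative terms. *)
Definition jump_sum x f t : R :=
  let a s := (jump_term x f s)%:E in
  fine (esum `]0%R, t] a^\+ - esum `]0%R, t] a^\-)%E.

End pathwise_integral.

(* Main.v *)
Require Import Defs.
From mathcomp Require Import all_boot all_order all_algebra.
From mathcomp Require Import all_classical all_reals all_analysis.
From mathcomp Require Import measurable_realfun.
From mathcomp Require Import ess_sup_inf ring lra.
Import Order.TTheory GRing.Theory Num.Theory.
Import numFieldNormedType.Exports.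
Local Open Scope classical_set_scope.
Local Open Scope ring_scope.
Set Implicit Arguments.
Unset Strict Implicit.
Unset Printing Implicit Defensive.

(** Write w_{u,v}(r) = |v - r| 1_{<u,v>}(r), so that Taylor's formula reads
  f(v) - f(u) - f'(u) (v - u) = int f''(r) w_{u,v}(r) dr
  and J_t is the sum of the kernels w_{x_{s-},x_s}.

  For h of class C^2 the Riemann sums of h'(x) dx therefore telescope, up to the
  sums of G(x_{t_j}, x_{t_{j+1}}) with G(u, v) = int h'' w_{u,v}.  Near the
  diagonal G(u, v) is equivalent to h''(u) (v - u)^2 / 2, and real induction on t
  carries the convergence of the sums of squared increments over to
    sum_j G(x_{t_j}, x_{t_{j+1}})
      --> 1/2 int_0^t h''(x_s) d[x]^c_s + sum_{s <= t} G(x_{s-}, x_s),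
  whose right-hand side is int h'' K_t by the occupation formula and Tonelli.
  Hence the Foellmer integral of h' is h(x_t) - h(x_0) - int h'' K_t.

  For h = f_n = rho_n * f, Fubini turns int f_n'' K_t into the average of
  H(w) = int f''(u - w) K_t(u) du against rho_n, so it suffices that H is bounded
  and continuous: the part of f'' below a level M is handled by continuity of
  translations on K_t in L^1, the part above M, uniformly in w, by a scaled
  Young inequality.  So the limit is f(x_t) - f(x_0) - int f'' K_t, and splitting
  K_t = L_t / 2 + J_t gives the formula; the absolutely convergent series comes
  from int |f''| J_t < oo. *)

(** * Continuity of translations in L^1 *)

(** Weak convergence of the squared increments says nothing about where an atom sits: the mass of a
    jump at t is carried by a partition point just before t, while its Taylor term depends on both
    x_{t-} and x_t. Real induction fits this, since a cadlag path is nearly constant just after a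
    point, and just before a point it is nearly constant except for one final jump. All local errors
    are proportional to increments of [x], hence add up to at most a multiple of [x]_t; the left
    step closes because the jumps of [x] are the squared jumps of x.

    Monotonicity and exchange of sums and integrals come for free only with nonnegative terms. So
    densities are nonnegative first, and signs return by splitting h'' or f'' into positive and
    negative parts.

    Density 1 shows that K_t is in L^1, as the continuity of translations requires; the L^p bound on
    K_t serves for the part of f'' above a level.

    The local time of the statement and the one with the L^p bound may come with different quadratic
    variation measures; uniqueness of [x] on [0, T] reconciles them. *)

Section affine_change_of_variable.
Context {R : realType}.

Lemma ltey_of_scale (a : R) (X : \bar R) :
  0 < a -> (0 <= X)%E -> (a%:E * X < +oo)%E -> (X < +oo)%E.
Proof.
by move=> a0; case: X => [r| |]//; rewrite ?ltry// gt0_muley// lte_fin.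
Qed.

Local Notation lam := (@lebesgue_measure R).

Lemma measurable_fun_affine (a b : R) :
  measurable_fun setT (fun u : measurableTypeR R => a * u + b : measurableTypeR R).
Proof. by apply: measurable_funD => //; exact: measurable_funM. Qed.

Let image_measure (a b : R) : {measure set (measurableTypeR R) -> \bar R} :=
  mscale (NngNum (normr_ge0 a))
    (measure_function_pushforward__canonical__measure_function_Measure lam
      (measurable_fun_affine a b)).

(** Measures that agree on the intervals []c, d]] coincide. A negative slope turns the preimage of
    []c, d]] into an interval closed on the left, so the two signs are computed apart. *)
Let lebesgue_measure_affine (a b : R) : a != 0 -> forall A, measurable A ->
  lam A = image_measure a b A.
Proof.
move=> a0 A mA.
apply: lebesgue_measure_unique => // _ [[c d] _ <-] /=.
rewrite /image_measure /mscale /= /pushforward.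
have [a_gt0|a_lt0|/eqP] := ltrgt0P a; last by rewrite (negbTE a0).
- rewrite (_ : _ @^-1` _ = `](c - b) / a, (d - b) / a]%classic); last first.
    apply/seteqP; split => u /=; rewrite !in_itv/=;
      by rewrite ltr_pdivrMr// ler_pdivlMr// ltrBlDr lerBrDr (mulrC u).
  rewrite /= !lebesgue_measure_itv/= !lte_fin ltr_pM2r ?invr_gt0// ltrD2r.
  case: ifPn => _; last by rewrite mule0.
  by rewrite -EFinD -EFinB -EFinM; congr EFin; field.
- rewrite (_ : _ @^-1` _ = `[(d - b) / a, (c - b) / a[%classic); last first.
    apply/seteqP; split => u /=; rewrite !in_itv/=;
      by rewrite ltr_ndivlMr// ler_ndivrMr// ltrBlDr lerBrDr (mulrC u) andbC.
  rewrite /= !lebesgue_measure_itv/= !lte_fin ltr_nM2r ?invr_lt0// ltrD2r.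
  case: ifPn => _; last by rewrite mule0.
  by rewrite -EFinD -EFinB -EFinM; congr EFin; field.
Qed.

Lemma ge0_integral_affine (F : R -> \bar R) (a b : R) : a != 0 ->
  measurable_fun setT F -> (forall u, 0 <= F u)%E ->
  (\int[lam]_u F u = `|a|%:E * \int[lam]_u F (a * u + b)%R)%E.
Proof.
move=> a0 mF F0; transitivity (\int[image_measure a b]_u F u)%E.
  by apply: eq_measure_integral => A mA _; exact: lebesgue_measure_affine.
rewrite ge0_integral_mscale//=.
by rewrite (ge0_integral_pushforward (measurable_fun_affine a b) lam _ mF)//.
Qed.

Lemma integrable_affine (F : R -> R) (a b : R) : a != 0 ->
  lam.-integrable setT (EFin \o F) ->
  lam.-integrable setT (fun u => (F (a * u + b)%R)%:E).
Proof.
move=> a0 /integrableP[mF iF]; apply/integrableP; split.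
  exact: (measurableT_comp mF (measurable_fun_affine a b)).
move: iF; rewrite (@ge0_integral_affine (abse \o (EFin \o F)) a b a0)//=; last first.
  exact: measurableT_comp.
move/ltey_of_scale; apply; first by rewrite normr_gt0.
by apply: integral_ge0 => u _ /=.
Qed.

Lemma Rintegral_affine (F : R -> R) (a b : R) : a != 0 ->
  lam.-integrable setT (EFin \o F) ->
  \int[lam]_u F u = `|a| * \int[lam]_u F (a * u + b)%R.
Proof.
move=> a0 iF; have iF' := @integrable_affine F a b a0 iF.
have mF := measurable_int _ iF.
have mF' := measurable_int _ iF'.
rewrite /Rintegral integralE [X in _ = _ * fine X]integralE.
have H (G : R -> \bar R) : measurable_fun setT G -> (forall u, 0 <= G u)%E ->
  (\int[lam]_u G u < +oo)%E -> fine (\int[lam]_u G u) =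
     `|a| * fine (\int[lam]_u G (a * u + b)%R).
  move=> mG G0; rewrite (ge0_integral_affine b a0 mG G0) => Goo.
  have X0 : (0 <= \int[lam]_u G (a * u + b)%R)%E by exact: integral_ge0.
  rewrite fineM// ge0_fin_numE//; apply: ltey_of_scale Goo => //.
  by rewrite normr_gt0.
rewrite fineB ?integrable_pos_fin_num ?integrable_neg_fin_num//.
rewrite [in RHS]fineB ?integrable_pos_fin_num ?integrable_neg_fin_num//.
rewrite mulrBr; congr (_ - _).
- have := H ((EFin \o F)^\+)%E (measurable_funepos mF) (fun u => funepos_ge0 _ u)
    (integral_funepos_lt_pinfty measurableT iF).
  under [X in _ = _ * fine X -> _]eq_integral do rewrite funeposE.
  by under [X in _ -> _ = _ * fine X]eq_integral do rewrite funeposE.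
- have := H ((EFin \o F)^\-)%E (measurable_funeneg mF) (fun u => funeneg_ge0 _ u)
    (integral_funeneg_lt_pinfty measurableT iF).
  under [X in _ = _ * fine X -> _]eq_integral do rewrite funenegE.
  by under [X in _ -> _ = _ * fine X]eq_integral do rewrite funenegE.
Qed.

End affine_change_of_variable.

Section lebesgue_shift.
Context {R : realType}.
Local Notation lam := (@lebesgue_measure R).

Lemma ge0_integral_shift (F : R -> \bar R) (w : R) :
  measurable_fun setT F -> (forall u, 0 <= F u)%E ->
  (\int[lam]_u F (u + w)%R = \int[lam]_u F u)%E.
Proof.
move=> mF F0; rewrite (ge0_integral_affine w (oner_neq0 R) mF F0) normr1 mul1e.
by apply: eq_integral => u _; rewrite mul1r.
Qed.

End lebesgue_shift.

Section vanishing_sequences.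
Context {R : realType}.
Implicit Types X : nat -> \bar R.

Lemma cvge0_lt X (e : R) : X n @[n --> \oo] --> 0%E -> 0 < e ->
  \forall n \near \oo, (X n < e%:E)%E.
Proof.
move=> /fine_cvgP[fX /cvgr0Pnorm_lt cX] e0; near=> n.
have fn : X n \is a fin_num by near: n.
rewrite -(fineK fn) lte_fin (le_lt_trans (ler_norm _))//.
by near: n; exact: cX.
Unshelve. all: by end_near. Qed.

Lemma cvge0_of_le X : (forall n, 0 <= X n)%E ->
  (forall e : R, 0 < e -> \forall n \near \oo, (X n <= e%:E)%E) ->
  X n @[n --> \oo] --> 0%E.
Proof.
move=> X0 Xe; apply/fine_cvgP; split.
  near=> n; rewrite ge0_fin_numE//; apply: (@le_lt_trans _ _ 1%E); last exact: ltry.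
  by near: n; exact: (Xe 1 ltr01).
apply/cvgr0Pnorm_le => e e0; near=> n.
have Xn : (X n <= e%:E)%E by near: n; exact: Xe.
have fn : X n \is a fin_num by rewrite ge0_fin_numE// (le_lt_trans Xn)// ltry.
by rewrite /= ger0_norm ?fine_ge0// -lee_fin fineK.
Unshelve. all: by end_near. Qed.

End vanishing_sequences.

Section translation_continuity.
Context {R : realType}.
Local Notation lam := (@lebesgue_measure R).

Let A (n : nat) : set R := `[- n%:R, n%:R]%classic.

(** Cutting [phi] off to [[-n, n]] leaves a domain of finite measure, on which continuous functions
    are dense in L^1. The approximant is thus a continuous function cut off at [-n] and [n], where
    it may jump. *)
Lemma integrable_approximation (phi : R -> R) (e : R) : 0 < e ->
  lam.-integrable setT (EFin \o phi) ->
  exists n, exists2 h : R -> R, continuous h &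
    (\int[lam]_u `|phi u - (h \_ (A n)) u|%:E < e%:E)%E.
Proof.
move=> e0 iphi; have mphi : measurable_fun setT phi.
  by apply/measurable_EFinP; exact: measurable_int iphi.
have mA n : measurable (A n) by exact: measurable_itv.
have mphiA n : measurable_fun setT (phi \_ (A n)).
  by apply/(measurable_restrictT _ _).1 => //; exact: measurable_funTS.
have : (\int[lam]_u `|phi u - (phi \_ (A n)) u|%:E)%E @[n --> \oo] --> 0%E.
  have := @dominated_cvg _ _ _ lam setT measurableT
    (fun n u => `|phi u - (phi \_ (A n)) u|%:E) (cst 0%E) (fun u => `|phi u|%:E).
  rewrite integral_cst// mul0e; apply.
  - move=> n; apply/measurable_EFinP; apply: (measurableT_comp (@normr_measurable _ _)).
    exact: (measurable_funB mphi (mphiA n)).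
  - move=> u _; apply: cvg_near_cst; near=> n.
    rewrite patchE mem_set ?subrr ?normr0//= /A/= in_itv/= -ler_norml.
    by near: n; exact: nbhs_infty_ger.
  - by [].
  - exact: integrable_norm.
  - move=> n u _; rewrite lee_fin normr_id patchE; case: ifPn => _.
      by rewrite subrr normr0.
    by rewrite subr0.
move=> /cvge0_lt/(_ (divr_gt0 e0 (ltr0Sn R 1)))[n _ /(_ n (leqnn n)) hn].
have lA : (lam (A n) < +oo)%E.
  by rewrite lebesgue_measure_itv/=; case: ifP => _; rewrite ?ltry// -EFinB ltry.
have iA : lam.-integrable (A n) (EFin \o phi) by apply: integrableS iphi; [exact: measurableT | exact: measurable_itv | exact: subsetT].
have [g [cg ig]] := approximation_continuous_integrable (mA n) lA iA.
move=> /cvge0_lt/(_ (divr_gt0 e0 (ltr0Sn R 1)))[m _ /(_ m (leqnn m)) hm].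
exists n, (g m) => //.
have mg : measurable_fun setT (g m) by exact: continuous_measurable_fun.
have mgA : measurable_fun setT (g m \_ (A n)).
  by apply/(measurable_restrictT _ _).1 => //; exact: measurable_funTS.
have mc : measurable_fun setT (fun z => `|(phi z - g m z)%:E|)%E.
  have : measurable_fun setT (EFin \o (fun z => `|phi z - g m z|)).
    apply/measurable_EFinP; apply: (measurableT_comp (@normr_measurable _ _)).
    exact: (measurable_funB mphi mg).
  by [].
pose a u := `|phi u - (phi \_ (A n)) u|%:E.
have ma : measurable_fun setT a.
  apply/measurable_EFinP; apply: (measurableT_comp (@normr_measurable _ _)).
  exact: (measurable_funB mphi (mphiA n)).
pose c := ((fun z => `|(phi z - g m z)%:E|%E) \_ (A n)).
have {}mc : measurable_fun setT c.
  by apply/(measurable_restrictT _ _).1 => //; exact: measurable_funTS mc.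
have c0 u : (0 <= c u)%E by rewrite /c patchE; case: ifP.
apply: (@le_lt_trans _ _ (\int[lam]_u (a u + c u)))%E.
  apply: ge0_le_integral => //.
  - apply/measurable_EFinP; apply: (measurableT_comp (@normr_measurable _ _)).
    exact: (measurable_funB mphi mgA).
  - exact: emeasurable_funD.
  - move=> u _; rewrite /a /c !patchE; case: ifPn => _ /=.
      by rewrite subrr normr0 add0e.
    by rewrite subr0 adde0.
have a0 u : (0 <= a u)%E by rewrite lee_fin.
rewrite (ge0_integralD lam measurableT (fun u _ => a0 u) ma (fun u _ => c0 u) mc).
have -> : e%:E = ((e / 2)%:E + (e / 2)%:E)%E by rewrite -EFinD -splitr.
by apply: lteD; [exact: hn|rewrite /c -integral_mkcond; exact: hm].
Unshelve. all: by end_near. Qed.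

Let cvg_translation_continuous (h : R -> R) n (w : nat -> R) :
  continuous h -> w m @[m --> \oo] --> 0 ->
  (\int[lam]_u `|(h \_ (A n)) (u + w m)%R - (h \_ (A n)) u|%:E)%E @[m --> \oo] --> 0%E.
Proof.
move=> ch w0.
have mA k : measurable (A k) by exact: measurable_itv.
have mh : measurable_fun setT (h \_ (A n)).
  apply/(measurable_restrictT _ _).1 => //; apply: measurable_funTS.
  exact: continuous_measurable_fun.
have [C hC] : exists C, forall u, `|(h \_ (A n)) u| <= C.
  have [C [_ /(_ (C + 1))]] : bounded_set (h @` A n).
    apply: compact_bounded; apply: continuous_compact; last exact: segment_compact.
    exact/continuous_subspaceT.
  rewrite ltrDl => /(_ ltr01) CA; exists (Num.max 0 (C + 1)) => u.
  rewrite patchE; case: ifPn => [/set_mem Au|_]; last by rewrite normr0 le_max lexx.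
  by rewrite le_max CA ?orbT//; exists u.
have C0 : 0 <= C by exact: le_trans (hC 0).
(* Once [|w m| < 1], every translate of the cut-off function lives on this interval, one unit longer
   on each side. The sequence is shifted to start there, so that [C * \1_B] dominates all of its
   terms. *)
pose B : set R := `[- n.+1%:R, n.+1%:R]%classic.
have mB : measurable B by exact: measurable_itv.
have [m0 _ w1] : \forall m \near \oo, `|w m| < 1.
  by move/cvgr0Pnorm_lt : w0 => /(_ _ ltr01).
rewrite -(cvg_shiftn m0) /=.
have [//||||//|_ + _] := @dominated_convergence _ _ _ lam setT measurableT
    (fun m u => ((h \_ (A n)) (u + w (m + m0)%N)%R)%:E)
    (fun u => ((h \_ (A n)) u)%:E) (fun u => (C * \1_B u)%:E).
- move=> m; apply/measurable_EFinP.
  apply: (measurableT_comp mh).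
  have := @measurable_fun_affine R 1 (w (m + m0)%N).
  by under eq_fun do rewrite mul1r.
- exact/measurable_EFinP.
- exists [set n%:R; - n%:R]; split.
  + by apply: measurableU; exact: measurable_set1.
  + by apply: countable_lebesgue_measure0; apply: finite_set_countable.
  + move=> u /= /not_implyP[_]; apply: contra_notP => /not_orP[uNn uNNn].
    apply: cvg_EFin; first exact: nearW.
    have cu : {for u, continuous (h \_ (A n))}.
      have nu z : `|u| < z -> \forall v \near u, `|v| < z.
        by move=> uz; have /cvgr_lt/(_ _ uz) := @norm_continuous R R u; apply.
      have nu' z : z < `|u| -> \forall v \near u, z < `|v|.
        by move=> uz; have /cvgr_gt/(_ _ uz) := @norm_continuous R R u; apply.
      have [un|un|un] := ltgtP `|u| n%:R.
      * have hu : (h \_ (A n)) u = h u.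
          by rewrite patchE mem_set// /A/= in_itv/= -ler_norml ltW.
        suff : (h \_ (A n)) v @[v --> u] --> (h \_ (A n)) u by [].
        rewrite hu; apply: cvg_trans (ch u).
        apply: near_eq_cvg; near=> v; rewrite patchE mem_set//.
        by rewrite /A/= in_itv/= -ler_norml ltW//; near: v; exact: nu.
      * have hu : (h \_ (A n)) u = 0.
          by rewrite patchE memNset// /A/= in_itv/= -ler_norml => /(lt_le_trans un); rewrite ltxx.
        suff : (h \_ (A n)) v @[v --> u] --> (h \_ (A n)) u by [].
        rewrite hu; apply: cvg_near_cst; near=> v.
        rewrite patchE memNset// /A/= in_itv/= -ler_norml; apply/negP; rewrite -ltNge.
        by near: v; exact: nu'.
      * exfalso; move/eqP : un; rewrite eqr_norml => /andP[/orP[/eqP uE|/eqP uE] _]; [exact: uNn|exact: uNNn].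
    have wu : u + w (m + m0)%N @[m --> \oo] --> u.
      rewrite -[X in _ --> X]addr0.
      by apply: cvgD; [exact: cvg_cst|rewrite (cvg_shiftn m0 w)].
    exact: (cvg_comp _ _ wu cu).
- under eq_fun do rewrite EFinM.
  by apply: integrableZl => //; exact: integrable_indic_itv.
- apply: aeW => u m _; rewrite lee_fin.
  have [Bu|Bu] := boolP (u \in B); first by rewrite indicE Bu mulr1.
  rewrite indicE (negbTE Bu) mulr0 patchE; case: ifPn => [/set_mem|]; last by rewrite normr0.
  rewrite /A/= in_itv/= => /andP[h1 h2]; exfalso; move/negP : Bu; apply.
  have := w1 (m + m0)%N (leq_addl _ _); rewrite /= ltr_norml => /andP[h3 h4].
  by rewrite inE /B/= in_itv/= -natr1; apply/andP; split; lra.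
- exact.
Unshelve. all: by end_near. Qed.

(** The error of the approximation enters twice, once translated; translation does not change its
    integral, so both occurrences are small whatever [w m] is. *)
Lemma cvg_integral_translation (phi : R -> R) (w : nat -> R) :
  lam.-integrable setT (EFin \o phi) -> w m @[m --> \oo] --> 0 ->
  (\int[lam]_u `|phi (u + w m)%R - phi u|%:E)%E @[m --> \oo] --> 0%E.
Proof.
move=> iphi w0; apply: cvge0_of_le => [m|e e0].
  by apply: integral_ge0 => u _; rewrite lee_fin.
have e40 : 0 < e / 4 by rewrite divr_gt0.
have [n [h ch hphi]] := integrable_approximation e40 iphi.
have /cvge0_lt/(_ e40) := cvg_translation_continuous n ch w0.
apply: filterS => m hm.
have mphi : measurable_fun setT phi.
  by apply/measurable_EFinP; exact: measurable_int iphi.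
have mpsi : measurable_fun setT (h \_ (A n)).
  apply/(measurable_restrictT _ _).1 => //; first exact: measurable_itv.
  by apply: measurable_funTS; exact: continuous_measurable_fun.
have mshift : measurable_fun setT (fun u : R => u + w m).
  have := @measurable_fun_affine R 1 (w m).
  by under eq_fun do rewrite mul1r.
pose a u := `|phi u - (h \_ (A n)) u|%:E.
have ma : measurable_fun setT a.
  apply/measurable_EFinP; apply: (measurableT_comp (@normr_measurable _ _)).
  exact: (measurable_funB mphi mpsi).
have ma' : measurable_fun setT (fun u : R => a (u + w m)) by exact: measurableT_comp ma mshift.
pose b u := `|(h \_ (A n)) (u + w m)%R - (h \_ (A n)) u|%:E.
have mb : measurable_fun setT b.
  apply/measurable_EFinP; apply: (measurableT_comp (@normr_measurable _ _)).
  by apply: (measurable_funB _ mpsi); exact: measurableT_comp mpsi mshift.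
have mab : measurable_fun setT (fun u : R => a (u + w m)%R + b u)%E by exact: emeasurable_funD.
apply: (@le_trans _ _ (\int[lam]_u (a (u + w m)%R + b u + a u)))%E.
  apply: ge0_le_integral => //=.
  - apply/measurable_EFinP; apply: (measurableT_comp (@normr_measurable _ _)).
    by apply: (measurable_funB _ mphi); exact: measurableT_comp mphi mshift.
  - by apply: emeasurable_funD.
  - move=> u _; rewrite -!EFinD lee_fin.
    rewrite (_ : phi (u + w m) - phi u = (phi (u + w m) - (h \_ (A n)) (u + w m)) +
      ((h \_ (A n)) (u + w m) - (h \_ (A n)) u) - (phi u - (h \_ (A n)) u)); last by ring.
    by rewrite (le_trans (ler_normB _ _))// lerD2r ler_normD.
have a0 u : (0 <= a u)%E by rewrite lee_fin.
have b0 u : (0 <= b u)%E by rewrite lee_fin.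
rewrite (ge0_integralD lam measurableT (fun u _ => adde_ge0 (a0 _) (b0 u)) mab
  (fun u _ => a0 u) ma).
rewrite (ge0_integralD lam measurableT (fun u _ => a0 _) ma' (fun u _ => b0 u) mb).
rewrite ge0_integral_shift//.
rewrite [leRHS](_ : _ = (e / 4)%:E + (e / 4)%:E + (e / 4)%:E + (e / 4)%:E)%E; last first.
  by rewrite -!EFinD; congr EFin; field.
apply: (@le_trans _ _ ((e / 4)%:E + (e / 4)%:E + (e / 4)%:E))%E.
  by rewrite leeD// ?leeD// ltW.
by rewrite -!EFinD lee_fin; lra.
Qed.

End translation_continuity.

Lemma integrable_patch (R : realType) (g : R -> R) (D : set R) : measurable D ->
  (@lebesgue_measure R).-integrable D (EFin \o g) ->
  (@lebesgue_measure R).-integrable setT (EFin \o (g \_ D)).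
Proof.
move=> mD ig; rewrite -restrict_EFin.
by apply: (@integrable_mkcond _ _ _ (@lebesgue_measure R) _ _ _).1.
Qed.

Lemma Rintegral_dominated_cvg (R : realType) (F : nat -> R -> R) (f g : R -> R) :
  (forall n, measurable_fun setT (F n)) ->
  (forall u, F n u @[n --> \oo] --> f u) ->
  (@lebesgue_measure R).-integrable setT (EFin \o g) ->
  (forall n u, `|F n u| <= g u) ->
  \int[@lebesgue_measure R]_u F n u @[n --> \oo] --> \int[@lebesgue_measure R]_u f u.
Proof.
move=> mF Ff ig Fg.
have mf : measurable_fun setT f.
  by apply: (measurable_fun_cvg mF) => u _; exact: Ff.
have fg u : `|f u| <= g u.
  have -> : `|f u| = lim (`|F n u| @[n --> \oo]).
    by apply/esym/cvg_lim; [exact: Rhausdorff|exact: cvg_norm (Ff u)].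
  by apply: limr_le; [apply: is_cvg_norm; apply/cvg_ex; exists (f u)|exact: nearW].
have if_ : (@lebesgue_measure R).-integrable setT (EFin \o f).
  apply: le_integrable ig => //; first exact/measurable_EFinP.
  by move=> u _; rewrite /= lee_fin (le_trans (fg u))// ler_norm.
apply: fine_cvg; rewrite /Rintegral fineK; last exact: integrable_fin_num.
have := @dominated_cvg _ _ _ (@lebesgue_measure R) setT measurableT
  (fun n => EFin \o F n) (EFin \o f) (EFin \o g).
apply.
- by move=> n; apply/measurable_EFinP; exact: mF.
- by move=> u _; apply: cvg_EFin; [exact: nearW|exact: Ff].
- by [].
- by [].
- by move=> n u _; rewrite /= lee_fin.
Qed.

Lemma integrable_addR (R : realType) (f g : R -> R) :
  (@lebesgue_measure R).-integrable setT (EFin \o f) ->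
  (@lebesgue_measure R).-integrable setT (EFin \o g) ->
  (@lebesgue_measure R).-integrable setT (EFin \o (fun r => f r + g r)).
Proof.
move=> if_ ig; rewrite (_ : EFin \o (fun r => f r + g r)%R = (EFin \o f) \+ (EFin \o g))%E//.
exact: integrableD.
Qed.

(** * Sums along partitions *)

(** The supremum of the points up to which [P] holds is reached by the left step and passed by the
    right step unless it is [t]. The right step may use [P a] alone, the left step everything before
    [b]. *)
Lemma real_induction (R : realType) (P : R -> Prop) (T : R) :
  P 0 ->
  (forall a, 0 <= a < T -> P a ->
    exists2 d, 0 < d & forall b, a < b < a + d -> b <= T -> P b) ->
  (forall b, 0 < b <= T -> (forall a, 0 <= a < b -> P a) -> P b) ->
  forall t, 0 <= t <= T -> P t.
Proof.
move=> P0 Pr Pl t /andP[t0 tT].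
pose E := [set s | 0 <= s <= t /\ forall r, 0 <= r <= s -> P r].
have E0 : E 0.
  split; first by rewrite lexx t0.
  by move=> r r0; have /eqP <- : 0 == r by rewrite eq_le.
have supE : has_sup E by split; [exists 0 | exists t => s [/andP[]]].
have c0 : 0 <= sup E by exact: (sup_upper_bound supE).
have ct : sup E <= t by apply: ge_sup => [|s [/andP[]]//]; exists 0.
have Plt r : 0 <= r < sup E -> P r.
  move=> /andP[r0 rc]; have [s [_ Ps] rs] := sup_gt (proj1 supE) rc.
  by apply: Ps; rewrite r0 ltW.
have Pc : P (sup E).
  have [->//|cN0] := eqVneq (sup E) 0.
  by apply: Pl => //; rewrite lt_neqAle eq_sym cN0 c0 (le_trans ct).
have [ct'|tc] := ltP (sup E) t; last first.
  by have -> : t = sup E by apply/eqP; rewrite eq_le tc ct.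
have cT : 0 <= sup E < T by rewrite c0 (lt_le_trans ct').
have [d d0 Pd] := Pr _ cT Pc.
have d20 : 0 < d / 2 by rewrite divr_gt0.
have : Num.min t (sup E + d / 2) <= sup E.
  apply: (sup_upper_bound supE); split.
    by rewrite le_min t0 (addr_ge0 c0 (ltW d20)) ge_min lexx.
  move=> r /andP[r0]; rewrite le_min => /andP[rt rd].
  have [rc|rc|->//] := ltgtP r (sup E); first by apply: Plt; rewrite r0.
  apply: Pd; last exact: le_trans rt tT.
  by rewrite rc (le_lt_trans rd)// ltrD2l; lra.
by rewrite ge_min leNgt ct'/= gerDl leNgt d20.
Qed.

Section partitions.
Context {R : realType}.
Variables (T : R) (s : seq R).
Hypothesis partition_s : itv_partition 0 T s.

Lemma pt0 : pt s 0 = 0. Proof. by []. Qed.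

Lemma pt_size : pt s (size s) = T.
Proof. exact: itv_partition_nth_size. Qed.

Lemma pt_lt i j : (i < j)%N -> (j <= size s)%N -> pt s i < pt s j.
Proof.
move=> ij js; case: partition_s => ps _.
have /= := @sorted_ltn_nth _ <%R lt_trans 0 (0 :: s) ps.
by apply; rewrite ?inE//= ltnS// (leq_trans _ js)// ltnW.
Qed.

Lemma pt_le i j : (i <= j)%N -> (j <= size s)%N -> pt s i <= pt s j.
Proof. by rewrite leq_eqVlt => /predU1P[->//|ij js]; apply/ltW/pt_lt. Qed.

Lemma pt_ge0 i : (i <= size s)%N -> 0 <= pt s i.
Proof. by move=> si; rewrite -pt0 pt_le. Qed.

Lemma pt_leT i : (i <= size s)%N -> pt s i <= T.
Proof. by move=> si; rewrite -pt_size pt_le. Qed.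

Lemma pt_mesh i : (i < size s)%N -> pt s i.+1 - pt s i <= mesh s.
Proof.
move=> si; rewrite /mesh.
by have /= := @le_bigmax _ _ _ 0 (fun j : 'I_(size s) => pt s j.+1 - pt s j) (Ordinal si).
Qed.

Lemma pt_straddle_right a : 0 <= a < T ->
  exists j : 'I_(size s), pt s j <= a < pt s j.+1.
Proof.
move=> /andP[a0 aT].
have ex : exists j, (j <= size s)%N && (a < pt s j).
  by exists (size s); rewrite leqnn pt_size.
case: (ex_minnP ex) => -[|j] /andP[js aj] jmin; first by rewrite pt0 ltNge a0 in aj.
exists (Ordinal js) => /=; rewrite aj andbT leNgt; apply/negP => aj'.
by have := jmin j; rewrite aj' (ltnW js) ltnn => /(_ isT).
Qed.

Lemma pt_straddle_left b : 0 < b <= T ->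
  exists j : 'I_(size s), pt s j < b <= pt s j.+1.
Proof.
move=> /andP[b0 bT].
have ex : exists j, (j <= size s)%N && (b <= pt s j).
  by exists (size s); rewrite leqnn pt_size.
case: (ex_minnP ex) => -[|j] /andP[js bj] jmin; first by rewrite pt0 leNgt b0 in bj.
exists (Ordinal js) => /=; rewrite bj andbT ltNge; apply/negP => bj'.
by have := jmin j; rewrite bj' (ltnW js) ltnn => /(_ isT).
Qed.

End partitions.

Lemma norm_sum_single_le (R : realDomainType) n (d : 'I_n -> R) (k : 'I_n) (e : R) :
  (forall j, j != k -> d j = 0) -> `|d k| <= e -> `|\sum_j d j| <= e.
Proof. by move=> d0 de; rewrite (bigD1 k)//= big1 ?addr0// => j /d0. Qed.

(** One-sided companion of the previous lemma, for comparing a stopped sum with a weighted one: away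
    from the partition interval around the stopping time the differences have a sign but need not
    vanish. *)
Lemma sum_le_of_single_pos (R : realDomainType) n (d : 'I_n -> R) (e : R) :
  0 <= e -> (forall i j, 0 < d i -> 0 < d j -> i = j) -> (forall j, d j <= e) ->
  \sum_j d j <= e.
Proof.
move=> e0 uniq_d de; have [[k dk]|none] := pselect (exists k, 0 < d k).
  rewrite (bigD1 k)//= -[leRHS]addr0 lerD//; apply: sumr_le0 => j jk.
  by rewrite leNgt; apply: contra jk => dj; apply/eqP; exact: uniq_d.
apply: le_trans e0; apply: sumr_le0 => j _; rewrite leNgt.
by apply/negP => dj; apply: none; exists j.
Qed.

Section stopped_sums.
Context {R : realType}.
Implicit Types (G : R -> R -> R) (y : R -> R).

Definition clamp (a b r : R) := Num.min (Num.max r a) b.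

Lemma clamp_itv a b r : a <= b -> a <= clamp a b r <= b.
Proof. by move=> ab; rewrite /clamp le_min ge_min le_max lexx orbT ab lexx orbT. Qed.

Lemma clamp_id a b r : a <= r <= b -> clamp a b r = r.
Proof. by move=> /andP[ar rb]; rewrite /clamp max_l// min_l. Qed.

Lemma clamp_l a b r : a <= b -> r <= a -> clamp a b r = a.
Proof. by move=> ab ra; rewrite /clamp max_r// min_l. Qed.

Lemma clamp_r a b r : a <= b -> b <= r -> clamp a b r = b.
Proof. by move=> ab br; rewrite /clamp min_r// le_max br. Qed.

(** Every partition point is moved into [[a, b]]. An interval outside contributes some [G u u],
    which vanishes for the functionals in use, and an interval that meets [a] or [b] is cut there.
    The index range therefore does not depend on [a] and [b], and sums over different windows are
    compared term by term. *)
Definition stopped_sum G y (s : seq R) (a b : R) :=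
  \sum_(j < size s) G (y (clamp a b (pt s j))) (y (clamp a b (pt s j.+1))).

Definition sqdist (u v : R) := (v - u) ^+ 2.

End stopped_sums.

Section stopped_sum_limits.
Context {R : realType}.
Variables (T : R) (pi : nat -> seq R).
Hypothesis T_gt0 : 0 < T.
Hypothesis pi_partition : forall n, itv_partition 0 T (pi n).
Hypothesis pi_mesh : mesh (pi n) @[n --> \oo] --> 0.
Variables (y yl : R -> R) (N : R).
Hypothesis y_right : forall t e, 0 < e ->
  exists2 d, 0 < d & forall r, t <= r < t + d -> `|y r - y t| <= e.
Hypothesis y_left : forall t e, 0 < e ->
  exists2 d, 0 < d & forall r, t - d < r < t -> `|y r - yl t| <= e.
Hypothesis y_bound : forall t, `|y t| <= N.

Let N_ge0 : 0 <= N. Proof. exact: le_trans (y_bound 0). Qed.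

Let near_mesh d : 0 < d -> \forall n \near \oo, mesh (pi n) < d.
Proof.
move=> d0; have /cvgr0Pnorm_lt/(_ d d0) := pi_mesh.
by apply: filterS => n; exact: le_lt_trans (ler_norm _).
Qed.

Let yB2 s t : `|y s - y t| <= 2 * N.
Proof. by rewrite (le_trans (ler_normB _ _))// mulr2n mulrDl mul1r lerD. Qed.

Section functional.
Variables (G : R -> R -> R) (M : R).
Hypothesis M_ge0 : 0 <= M.
Hypothesis G_bound : forall u v, `|u| <= N -> `|v| <= N -> 0 <= G u v <= M * (v - u) ^+ 2.
Hypothesis G_split : forall u m v, `|u| <= N -> `|m| <= N -> `|v| <= N ->
  `|G u v - G u m - G m v| <= M * `|m - u| * `|v - m|.

Let G0 u : `|u| <= N -> G u u = 0.
Proof.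
move=> uN; have := G_bound uN uN; rewrite subrr expr0n/= mulr0 => G0.
by apply/eqP; rewrite eq_le andbC.
Qed.

(** Only the partition interval [[t_k, t_(k+1)[] that contains [a] is counted differently, being cut
    at [a] in the last two sums. By [G_split] the defect is at most [M] times [|y a - y t_k|], which
    is bounded, times the increment of [y] from [a] to a point at most one mesh later, which is
    small by right continuity. *)
Lemma stopped_sum_additive a b e : 0 <= a <= b -> b <= T -> 0 < e ->
  \forall n \near \oo, `|stopped_sum G y (pi n) 0 b - stopped_sum G y (pi n) 0 a
    - stopped_sum G y (pi n) a b| <= e.
Proof.
move=> /andP[a0 ab] bT e0.
have b0 : 0 <= b := le_trans a0 ab.
have [abE|aNb] := eqVneq a b.
  near=> n; rewrite abE subrr sub0r normrN /stopped_sum big1 ?normr0 ?ltW// => j _.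
  by rewrite /clamp !min_r ?le_max ?lexx ?orbT// G0.
have ltab : a < b by rewrite lt_neqAle aNb.
(* [2 * N] bounds [|y a - y t_k|], and the added 1 keeps the divisor of [e] positive. *)
pose C := M * (2 * N) + 1.
have C0 : 0 < C by rewrite ltr_wpDl// mulr_ge0// mulr_ge0.
have [d d0 yd] := y_right a (divr_gt0 e0 C0).
near=> n.
have md : mesh (pi n) < d by near: n; exact: near_mesh.
have a0T : 0 <= a < T by rewrite a0 (lt_le_trans ltab).
have [k /andP[ka ak]] := pt_straddle_right (pi_partition n) a0T.
have P := pi_partition n.
rewrite /stopped_sum -!sumrB; apply: (norm_sum_single_le (k := k)) => [j jk|].
  have js := ltn_ord j; have tj0 := pt_ge0 P (ltnW js); have tj1 := pt_ge0 P js.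
  have tjj := pt_le P (leqnSn j) js.
  have [ja|aj] := leP (pt (pi n) j.+1) a.
    have ja' := le_trans tjj ja.
    rewrite (clamp_l ab ja) (clamp_l ab ja') G0//.
    by rewrite !clamp_id ?tj0 ?tj1 ?(le_trans ja) ?(le_trans ja')// subrr subr0.
  have aj' : a <= pt (pi n) j.
    rewrite leNgt; apply/negP => ja; move/eqP : jk; apply.
    apply/val_inj => /=; have [jk|kj|//] := ltngtP (j : nat) k.
      by have := le_trans (pt_le P jk (ltnW (ltn_ord k))) ka; rewrite leNgt aj.
    by have := lt_trans (lt_le_trans ak (pt_le P kj (ltnW js))) ja; rewrite ltxx.
  rewrite !(clamp_r a0)// ?(ltW aj)// G0// subr0.
  by rewrite /clamp !(max_l tj0) !(max_l tj1) (max_l aj') (max_l (ltW aj)) subrr.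
have ks := ltn_ord k; have tk0 := pt_ge0 P (ltnW ks); have tk1 := pt_ge0 P ks.
have -> : clamp 0 b (pt (pi n) k) = pt (pi n) k.
  by rewrite clamp_id// tk0 (le_trans ka).
have -> : clamp 0 a (pt (pi n) k) = pt (pi n) k by rewrite clamp_id// tk0.
rewrite (clamp_r a0 (ltW ak)) (clamp_l ab ka).
have -> : clamp 0 b (pt (pi n) k.+1) = clamp a b (pt (pi n) k.+1).
  by rewrite /clamp (max_l tk1) (max_l (ltW ak)).
apply: (le_trans (G_split (y_bound _) (y_bound _) (y_bound _))).
set r := clamp a b _.
have yr : `|y r - y a| <= e / C.
  apply: yd; have /andP[-> _]/= := clamp_itv (pt (pi n) k.+1) ab.
  have := pt_mesh ks; rewrite /r /clamp (max_l (ltW ak)) => mk.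
  by rewrite gt_min; apply/orP; left; lra.
apply: (@le_trans _ _ (C * (e / C))); last by rewrite mulrC divfK ?gt_eqF.
apply: ler_pM => //; first by rewrite mulr_ge0.
rewrite /C (@le_trans _ _ (M * (2 * N)))//; last by rewrite lerDl.
exact: ler_wpM2l.
Unshelve. all: by end_near. Qed.

Lemma stopped_sum_near_right a b n c w : a <= b -> 
  (forall r s, a <= r <= b -> a <= s <= b ->
    `|G (y r) (y s) - c * (y s - y r) ^+ 2| <= w * (y s - y r) ^+ 2) ->
  `|stopped_sum G y (pi n) a b - c * stopped_sum sqdist y (pi n) a b|
    <= w * stopped_sum sqdist y (pi n) a b.
Proof.
move=> ab Gc; rewrite /stopped_sum !mulr_sumr -sumrB.
apply: (le_trans (ler_norm_sum _ _ _)); apply: ler_sum => j _.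
by apply: Gc; exact: clamp_itv.
Qed.

(** The last interval before [b] starts where [y] is close to [yl b], so its term is close to
    [G (yl b) (y b)] and its squared increment to the squared jump. The remaining terms are at most
    [M] times the remaining squared increments. *)
Lemma stopped_sum_near_left a b e : 0 <= a < b -> b <= T -> `|yl b| <= N -> 0 < e ->
  \forall n \near \oo, `|stopped_sum G y (pi n) a b - G (yl b) (y b)|
    <= M * (stopped_sum sqdist y (pi n) a b - (y b - yl b) ^+ 2) + e.
Proof.
move=> /andP[a0 ab] bT ylN e0.
(* Replacing [u] by [yl b] costs [4 * (M * N) * |u - yl b|] in [G u (y b)], by [G_split] and
   [G_bound], and as much again in [M] times the squared increment. *)
pose C := 8 * (M * N) + 1.
have C0 : 0 < C by rewrite ltr_wpDl// mulr_ge0// mulr_ge0.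
have [d d0 yd] := y_left b (divr_gt0 e0 C0).
near=> n.
have md : mesh (pi n) < d by near: n; exact: near_mesh.
have mab : mesh (pi n) < b - a by near: n; apply: near_mesh; rewrite subr_gt0.
have P := pi_partition n.
have b0T : 0 < b <= T by rewrite (le_lt_trans a0 ab).
have [k /andP[kb bk]] := pt_straddle_left P b0T.
have ks := ltn_ord k; have mk := pt_mesh ks.
have tka : a <= pt (pi n) k by lra.
set u := y (pt (pi n) k).
have uyl : `|u - yl b| <= e / C by apply: yd; rewrite kb andbT; lra.
rewrite /stopped_sum (bigD1 k)//= [X in M * (X - _)](bigD1 k)//=.
have ckE : clamp a b (pt (pi n) k) = pt (pi n) k by rewrite clamp_id// tka ltW.
rewrite ckE (clamp_r (ltW ab) bk) -/u.
set S1 := \sum_(j < _ | _) G _ _; set S2 := \sum_(j < _ | _) sqdist _ _.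
have S10 : 0 <= S1.
  by apply: sumr_ge0 => j _; have /andP[] := G_bound (y_bound (clamp a b (pt (pi n) j)))
    (y_bound (clamp a b (pt (pi n) j.+1))).
have S12 : S1 <= M * S2.
  rewrite mulr_sumr; apply: ler_sum => j _.
  by have /andP[] := G_bound (y_bound (clamp a b (pt (pi n) j)))
    (y_bound (clamp a b (pt (pi n) j.+1))).
have uN : `|u| <= N by exact: y_bound.
have bN : `|y b| <= N by exact: y_bound.
have H1 : `|G u (y b) - G (yl b) (y b)| <= M * (4 * N) * `|u - yl b|.
  have /ler_normlP[K1 K2] := G_split uN ylN bN.
  have /andP[K3 K4] := G_bound uN ylN.
  have h1 : `|yl b - u| * `|y b - yl b| <= `|u - yl b| * (2 * N).
    rewrite distrC; apply: ler_wpM2l => //.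
    by rewrite (le_trans (ler_normB _ _))// mulr2n mulrDl mul1r lerD.
  have h2 : (yl b - u) ^+ 2 <= `|u - yl b| * (2 * N).
    rewrite -real_normK ?num_real// expr2 distrC; apply: ler_wpM2l => //.
    by rewrite (le_trans (ler_normB _ _))// mulr2n mulrDl mul1r lerD.
  have h1M := ler_wpM2l M_ge0 h1; have h2M := ler_wpM2l M_ge0 h2.
  rewrite -!mulrA in K1 K2.
  by apply/ler_normlP; split; lra.
have H2 : `|(y b - u) ^+ 2 - (y b - yl b) ^+ 2| <= 4 * N * `|u - yl b|.
  have -> : (y b - u) ^+ 2 - (y b - yl b) ^+ 2 =
      (yl b - u) * ((y b - u) + (y b - yl b)) by ring.
  rewrite normrM mulrC distrC; apply: ler_wpM2r => //.
  apply: (le_trans (ler_normD _ _)).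
  have := ler_normB (y b) u; have := ler_normB (y b) (yl b); lra.
rewrite /sqdist mulrBr mulrDr.
have H2M := ler_wpM2l M_ge0 H2.
have He : 8 * (M * N) * `|u - yl b| <= e.
  apply: (@le_trans _ _ (C * (e / C))); last by rewrite mulrC divfK ?gt_eqF.
  by apply: ler_pM => //; [rewrite mulr_ge0// mulr_ge0|rewrite /C lerDl].
have {}H2M : M * `|(y b - u) ^+ 2 - (y b - yl b) ^+ 2| <= 4 * (M * N) * `|u - yl b|.
  by apply: (le_trans H2M); rewrite le_eqVlt; apply/orP; left; apply/eqP; ring.
have {}H1 : `|G u (y b) - G (yl b) (y b)| <= 4 * (M * N) * `|u - yl b|.
  by apply: (le_trans H1); rewrite le_eqVlt; apply/orP; left; apply/eqP; ring.
have H3 : - (M * `|(y b - u) ^+ 2 - (y b - yl b) ^+ 2|)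
    <= M * (y b - u) ^+ 2 - M * (y b - yl b) ^+ 2.
  by rewrite -mulrBr -mulrN; apply: ler_wpM2l => //; rewrite lerNl -normrN ler_norm.
apply: (@le_trans _ _ (`|G u (y b) - G (yl b) (y b)| + S1)).
  rewrite addrAC (le_trans (ler_normD _ _))// lerD2l ger0_norm//.
by lra.
Unshelve. all: by end_near. Qed.

End functional.

Section quadratic_sums.
Variables (F : R -> R).
Hypothesis yl_bound : forall t, `|yl t| <= N.
Hypothesis test_above : forall t e, 0 <= t <= T -> 0 < e ->
  exists g : R -> R, [/\ forall s, 0 <= g s, forall s, 0 <= s <= t -> 1 <= g s &
    \forall n \near \oo, \sum_(j < size (pi n)) g (pt (pi n) j) *
      (y (pt (pi n) j.+1) - y (pt (pi n) j)) ^+ 2 <= F t + e].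
Hypothesis test_below : forall t e, 0 < t <= T -> 0 < e ->
  exists g : R -> R, [/\ forall s, 0 <= g s <= 1,
    exists2 d, 0 < d & forall s, t - d <= s -> g s = 0 &
    \forall n \near \oo, F t - (y t - yl t) ^+ 2 - e <=
      \sum_(j < size (pi n)) g (pt (pi n) j) *
      (y (pt (pi n) j.+1) - y (pt (pi n) j)) ^+ 2].
Hypothesis F0 : F 0 = 0.

Let sq_near u v w : `|u| <= N -> `|v| <= N -> `|w| <= N ->
  `|(v - u) ^+ 2 - (w - u) ^+ 2| <= 4 * N * `|v - w|.
Proof.
move=> uN vN wN.
have -> : (v - u) ^+ 2 - (w - u) ^+ 2 = (v - w) * ((v - u) + (w - u)) by ring.
rewrite normrM mulrC; apply: ler_wpM2r => //.
apply: (le_trans (ler_normD _ _)).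
have := ler_normB v u; have := ler_normB w u; lra.
Qed.

Let sqsum n t := stopped_sum sqdist y (pi n) 0 t.

(** Test functions that dominate the indicator of [[0, t]] bound the stopped sums from above, up to
    the interval around [t], where right continuity compares [y t] with the next partition value.
    From below, the test function stays away from [t]: it captures the mass before [t], and the
    interval that reaches [t] supplies the squared jump. *)
Lemma stopped_sqsum_cvg t e : 0 <= t <= T -> 0 < e ->
  \forall n \near \oo, `|sqsum n t - F t| <= e.
Proof.
move=> /andP[t0 tT] e0; have e20 : 0 < e / 2 by rewrite divr_gt0.
pose C := 4 * N + 1; have C0 : 0 < C by rewrite ltr_wpDl// mulr_ge0.
have small (a : R) : `|a| <= e / 2 / C -> 4 * N * `|a| <= e / 2.
  move=> ae; apply: (@le_trans _ _ (C * (e / 2 / C))); last first.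
    by rewrite mulrC divfK ?gt_eqF.
  by apply: ler_pM => //; [rewrite mulr_ge0|rewrite /C lerDl].
have up : \forall n \near \oo, sqsum n t <= F t + e.
  have [|g [g0 g1 gF]] := test_above (t := t) _ e20; first by rewrite t0.
  have [d d0 yd] := y_right t (divr_gt0 e20 C0).
  apply: filterS2 gF (near_mesh d0) => n gn md.
  have P := pi_partition n.
  suff : sqsum n t - \sum_(j < size (pi n)) g (pt (pi n) j) *
      (y (pt (pi n) j.+1) - y (pt (pi n) j)) ^+ 2 <= e / 2 by lra.
  rewrite /sqsum /stopped_sum -sumrB.
  (* An interval without [t] in its interior is either entirely stopped, or complete and then
     weighted by [g] at least 1. *)
  have neg (j : 'I_(size (pi n))) : ~~ (pt (pi n) j < t < pt (pi n) j.+1) ->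
      sqdist (y (clamp 0 t (pt (pi n) j))) (y (clamp 0 t (pt (pi n) j.+1))) -
      g (pt (pi n) j) * (y (pt (pi n) j.+1) - y (pt (pi n) j)) ^+ 2 <= 0.
    move=> jt; have js := ltn_ord j.
    have tj0 := pt_ge0 P (ltnW js); have tj1 := pt_ge0 P js.
    have tjj := pt_le P (leqnSn j) js.
    have [jlt|tlej] := ltP (pt (pi n) j) t.
      move: jt; rewrite jlt/= -leNgt => j1t.
      rewrite !clamp_id ?tj0 ?tj1 ?(ltW jlt)// /sqdist.
      rewrite subr_le0 ler_peMl ?sqr_ge0// g1// tj0 ltW//.
    rewrite !clamp_r ?(le_trans tlej)// /sqdist subrr expr0n/= sub0r oppr_le0.
    by rewrite mulr_ge0// sqr_ge0.
  apply: sum_le_of_single_pos => [|i j di dj|j]; first exact: ltW.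
    have /andP[it ti] : pt (pi n) i < t < pt (pi n) i.+1.
      by apply/negPn/negP => /neg; rewrite leNgt di.
    have /andP[jt tj] : pt (pi n) j < t < pt (pi n) j.+1.
      by apply/negPn/negP => /neg; rewrite leNgt dj.
    apply/val_inj => /=; have [ij|ji|//] := ltngtP (i : nat) j.
      have := lt_trans jt ti; rewrite ltNge (pt_le P)//.
      exact: ltnW.
    have := lt_trans it tj; rewrite ltNge (pt_le P)//.
    exact: ltnW.
  have [/andP[jt tj]|/neg] := boolP (pt (pi n) j < t < pt (pi n) j.+1); last first.
    by move=> /le_trans; apply; exact: ltW.
  have js := ltn_ord j; have mj := pt_mesh js.
  have tj0 := pt_ge0 P (ltnW js).
  rewrite clamp_id ?tj0 ?(ltW jt)// clamp_r ?(ltW tj)// /sqdist.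
  have yr : `|y t - y (pt (pi n) j.+1)| <= e / 2 / C.
    by rewrite distrC; apply: yd; rewrite ltW//=; lra.
  have := sq_near (y_bound (pt (pi n) j)) (y_bound t) (y_bound (pt (pi n) j.+1)).
  have := small (y t - y (pt (pi n) j.+1)) yr.
  move=> h1 /ler_normlP[_ h2].
  have h3 : (y (pt (pi n) j.+1) - y (pt (pi n) j)) ^+ 2 <=
      g (pt (pi n) j) * (y (pt (pi n) j.+1) - y (pt (pi n) j)) ^+ 2.
    by rewrite ler_peMl ?sqr_ge0// g1// tj0 ltW.
  by lra.
have lo : \forall n \near \oo, F t - e <= sqsum n t.
  have [tz|tN0] := eqVneq t 0.
    apply: nearW => n; rewrite tz F0 sub0r; apply: (@le_trans _ _ 0).
      by rewrite oppr_le0 ltW.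
    by rewrite /sqsum /stopped_sum sumr_ge0// => j _; exact: sqr_ge0.
  have t0' : 0 < t by rewrite lt_neqAle eq_sym tN0.
  have [|g [g01 [d d0 gd] gF]] := test_below (t := t) _ e20; first by rewrite t0'.
  have [d' d'0 yd] := y_left t (divr_gt0 e20 C0).
  apply: filterS3 gF (near_mesh d0) (near_mesh d'0) => n gn md md'.
  have P := pi_partition n.
  have [|k /andP[kt tk]] := pt_straddle_left P (b := t); first by rewrite t0'.
  have ks := ltn_ord k; have mk := pt_mesh ks.
  have tk0 := pt_ge0 P (ltnW ks).
  move: gn; rewrite /sqsum /stopped_sum (bigD1 k)//= [X in _ -> _ <= X](bigD1 k)//=.
  (* The mesh is below [d], so [g] vanishes at the left end of the interval that reaches [t], and
     its term in the stopped sum is free to account for the jump. *)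
  rewrite gd ?mul0r ?add0r; last by lra.
  rewrite clamp_id ?tk0 ?(ltW kt)// clamp_r//.
  have -> : sqdist (y (pt (pi n) k)) (y t) = (y t - y (pt (pi n) k)) ^+ 2 by [].
  move=> gn.
  have yr : `|yl t - y (pt (pi n) k)| <= e / 2 / C.
    by rewrite distrC; apply: yd; rewrite kt andbT; lra.
  have := sq_near (y_bound t) (yl_bound t) (y_bound (pt (pi n) k)).
  have := small (yl t - y (pt (pi n) k)) yr.
  have -> : (yl t - y t) ^+ 2 = (y t - yl t) ^+ 2 by ring.
  have -> : (y (pt (pi n) k) - y t) ^+ 2 = (y t - y (pt (pi n) k)) ^+ 2 by ring.
  move=> h1 /ler_normlP[_ h2].
  have h3 : \sum_(j < size (pi n) | j != k) g (pt (pi n) j) *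
      (y (pt (pi n) j.+1) - y (pt (pi n) j)) ^+ 2 <=
    \sum_(j < size (pi n) | j != k)
      sqdist (y (clamp 0 t (pt (pi n) j))) (y (clamp 0 t (pt (pi n) j.+1))).
    apply: ler_sum => j _; have js := ltn_ord j; have mj := pt_mesh js.
    have [tj|jt] := leP (t - d) (pt (pi n) j); first by rewrite gd// mul0r sqr_ge0.
    have tj0 := pt_ge0 P (ltnW js); have tj1 := pt_ge0 P js.
    rewrite !clamp_id ?tj0 ?tj1//=; [|lra|lra].
    by have /andP[_ gj1] := g01 (pt (pi n) j); rewrite ler_piMl ?sqr_ge0.
  by lra.
apply: filterS2 up lo => n up lo.
by apply/ler_normlP; split; lra.
Qed.

End quadratic_sums.

Section limit.
Variables (G : R -> R -> R) (M : R).
Hypothesis M_ge0 : 0 <= M.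
Hypothesis G_bound : forall u v, `|u| <= N -> `|v| <= N -> 0 <= G u v <= M * (v - u) ^+ 2.
Hypothesis G_split : forall u m v, `|u| <= N -> `|m| <= N -> `|v| <= N ->
  `|G u v - G u m - G m v| <= M * `|m - u| * `|v - m|.
Variables (F Phi c : R -> R).
Hypothesis yl_bound : forall t, `|yl t| <= N.
Hypothesis F0 : 0 <= F 0.
Hypothesis F_nd : forall a b, 0 <= a <= b -> b <= T -> F a <= F b.
Hypothesis F_left : forall b e, 0 < b <= T -> 0 < e ->
  exists2 d, 0 < d & forall a, b - d < a < b -> F b - F a - (y b - yl b) ^+ 2 <= e.
Hypothesis sqsum_cvg : forall t e, 0 <= t <= T -> 0 < e ->
  \forall n \near \oo, `|stopped_sum sqdist y (pi n) 0 t - F t| <= e.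
Hypothesis G_local : forall t w, 0 < w -> exists2 d, 0 < d & forall u v,
  `|u - y t| <= d -> `|v - y t| <= d ->
  `|G u v - c t * (v - u) ^+ 2| <= w * (v - u) ^+ 2.
Hypothesis Phi0 : Phi 0 = 0.
Hypothesis Phi_right : forall a w, 0 <= a < T -> 0 < w -> exists2 d, 0 < d &
  forall b, a < b < a + d -> b <= T ->
    `|Phi b - Phi a - c a * (F b - F a)| <= w * (F b - F a).
Hypothesis Phi_left : forall a b, 0 <= a < b -> b <= T ->
  `|Phi b - Phi a - G (yl b) (y b)| <= M * (F b - F a - (y b - yl b) ^+ 2).

(** The squared distance itself satisfies [G_bound] and [G_split] with constant 2, so additivity
    applies to it. *)
Let sqsum_increment a b e : 0 <= a <= b -> b <= T -> 0 < e ->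
  \forall n \near \oo, `|stopped_sum sqdist y (pi n) a b - (F b - F a)| <= e.
Proof.
move=> /andP[a0 ab] bT e0; have e30 : 0 < e / 3 by rewrite divr_gt0.
have aT : 0 <= a <= T by rewrite a0 (le_trans ab).
have bT' : 0 <= b <= T by rewrite (le_trans a0).
have aab : 0 <= a <= b by rewrite a0.
have sqB u v : `|u| <= N -> `|v| <= N -> 0 <= sqdist u v <= 2 * (v - u) ^+ 2.
  by move=> _ _; rewrite /sqdist sqr_ge0/= mulr_natl mulr2n lerDl sqr_ge0.
have sqS u m v : `|u| <= N -> `|m| <= N -> `|v| <= N ->
    `|sqdist u v - sqdist u m - sqdist m v| <= 2 * `|m - u| * `|v - m|.
  move=> _ _ _; rewrite /sqdist (_ : _ - _ - _ = 2 * (m - u) * (v - m)); last by ring.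
  by rewrite !normrM [`|2|]ger0_norm.
have H1 := stopped_sum_additive (ler0n R 2) sqB sqS aab bT e30.
have H2 := sqsum_cvg aT e30; have H3 := sqsum_cvg bT' e30.
apply: filterS3 H1 H2 H3 => n /ler_normlP[h1 h1'] /ler_normlP[h2 h2'] /ler_normlP[h3 h3'].
by apply/ler_normlP; split; lra.
Qed.

(** Real induction on the bound [eps * F t + eta], with [eps] fixed and [eta] arbitrary. The first
    term absorbs the local errors, which are proportional to increments of [F] and so telescope; the
    second absorbs what vanishes as the mesh does and can be chosen afresh at every step. A bound by
    a constant alone would not survive infinitely many steps. *)
Theorem stopped_sum_cvg t e : 0 <= t <= T -> 0 < e ->
  \forall n \near \oo, `|stopped_sum G y (pi n) 0 t - Phi t| <= e.
Proof.
move=> tT e0.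
suff H eps : 0 < eps -> forall t, 0 <= t <= T -> forall eta, 0 < eta ->
    \forall n \near \oo, `|stopped_sum G y (pi n) 0 t - Phi t| <= eps * F t + eta.
  have Ft0 : 0 <= F t.
    by case/andP: tT => t0 tT; apply: (le_trans F0); apply: F_nd => //; rewrite lexx.
  have Ft1 : 0 < F t + 1 by rewrite ltr_wpDl.
  have eps0 : 0 < e / 2 / (F t + 1) by rewrite !divr_gt0.
  have := H _ eps0 _ tT (e / 2) (divr_gt0 e0 (ltr0Sn R 1)).
  apply: filterS => n /le_trans; apply.
  rewrite [leRHS]splitr lerD2r.
  apply: (@le_trans _ _ (e / 2 / (F t + 1) * (F t + 1))); last by rewrite divfK ?gt_eqF.
  by rewrite ler_wpM2l ?(ltW eps0)// lerDl.
move=> eps0 {t e tT e0}; apply: real_induction => [eta eta0|a aT Pa|b bT Pb eta eta0].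
- apply: nearW => n; rewrite Phi0 subr0 /stopped_sum big1 ?normr0.
    by rewrite addr_ge0 ?(ltW eta0)// mulr_ge0 ?(ltW eps0).
  move=> j _; rewrite /clamp !min_r ?le_max ?lexx ?orbT//.
  have := G_bound (y_bound 0) (y_bound 0); rewrite subrr expr0n/= mulr0 => G0.
  by apply/eqP; rewrite eq_le andbC.
(* Half of [eps] pays for replacing [G] by its quadratic approximation, half for the same
   replacement in [Phi]. *)
- have w0 : 0 < eps / 2 by rewrite divr_gt0.
  have [d1 d10 G1] := G_local a w0.
  have [d2 d20 y2] := y_right a d10.
  have [d3 d30 Phi3] := Phi_right aT w0.
  exists (Num.min d2 d3); first by rewrite lt_min d20.
  move=> b /andP[ab]; rewrite -ltrBlDl lt_min => /andP[bd2 bd3] bT eta eta0.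
  case/andP: (aT) => a0 ltaT.
  have aab : 0 <= a <= b by rewrite a0 ltW.
  have yab r : a <= r <= b -> `|y r - y a| <= d1.
    by move=> /andP[ar rb]; apply: y2; rewrite ar/=; lra.
  pose w := eps / 2; pose K := `|c a| + w + 1.
  have K0 : 0 < K by rewrite /K ltr_wpDl// addr_ge0// ltW.
  have k0 : 0 < eta / 4 / K by rewrite !divr_gt0.
  have H1 := Pa _ (divr_gt0 eta0 (ltr0Sn R 3)).
  have H2 := stopped_sum_additive M_ge0 G_bound G_split aab bT (divr_gt0 eta0 (ltr0Sn R 3)).
  have H3 := sqsum_increment aab bT k0.
  have abd : a < b < a + d3 by rewrite ab; lra.
  have /ler_normlP[h4 h4'] := Phi3 _ abd bT.
  apply: filterS3 H1 H2 H3 => n.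
  move=> /ler_normlP[h1 h1'] /ler_normlP[h2 h2'] /ler_normlP[h3 h3'].
  have /ler_normlP[h5 h5'] := @stopped_sum_near_right G a b n (c a) w (ltW ab)
    (fun r s ar as_ => G1 _ _ (yab _ ar) (yab _ as_)).
  set V := stopped_sum sqdist y (pi n) a b in h3 h3' h5 h5'.
  set D := F b - F a in h3 h3' h4 h4' *.
  have Kk : (`|c a| + w) * (eta / 4 / K) <= eta / 4.
    apply: (@le_trans _ _ (K * (eta / 4 / K))); last by rewrite mulrC divfK ?gt_eqF.
    by rewrite ler_wpM2r ?(ltW k0)// /K lerDl.
  have h6 : `|c a * (V - D)| <= `|c a| * (eta / 4 / K).
    by rewrite normrM ler_wpM2l//; apply/ler_normlP; split; lra.
  have /ler_normlP[h7 h7'] := h6.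
  have h8 : w * V <= w * (D + eta / 4 / K) by rewrite ler_wpM2l ?(ltW w0)//; lra.
  have FbE : eps * F b = eps * F a + w * D + w * D by rewrite /w /D; field.
  rewrite FbE; rewrite /w in h4 h4' h5 h5' h7 h7' h8 Kk *.
  by apply/ler_normlP; split; lra.
- case/andP: (bT) => b0 leT.
  (* Close to [b] the increment of [F] exceeds the squared jump by at most [k0], and the squared
     sums exceed it by at most [2 * k0]. Both are multiplied by [M], and the divisor [16 * (M + 1)]
     keeps the products within the share of [eta] left by the other errors. *)
  have M10 : 0 < 16 * (M + 1) by rewrite mulr_gt0// ltr_wpDl.
  have k0 : 0 < eta / (16 * (M + 1)) by rewrite divr_gt0.
  have [d d0 Fd] := F_left bT k0.
  pose a := Num.max 0 (b - d / 2).
  have ab : a < b by rewrite gt_max b0/=; lra.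
  have a0 : 0 <= a by rewrite le_max lexx.
  have abd : b - d < a < b by rewrite ab andbT lt_max; apply/orP; right; lra.
  have aab : 0 <= a <= b by rewrite a0 ltW.
  have aab' : 0 <= a < b by rewrite a0.
  have H1 := Pb a aab' _ (divr_gt0 eta0 (ltr0Sn R 7)).
  have H2 := stopped_sum_additive M_ge0 G_bound G_split aab leT (divr_gt0 eta0 (ltr0Sn R 7)).
  have H3 := sqsum_increment aab leT k0.
  have H5 := stopped_sum_near_left M_ge0 G_bound G_split aab' leT (yl_bound b)
    (divr_gt0 eta0 (ltr0Sn R 7)).
  have h6 := Fd _ abd.
  have /ler_normlP[h4 h4'] := Phi_left aab' leT.
  have Fab : eps * F a <= eps * F b.
    by rewrite ler_wpM2l ?(ltW eps0)//; apply: F_nd.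
  apply: filter_app H5; apply: filterS3 H1 H2 H3 => n.
  move=> /ler_normlP[h1 h1'] /ler_normlP[h2 h2'] /ler_normlP[h3 h3'] /ler_normlP[h5 h5'].
  have Mk : M * (eta / (16 * (M + 1))) <= eta / 16.
    have -> : eta / 16 = (M + 1) * (eta / (16 * (M + 1))) by field; rewrite gt_eqF ?ltr_wpDl.
    by rewrite ler_wpM2r ?(ltW k0)// lerDl.
  have h7 : M * (F b - F a - (y b - yl b) ^+ 2) <= M * (eta / (16 * (M + 1))).
    exact: ler_wpM2l.
  have h8 : M * (stopped_sum sqdist y (pi n) a b - (y b - yl b) ^+ 2) <=
      M * (eta / (16 * (M + 1)) + eta / (16 * (M + 1))).
    by apply: ler_wpM2l => //; lra.
  rewrite mulrDr in h8.
  by apply/ler_normlP; split; lra.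
Qed.

End limit.

End stopped_sum_limits.

(** * Cadlag paths, extended by constants beyond [0, T] *)

Section cadlag_paths.
Context {R : realType}.
Variables (T : R) (x : R -> R).
Hypothesis T_gt0 : 0 < T.
Hypothesis x_cadlag : cadlag T x.

Definition stopped (r : R) := x (clamp 0 T r).

(** Just before a time outside []0, T]] the stopped path is constant, and its left limit is written
    out: for negative times and after [T], [left_value] would look at values of [x] outside of
    [[0, T]]. *)
Definition stopped_left (t : R) :=
  if t <= 0 then x 0 else if T < t then x T else left_value x t.

Local Notation y := stopped.
Local Notation yl := stopped_left.

Lemma stoppedE t : 0 <= t <= T -> y t = x t.
Proof. by move=> tT; rewrite /y clamp_id. Qed.

Lemma stopped_leftE t : 0 < t <= T -> yl t = left_value x t.
Proof. by move=> /andP[t0 tT]; rewrite /yl [t <= 0]leNgt t0/= ltNge tT. Qed.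

Lemma stopped_right t e : 0 < e ->
  exists2 d, 0 < d & forall r, t <= r < t + d -> `|y r - y t| <= e.
Proof.
move=> e0; have T0 := ltW T_gt0.
have [t0|t0] := ltP t 0.
  exists (- t); first by rewrite oppr_gt0.
  move=> r /andP[_]; rewrite subrr => r0.
  by rewrite /y !clamp_l ?subrr ?normr0// ltW.
have [tT|Tt] := ltP t T; last first.
  exists 1 => // r /andP[tr _].
  by rewrite /y !clamp_r ?subrr ?normr0 ?(ltW e0)// (le_trans Tt).
have /cvgrPdist_le/(_ _ e0) : x r @[r --> t^'+] --> x t.
  by apply: (proj1 x_cadlag); rewrite t0.
rewrite near_withinE => -[d /= d0 xd].
exists (Num.min d (T - t)); first by rewrite lt_min d0 subr_gt0.
move=> r /andP[tr]; rewrite -ltrBlDl lt_min => /andP[rd rT].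
rewrite !stoppedE ?t0 ?(ltW tT) ?(le_trans t0)//=; last by lra.
have [->|rt] := eqVneq r t; first by rewrite subrr normr0 ltW.
rewrite distrC; apply: xd; last by rewrite lt_neqAle eq_sym rt.
by rewrite /= distrC ger0_norm ?subr_ge0.
Qed.

Lemma stopped_left_limit t e : 0 < e ->
  exists2 d, 0 < d & forall r, t - d < r < t -> `|y r - yl t| <= e.
Proof.
move=> e0; have T0 := ltW T_gt0.
have [t0|t0] := leP t 0.
  exists 1 => // r /andP[_ rt].
  by rewrite /y /yl t0 clamp_l ?subrr ?normr0 ?(ltW e0)// ltW// (lt_le_trans rt).
have [Tt|tT] := ltP T t.
  exists (t - T); first by rewrite subr_gt0.
  move=> r /andP[+ _]; rewrite subKr => Tr.
  by rewrite /y /yl [t <= 0]leNgt t0/= Tt clamp_r ?subrr ?normr0 ?(ltW e0)// ltW.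
have : x r @[r --> t^'-] --> yl t.
  rewrite stopped_leftE ?t0// /left_value gt_eqF//.
  by apply: (proj2 x_cadlag); rewrite t0.
move=> /cvgrPdist_le/(_ _ e0); rewrite near_withinE => -[d /= d0 xd].
exists (Num.min d t); first by rewrite lt_min d0.
move=> r /andP[+ rt]; rewrite ltrBlDr -ltrBlDl lt_min => /andP[rd r0].
rewrite stoppedE; last by apply/andP; split; lra.
rewrite distrC; apply: xd => //.
by rewrite /= ger0_norm ?subr_ge0 ?ltW//; lra.
Qed.

(** Real induction again: a bound up to [a] extends to the right by right continuity, and a bound up
    to some point close to [b] extends to [b] through the left limit and the value at [b]. *)
Lemma stopped_bounded : exists N, forall t, `|y t| <= N.
Proof.
have : exists N, forall r, 0 <= r <= T -> `|y r| <= N.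
  apply: (@real_induction R (fun t => exists N, forall r, 0 <= r <= t -> `|y r| <= N) T);
    last by rewrite lexx ltW.
  - by exists `|y 0| => r r0; have /eqP <- : 0 == r by rewrite eq_le.
  - move=> a aT [N yN]; have [d d0 yd] := stopped_right a (ltr01 : 0 < (1:R)).
    exists d => // b /andP[ab bd] bT; exists (Num.max N (`|y a| + 1)) => r /andP[r0 rb].
    rewrite le_max; have [ra|ar] := leP r a; first by rewrite yN ?r0.
    apply/orP; right; rewrite -(subrK (y a) (y r)) (le_trans (ler_normD _ _))//.
    by rewrite addrC lerD2l yd// (ltW ar) (le_lt_trans rb).
  - move=> b /andP[b0 bT] Pb; have [d d0 yd] := stopped_left_limit b (ltr01 : 0 < (1:R)).
    pose a := Num.max 0 (b - d / 2).
    have ab : 0 <= a < b by rewrite le_max lexx/= gt_max b0/=; lra.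
    have [N yN] := Pb a ab.
    exists (Num.max (Num.max N (`|yl b| + 1)) `|y b|) => r /andP[r0 rb].
    rewrite !le_max; have [ra|ar] := leP r a; first by rewrite yN ?r0.
    move: rb; rewrite le_eqVlt => /predU1P[->|rb]; first by rewrite lexx !orbT.
    apply/orP; left; apply/orP; right.
    rewrite -(subrK (yl b) (y r)) (le_trans (ler_normD _ _))//.
    rewrite addrC lerD2l yd// rb andbT.
    by move: ar; rewrite gt_max => /andP[_]; lra.
move=> [N yN]; exists N => t; rewrite /y -stoppedE; last exact: clamp_itv (ltW T_gt0).
by apply: yN; exact: clamp_itv (ltW T_gt0).
Qed.

Lemma stopped_left_bounded N : (forall t, `|y t| <= N) -> forall t, `|yl t| <= N.
Proof.
move=> yN t; apply/ler_addgt0Pr => e e0.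
have [d d0 yd] := stopped_left_limit t e0.
have := yd (t - d / 2); have := yN (t - d / 2).
move=> h1 h2; rewrite -(subKr (y (t - d / 2)) (yl t)).
rewrite (le_trans (ler_normB _ _))// lerD//; apply: h2.
by apply/andP; split; lra.
Qed.

(** By right continuity [y] is the pointwise limit of the step functions that read [y] at the next
    point strictly to the right on a grid of step [1 / (n + 1)]; a preimage under such a step
    function is a countable union of grid cells. *)
Lemma measurable_stopped : measurable_fun setT y.
Proof.
pose g n (r : R) : R := (Num.floor (n.+1%:R * r) + 1)%:~R / n.+1%:R.
apply: (@measurable_fun_cvg _ _ _ setT (fun n r => y (g n r))).
  move=> n _ A mA; rewrite setTI.
  pose B (m : int) : set R := if `[< A (y ((m + 1)%:~R / n.+1%:R)) >]
    then `[m%:~R / n.+1%:R, (m + 1)%:~R / n.+1%:R[%classic else set0.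
  have n0 : 0 < n.+1%:R :> R by [].
  rewrite (_ : _ @^-1` A = \bigcup_m B m).
    apply: countable_bigcupT_measurable => [|m]; first exact: countableP.
    by rewrite /B; case: ifP => // _; exact: measurable_itv.
  apply/seteqP; split => [r Ar|r [m _]].
    exists (Num.floor (n.+1%:R * r)) => //; rewrite /B ifT; last exact/asboolP.
    rewrite /= in_itv/= ler_pdivrMr// ltr_pdivlMr// [r * _]mulrC.
    exact: floor_itv.
  rewrite /B; case: ifPn => // /asboolP Am.
  rewrite /= in_itv/= ler_pdivrMr// ltr_pdivlMr// [r * _]mulrC => /floor_def fm.
  by rewrite /= /g fm.
move=> r _; apply/cvgrPdist_le => e e0.
have [d d0 yd] := stopped_right r e0.
near=> n; rewrite distrC; apply: yd.
have n0 : 0 < n.+1%:R :> R by [].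
have /andP[h1 h2] := floor_itv (n.+1%:R * r).
rewrite /g ler_pdivlMr// ltr_pdivrMr// mulrC (ltW h2)/= mulrDl intrD [r * _]mulrC.
apply: ler_ltD => //; rewrite mulrC -ltr_pdivrMr//.
apply: (@lt_trans _ _ n%:R); last by rewrite ltr_nat.
by near: n; exact: nbhs_infty_gtr.
Unshelve. all: by end_near. Qed.

End cadlag_paths.

(** * Taylor's formula with integral remainder *)

Section fubini_real.
Context d1 d2 (T1 : measurableType d1) (T2 : measurableType d2) (R : realType).
Variables (m1 : {sigma_finite_measure set T1 -> \bar R})
  (m2 : {sigma_finite_measure set T2 -> \bar R}).

(** The inner integrals are finite almost everywhere only, and [fine] changes them on a null set. *)
Lemma Rintegral_fubini (g : T1 * T2 -> R) :
  (m1 \x m2)%E.-integrable setT (EFin \o g) ->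
  \int[m1]_x \int[m2]_y g (x, y) = \int[m2]_y \int[m1]_x g (x, y).
Proof.
move=> ig; rewrite /Rintegral; congr fine.
transitivity (\int[m1]_x \int[m2]_y (EFin \o g) (x, y))%E.
  have iF := integrable_fubini_F ig; have mF := measurable_int _ iF.
  apply: ae_eq_integral => //.
    exact/measurable_EFinP/(measurableT_comp (fine_measurable measurableT) mF).
  have := integrable_ae measurableT iF; apply: filterS => x /(_ I) Fx _.
  by rewrite fineK.
rewrite Fubini//.
have mG := measurable_fubini_G ig.
apply: ae_eq_integral => //.
  exact/measurable_EFinP/(measurableT_comp (fine_measurable measurableT) mG).
have := ae_integrable2 ig; apply: filterS => y iy _.
by rewrite fineK// integrable_fin_num.
Qed.

End fubini_real.

Section taylor.
Context {R : realType}.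
Local Notation lam := (@lebesgue_measure R).

Definition taylor_kernel (a b r : R) : R := `|b - r| * \1_(between a b) r.

Lemma taylor_kernel_ge0 a b r : 0 <= taylor_kernel a b r.
Proof. by rewrite mulr_ge0// indicE; case: (_ \in _). Qed.

Lemma measurable_between (a b : R) : measurable (between a b).
Proof. by rewrite /between; case: ifP => _; exact: measurable_itv. Qed.

Lemma measurable_taylor_kernel a b : measurable_fun setT (taylor_kernel a b).
Proof.
apply: measurable_funM; last by apply: measurable_indic; exact: measurable_between.
by apply: (measurableT_comp (@normr_measurable _ _)); exact: measurable_funB.
Qed.

Lemma indic_itvE (i : interval R) r : \1_([set` i] : set R) r = (r \in i)%:R :> R.
Proof. by rewrite indicE mem_setE. Qed.

(** The factor vanishes at [b], so for [a <= b] the interval may be closed, as the integrals over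
    compact intervals in Taylor's formula produce it. For [b < a] the end [a] stays excluded. *)
Lemma taylor_kernelE a b r : taylor_kernel a b r =
  if a <= b then (b - r) * \1_(`[a, b]) r else (r - b) * \1_(`[b, a[) r.
Proof.
rewrite /taylor_kernel /between; case: ifPn => ab; rewrite !indic_itvE !in_itv/=.
  have [->|rb] := eqVneq r b; first by rewrite subrr normr0 !mul0r.
  rewrite [r <= b]le_eqVlt (negbTE rb)/=.
  have [/andP[ar rb']|] := boolP (a <= r < b); last by rewrite !mulr0.
  by rewrite ger0_norm// subr_ge0 ltW.
have [/andP[br ra]|] := boolP (b <= r < a); last by rewrite !mulr0.
by rewrite distrC ger0_norm// subr_ge0.
Qed.

Lemma taylor_kernel_le a b r : taylor_kernel a b r <= `|b - a|.
Proof.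
rewrite taylor_kernelE; case: ifPn => ab; rewrite indic_itvE in_itv/=.
  have [/andP[ar rb]|_] := boolP (a <= r <= b); last by rewrite mulr0.
  by rewrite mulr1 ger0_norm ?subr_ge0// lerB.
have [/andP[ar rb]|_] := boolP (b <= r < a); last by rewrite mulr0.
by rewrite mulr1 distrC ger0_norm ?subr_ge0 ?lerB// ltW// ltNge.
Qed.

Lemma taylor_kernel_out a b r : r < Num.min a b \/ Num.max a b < r -> taylor_kernel a b r = 0.
Proof.
rewrite taylor_kernelE gt_max lt_min; case: ifPn => ab.
  case=> /andP[h1 h2]; rewrite indic_itvE in_itv/=.
    by rewrite leNgt h1 mulr0.
  by rewrite [r <= b]leNgt h2 andbF mulr0.
case=> /andP[h1 h2]; rewrite indic_itvE in_itv/=.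
  by rewrite leNgt h2 mulr0.
by rewrite [r < a]ltNge (ltW h1) andbF mulr0.
Qed.

Lemma integrable_mul_taylor_kernel (k : R -> R) a b :
  (forall c d, lam.-integrable `[c, d] (EFin \o k)) ->
  lam.-integrable setT (fun r => (k r * taylor_kernel a b r)%:E).
Proof.
move=> ik; pose D : set R := `[Num.min a b, Num.max a b]%classic.
have mD : measurable D by exact: measurable_itv.
suff : lam.-integrable setT
    ((fun r => (k r * taylor_kernel a b r)%:E) \_ D).
  rewrite (_ : _ \_ D = (fun r => (k r * taylor_kernel a b r)%:E))//.
  apply/funext => r; rewrite patchE; case: ifPn => //.
  rewrite notin_setE /D/= in_itv/= => /negP; rewrite negb_and -!ltNge => /orP h.
  by rewrite taylor_kernel_out ?mulr0.
apply: (@integrable_mkcond _ _ _ lam D _ _).1 => //.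
have mk : measurable_fun D k by apply/measurable_EFinP; exact: measurable_int (ik _ _).
have : lam.-integrable D (fun r => (`|b - a|%:E * (k r)%:E)%E).
  by apply: integrableZl => //; exact: ik.
apply: le_integrable => //.
  apply/measurable_EFinP; apply: measurable_funM => //.
  by apply: measurable_funTS; exact: measurable_taylor_kernel.
move=> r _; rewrite -EFinM/= lee_fin normrM (ger0_norm (taylor_kernel_ge0 _ _ _)).
by rewrite [leRHS]normrM normr_id mulrC ler_wpM2r// taylor_kernel_le.
Qed.

Lemma measurable_triangle (u v : R) :
  measurable [set p : R * R | u <= p.2 /\ p.2 <= p.1 /\ p.1 <= v].
Proof.
pose b (p : R * R) := [&& u <= p.2, p.2 <= p.1 & p.1 <= v].
have mb : measurable_fun setT b.
  apply: measurable_and; first by apply: measurable_fun_ler => //; exact: measurable_snd.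
  apply: measurable_and; first by apply: measurable_fun_ler; [exact: measurable_snd|exact: measurable_fst].
  by apply: measurable_fun_ler => //; exact: measurable_fst.
rewrite (_ : [set p | _] = setT `&` b @^-1` [set true]); first exact: mb.
apply/seteqP; split => [p [h1 [h2 h3]]|p [_]] /=; first by rewrite /b h1 h2 h3.
by rewrite /b => /and3P[].
Qed.

Lemma measurable_triangle_lt (v u : R) :
  measurable [set p : R * R | v <= p.1 /\ p.1 <= p.2 /\ p.2 < u].
Proof.
pose b (p : R * R) := [&& v <= p.1, p.1 <= p.2 & p.2 < u].
have mb : measurable_fun setT b.
  apply: measurable_and; first by apply: measurable_fun_ler => //; exact: measurable_fst.
  apply: measurable_and; first by apply: measurable_fun_ler; [exact: measurable_fst|exact: measurable_snd].
  by apply: measurable_fun_ltr => //; exact: measurable_snd.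
rewrite (_ : [set p | _] = setT `&` b @^-1` [set true]); first exact: mb.
apply/seteqP; split => [p [h1 [h2 h3]]|p [_]] /=; first by rewrite /b h1 h2 h3.
by rewrite /b => /and3P[].
Qed.

Lemma integrable_product_bounded (k : R -> R) (A : set (R * R)) (c d : R) :
  measurable A -> (forall p, A p -> c <= p.1 <= d /\ c <= p.2 <= d) ->
  lam.-integrable `[c, d] (EFin \o k) ->
  (lam \x lam)%E.-integrable setT (EFin \o (fun p : R * R => k p.2 * \1_A p)).
Proof.
move=> mA Acd ik; pose D : set R := `[c, d]%classic.
have mD : measurable D by exact: measurable_itv.
have mk : measurable_fun setT (k \_ D).
  have mkD : measurable_fun D k by apply/measurable_EFinP; exact: measurable_int ik.
  by apply/(measurable_restrictT _ _).1.
have -> : (fun p : R * R => k p.2 * \1_A p) = (fun p : R * R => (k \_ D) p.2 * \1_A p).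
  apply/funext => p; rewrite indicE; have [/set_mem/Acd[_ pD]|_] := boolP (p \in A).
    by rewrite patchE mem_set.
  by rewrite !mulr0.
have mkA : measurable_fun setT (EFin \o (fun p : R * R => (k \_ D) p.2 * \1_A p)).
  apply/measurable_EFinP; apply: measurable_funM; last exact: measurable_indic.
  exact: (measurableT_comp mk (@measurable_snd _ _ _ _)).
apply/(integrable12ltyP lam lam mkA).
have /integrableP[_ ik'] := ik.
have lD : (lam D < +oo)%E.
  by rewrite lebesgue_measure_itv/=; case: ifP => _; rewrite ?ltry// -EFinB ltry.
apply: (@le_lt_trans _ _ (\int[lam]_(x in D) (\int[lam]_(y in D) `|(k y)%:E|)))%E.
  rewrite [leRHS]integral_mkcond; apply: ge0_le_integral => //.
  - by move=> x _; apply: integral_ge0.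
  - apply: (@measurable_fun_fubini_tonelli_F _ _ _ _ _ lam
      (fun p : R * R => `|((k \_ D) p.2 * \1_A p)%:E|)%E) => //.
    exact: measurableT_comp mkA.
  - by apply/(measurable_restrictT _ _).1.
  - move=> x _; rewrite patchE; case: ifPn => [xD|].
      rewrite [leRHS]integral_mkcond; apply: ge0_le_integral => //.
      + apply: (measurableT_comp (@abse_measurable R setT)) => //.
        exact: (measurableT_comp mkA (measurable_pair1 x)).
      + have mkD : measurable_fun D (fun y => `|(k y)%:E|)%E.
          by apply: measurableT_comp => //; exact: measurable_int ik.
        by apply/(measurable_restrictT _ _).1.
      + move=> y _; rewrite !patchE; case: ifPn => yD /=.
          rewrite lee_fin normrM [(k \_ D) y]patchE yD ler_piMr// indicE; case: (_ \in _); rewrite ?normr1// normr0.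
          by [].
        by rewrite patchE (negbTE yD) mul0r normr0.
    move=> xD; rewrite integral0_eq// => y _ /=.
    rewrite indicE memNset ?mulr0 ?normr0// => /Acd[/= xcd _].
    by move/negP : xD; apply; rewrite inE /D/= in_itv/=.
rewrite integral_cst//= lte_mul_pinfty//.
- exact: integral_ge0.
- by rewrite ge0_fin_numE//; exact: integral_ge0.
Qed.

Variables (f f1 f2 : R -> R).
Hypothesis df : forall u : R, is_derive u 1 f (f1 u).
Hypothesis cf1 : continuous f1.
Hypothesis if2 : forall c d, lam.-integrable `[c, d] (EFin \o f2).
Hypothesis f1_increment : forall c d, c <= d -> f1 d - f1 c = \int[lam]_(r in `[c, d]) f2 r.

Let FTC u v (F1 F : R -> R) : u <= v -> continuous F1 ->
  (forall s : R, is_derive s 1 F (F1 s)) ->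
  F v - F u = \int[lam]_s (F1 s * \1_(`[u, v]) s).
Proof.
rewrite le_eqVlt => /predU1P[-> _ _|uv cF1 dF].
  rewrite subrr set_itv1.
  rewrite (_ : (fun s => _) = (F1 \_ [set v])); last first.
    by apply/funext => s; rewrite patchE indicE; case: ifP; rewrite ?mulr1 ?mulr0.
  by rewrite -Rintegral_mkcond Rintegral_set1.
rewrite (_ : (fun s => _) = (F1 \_ `[u, v])); last first.
  by apply/funext => s; rewrite patchE indicE; case: ifP; rewrite ?mulr1 ?mulr0.
rewrite -Rintegral_mkcond /Rintegral (@continuous_FTC2 _ F1 F)//.
- exact: continuous_subspaceT.
- have cF : continuous F.
    move=> s; apply: differentiable_continuous; apply/derivable1_diffP.
    exact: ex_derive.
  by split; [move=> s _; case: (dF s)|exact/cvg_at_right_filter/cF|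
    exact/cvg_at_left_filter/cF].
- by move=> s _; rewrite derive1E derive_val.
Qed.

(** The left-hand side is the integral over s from u to v of [f1 s - f1 u], itself an integral of
    [f2] from u to s. Exchanging the order over the triangle [u <= r <= s <= v] leaves, for each
    [r], the length [v - r] of the range of [s]. For [v < u] the two signs cancel, and the triangle
    excludes [r = u] in order to match the half-open kernel. *)
Lemma taylor_remainder u v :
  f v - f u - f1 u * (v - u) = \int[lam]_r (f2 r * taylor_kernel u v r).
Proof.
have [uv|vu] := leP u v.
  pose A := [set p : R * R | u <= p.2 /\ p.2 <= p.1 /\ p.1 <= v].
  have mA : measurable A := measurable_triangle u v.
  have iA : (lam \x lam)%E.-integrable setT
      (EFin \o (fun p : R * R => f2 p.2 * \1_A p)).
    apply: (@integrable_product_bounded f2 A u v) => // p [h1 [h2 h3]].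
    by rewrite h1 h3 (le_trans h1 h2) (le_trans h2 h3).
  have -> : f v - f u - f1 u * (v - u) = (f v - f1 u * v) - (f u - f1 u * u) by ring.
  have dF (s : R) : is_derive s 1 (fun s => f s - f1 u * s) (f1 s - f1 u).
    have D := is_deriveB (df s) (is_deriveZ (f1 u) (is_derive_id s (1:R))).
    by apply: (is_derive_eq D); rewrite /GRing.scale/= mulr1.
  have cF : continuous (fun s => f1 s - f1 u).
    by move=> s; apply: cvgB; [exact: cf1|exact: cvg_cst].
  have -> := FTC uv cF dF.
  transitivity (\int[lam]_s \int[lam]_r (f2 r * \1_A (s, r))).
    apply: eq_Rintegral => s _; rewrite indicE.
    have [/set_mem|sN] := boolP (s \in _).
      rewrite /= in_itv/= => /andP[us sv]; rewrite mulr1 f1_increment// Rintegral_mkcond.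
      apply: eq_Rintegral => r _; rewrite patchE indicE.
      have [/set_mem|rN] := boolP (r \in `[u, s]%classic).
        by rewrite /= in_itv/= => /andP[ur rs]; rewrite mem_set ?mulr1.
      rewrite memNset ?mulr0// => -[/= ur [rs _]].
      by move/negP : rN; apply; rewrite inE/= in_itv/= ur.
    rewrite mulr0; apply/esym; under eq_Rintegral => r _.
      rewrite indicE memNset ?mulr0; last first.
        move=> [/= ur [rs sv]]; move/negP : sN; apply.
        by rewrite inE/= in_itv/= sv (le_trans ur).
      over.
    by rewrite Rintegral_cst// mul0r.
  rewrite (Rintegral_fubini iA); apply: eq_Rintegral => r _.
  rewrite taylor_kernelE uv.
  have -> : (fun s => f2 r * \1_A (s, r)) = (fun s => (f2 r * \1_(`[u, v]) r) * \1_(`[r, v]) s).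
    apply/funext => s; rewrite -mulrA; congr (_ * _); rewrite !indicE -natrM mulnb; congr (_%:R).
    congr (nat_of_bool _); apply/idP/idP.
      move=> /set_mem[/= ur [rs sv]]; apply/andP; split; rewrite inE/= in_itv/=.
        by rewrite ur (le_trans rs).
      by rewrite rs.
    move=> /andP[/set_mem/= + /set_mem/=]; rewrite !in_itv/= => /andP[ur rv] /andP[rs sv].
    by apply: mem_set.
  rewrite RintegralZl//; last exact: integrable_indic_itv.
  rewrite mulrAC -mulrA; congr (_ * _).
  rewrite /Rintegral integral_indic// setIT.
  rewrite [X in fine X](_ : _ = lebesgue_measure (`[r, v]%classic : set R))// lebesgue_measure_itv/= lte_fin.
  rewrite indicE; have [/set_mem|_] := boolP (r \in _); last by rewrite !mulr0.
  rewrite /= in_itv/= => /andP[ur]; rewrite le_eqVlt => /predU1P[->|rv].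
    by rewrite ltxx subrr mul0r.
  by rewrite rv.
pose A := [set p : R * R | v <= p.1 /\ p.1 <= p.2 /\ p.2 < u].
have mA : measurable A := measurable_triangle_lt v u.
have iA : (lam \x lam)%E.-integrable setT
    (EFin \o (fun p : R * R => f2 p.2 * \1_A p)).
  apply: (@integrable_product_bounded f2 A v u) => // p [h1 [h2 h3]].
  by rewrite h1 (ltW h3) (le_trans h1 h2) (le_trans h2 (ltW h3)).
have -> : f v - f u - f1 u * (v - u) = (f1 u * u - f u) - (f1 u * v - f v) by ring.
have dF (s : R) : is_derive s 1 (fun s => f1 u * s - f s) (f1 u - f1 s).
  have D := is_deriveB (is_deriveZ (f1 u) (is_derive_id s (1:R))) (df s).
  by apply: (is_derive_eq D); rewrite /GRing.scale/= mulr1.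
have cF : continuous (fun s => f1 u - f1 s).
  by move=> s; apply: cvgB; [exact: cvg_cst|exact: cf1].
have -> := FTC (ltW vu) cF dF.
transitivity (\int[lam]_s \int[lam]_r (f2 r * \1_A (s, r))).
  apply: eq_Rintegral => s _; rewrite indicE.
  have [/set_mem|sN] := boolP (s \in _).
    rewrite /= in_itv/= => /andP[vs su]; rewrite mulr1 f1_increment//.
    rewrite -Rintegral_itv_bndo_bndc; last first.
      by apply: (integrableS _ _ _ (if2 s u)) => //; exact: subset_itv_co_cc.
    rewrite Rintegral_mkcond.
    apply: eq_Rintegral => r _; rewrite patchE indicE.
    have [/set_mem|rN] := boolP (r \in `[s, u[%classic).
      by rewrite /= in_itv/= => /andP[sr ru]; rewrite mem_set ?mulr1.
    rewrite memNset ?mulr0// => -[/= _ [sr ru]].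
    by move/negP : rN; apply; rewrite inE/= in_itv/= sr.
  rewrite mulr0; apply/esym; under eq_Rintegral => r _.
    rewrite indicE memNset ?mulr0; last first.
      move=> [/= vs [sr ru]]; move/negP : sN; apply.
      by rewrite inE/= in_itv/= vs (le_trans sr)// ltW.
    over.
  by rewrite Rintegral_cst// mul0r.
rewrite (Rintegral_fubini iA); apply: eq_Rintegral => r _.
rewrite taylor_kernelE leNgt vu/=.
have -> : (fun s => f2 r * \1_A (s, r)) = (fun s => (f2 r * \1_(`[v, u[) r) * \1_(`[v, r]) s).
  apply/funext => s; rewrite -mulrA; congr (_ * _); rewrite !indicE -natrM mulnb; congr (_%:R).
  congr (nat_of_bool _); apply/idP/idP.
    move=> /set_mem[/= vs [sr ru]]; apply/andP; split; rewrite inE/= in_itv/=.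
      by rewrite ru (le_trans vs).
    by rewrite sr vs.
  move=> /andP[/set_mem/= + /set_mem/=]; rewrite !in_itv/= => /andP[vr ru] /andP[vs sr].
  by apply: mem_set.
rewrite RintegralZl//; last exact: integrable_indic_itv.
rewrite mulrAC -mulrA; congr (_ * _).
rewrite /Rintegral integral_indic// setIT.
rewrite [X in fine X](_ : _ = lebesgue_measure (`[v, r]%classic : set R))// lebesgue_measure_itv/= lte_fin.
rewrite indicE; have [/set_mem|_] := boolP (r \in _); last by rewrite !mulr0.
rewrite /= in_itv/= => /andP[+ ru]; rewrite le_eqVlt => /predU1P[->|vr].
  by rewrite ltxx subrr mul0r.
by rewrite vr.
Qed.

End taylor.

(** * Increments of a function with a weak derivative *)

Section jets.
Context {R : realType}.

Lemma is_derive_continuous (f f1 : R -> R) :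
  (forall u : R, is_derive u 1 f (f1 u)) -> continuous f.
Proof.
move=> df u; apply: differentiable_continuous; apply/derivable1_diffP.
exact: ex_derive.
Qed.

Lemma derive1_is_derive (f f1 : R -> R) :
  (forall u : R, is_derive u 1 f (f1 u)) -> derive1 f = f1.
Proof. by move=> df; apply/funext => u; rewrite derive1E derive_val. Qed.

Lemma smooth_of_jet (d : nat -> R -> R) :
  (forall k (u : R), is_derive u 1 (d k) (d k.+1 u)) -> smooth (d 0).
Proof.
move=> dd; have dE k : derive1n k (d 0) = d k.
  by elim: k => // k IH; rewrite derive1nS IH (derive1_is_derive (dd k)).
move=> k; split => [i u _|]; rewrite dE; first exact: ex_derive.
exact: is_derive_continuous (dd k).
Qed.

Lemma is_derive_affine (g : R -> R) (a b u D : R) :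
  is_derive (a * (u - b)) 1 g D -> is_derive u 1 (fun v => g (a * (v - b))) (a * D).
Proof.
move=> dg; have da : is_derive u 1 (fun v => a * (v - b)) a.
  by apply: is_derive_eq; rewrite subr0 -[RHS]mulr1.
by have := @is_derive1_comp _ g (fun v => a * (v - b)) u D a dg da; rewrite mulrC.
Qed.

(** For the points where the bump below vanishes, in particular 0 and 1, where its formula cannot be
    differentiated. *)
Lemma is_derive_quadratic_bound (f : R -> R) (C u : R) :
  (forall v, `|f v - f u| <= C * (v - u) ^+ 2) -> is_derive u 1 f 0.
Proof.
move=> fC; have C0 : 0 <= C.
  by have := fC (u + 1); rewrite addrAC subrr add0r expr1n mulr1; exact: le_trans.
suff cf : h^-1 *: (f (h *: (1:R) + u) - f u) @[h --> 0^'] --> (0 : R).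
  split; first by apply/cvg_ex; exists 0.
  by apply/cvg_lim.
apply/cvgr0Pnorm_le => e e0; near=> h.
have h0 : h != 0 by near: h; exact: nbhs_dnbhs_neq.
have hC : `|h| <= e / (C + 1).
  by near: h; apply: dnbhs0_le; rewrite divr_gt0// ltr_wpDl.
rewrite normrZ normfV ler_pdivrMl ?normr_gt0//.
apply: (le_trans (fC _)); rewrite scaler1 addrK -real_normK ?num_real// expr2.
rewrite mulrCA ler_wpM2l//; apply: (@le_trans _ _ ((C + 1) * (e / (C + 1)))).
  by apply: ler_pM => //; rewrite lerDl.
by rewrite mulrC divfK// gt_eqF// ltr_wpDl.
Unshelve. all: by end_near. Qed.

End jets.

Section bump.
Context {R : realType}.

Let w (u : R) := u * (1 - u).

Let w_gt0 u : 0 < u < 1 -> 0 < w u.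
Proof. by move=> /andP[u0 u1]; rewrite mulr_gt0// subr_gt0. Qed.

(* The successive derivatives of [exp (- 1 / (u (1 - u)))] on ]0, 1[. *)
Definition bump (mQ : nat * {poly R}) (u : R) : R :=
  if 0 < u < 1 then mQ.2.[u] / w u ^+ mQ.1 * expR (- (w u)^-1) else 0.

Let W : {poly R} := 'X - 'X^2.
Let W1 : {poly R} := 1 - 2 *: 'X.

(** A pair (m, Q) stands for Q w^(-m) e^(-1/w). As w' = 1 - 2u, its derivative is (Q' w^2 - m Q w w'
    + Q w') w^(-m-2) e^(-1/w), again of this form. *)
Definition bump_next (mQ : nat * {poly R}) : nat * {poly R} :=
  (mQ.1.+2, mQ.2^`() * W ^+ 2 - mQ.1%:R *: (mQ.2 * W * W1) + mQ.2 * W1).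

Let hornerW u : W.[u] = w u. Proof. by rewrite /W /w !hornerE/=; ring. Qed.
Let hornerW1 u : W1.[u] = 1 - 2 * u. Proof. by rewrite /W1 !hornerE. Qed.

(** The exponential series gives e^(1/w) >= w^(-m-2) / (m+2)!, which beats w^(-m) and leaves w^2;
    the polynomial is bounded on [0, 1]. *)
Let bump_bound mQ : exists C, forall u, `|bump mQ u| <=
  C * (if 0 < u < 1 then w u ^+ 2 else 0).
Proof.
case: mQ => m Q.
have [B [_ /(_ (B + 1))]] : bounded_set ((fun u => Q.[u]) @` `[0, 1]%classic).
  apply: compact_bounded; apply: continuous_compact; last exact: segment_compact.
  by apply: continuous_subspaceT; exact: continuous_horner.
rewrite ltrDl => /(_ ltr01) QB.
exists ((B + 1) * (m.+2)`!%:R) => u; rewrite /bump/=.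
case: ifPn => [u01|_]; last by rewrite normr0 mulr0.
have w0 := w_gt0 u01; have /andP[u0 u1] := u01.
have QuB : `|Q.[u]| <= B + 1.
  by apply: QB; exists u => //=; rewrite in_itv/= !ltW.
have B0 : 0 <= B + 1 := le_trans (normr_ge0 _) QuB.
rewrite !normrM normfV normrX (gtr0_norm w0) (gtr0_norm (expR_gt0 _)).
rewrite -!mulrA; apply: ler_pM => //.
  by rewrite mulr_ge0 ?expR_ge0// invr_ge0 exprn_ge0// ltW.
rewrite expRN -invfM invf_ple ?posrE ?mulr_gt0 ?expR_gt0 ?exprn_gt0 ?ltr0n ?fact_gt0//.
have wV0 : 0 <= (w u)^-1 by rewrite invr_ge0 ltW.
have := expR_ge1Dxn m.+1 wV0 => h.
apply: (@le_trans _ _ (w u ^+ m * ((w u)^-1 ^+ m.+2 / (m.+2)`!%:R))); last first.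
  apply: ler_wpM2l; first by rewrite exprn_ge0// ltW.
  by apply: le_trans h; rewrite lerDr.
have : (m.+2)`!%:R != 0 :> R by rewrite pnatr_eq0 -lt0n fact_gt0.
move: (m.+2)`!%:R => c c0; have wN0 : w u != 0 by rewrite gt_eqF.
have key (x z d : R) : x != 0 -> z != 0 -> d != 0 ->
    (d * x ^+ 2)^-1 = z * ((z * x ^+ 2)^-1 / d) by move=> *; field; apply/and3P.
have -> : (w u)^-1 ^+ m.+2 = (w u ^+ m * w u ^+ 2)^-1.
  by rewrite exprVn -addn2 exprD.
- by rewrite -key// expf_neq0.
all: by rewrite subr_gt0.
Qed.

Lemma is_derive_bump mQ (u : R) : is_derive u 1 (bump mQ) (bump (bump_next mQ) u).
Proof.
have [u01|uN] := boolP (0 < u < 1); last first.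
  rewrite {2}/bump (negbTE uN).
  have [C bC] := bump_bound mQ.
  apply: (@is_derive_quadratic_bound _ _ C) => v.
  rewrite [bump mQ u]/bump (negbTE uN) subr0; apply: (le_trans (bC v)).
  have C0 : 0 <= C.
    have := bC (2^-1); rewrite invr_gt0 ltr0n/= invf_lt1 ?ltr0n// ltr1n/= => /(le_trans (normr_ge0 _)).
    rewrite pmulr_lge0// exprn_gt0// w_gt0// invr_gt0 ltr0n/= invf_lt1 ?ltr0n// ltr1n//.
  apply: ler_wpM2l => //; case: ifPn => [v01|_]; last exact: sqr_ge0.
  have wv := w_gt0 v01; case/andP: v01 => v0 v1.
  (* For [v] inside []0, 1[] and [u] outside, [w v] is at most the distance from [v] to the nearer
     of 0 and 1 on the side of [u], hence at most [|v - u|]. *)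
  move: uN; rewrite negb_and -!leNgt => /orP[u0|u1].
    rewrite ler_sqr ?nnegrE ?(ltW wv) ?subr_ge0 ?(le_trans u0) ?(ltW v0)//.
    rewrite /w mulrBr mulr1; apply: lerB; rewrite ?lexx//.
    by rewrite (le_trans u0)// mulr_ge0// ltW.
  rewrite -[leRHS]sqrrN opprB ler_sqr ?nnegrE ?(ltW wv) ?subr_ge0 ?(le_trans (ltW v1))//.
  rewrite /w mulrBr mulr1; have : 0 <= (1 - v) ^+ 2 by exact: sqr_ge0.
  by rewrite expr2; lra.
have w0 := w_gt0 u01; have wN0 : w u != 0 by rewrite gt_eqF.
pose g v := mQ.2.[v] / w v ^+ mQ.1 * expR (- (w v)^-1).
apply: (@near_eq_is_derive _ _ _ g).
  case/andP: u01 => u0 u1; near=> v; rewrite /bump /g ifT//.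
  have : v \in `]0, 1[ by near: v; apply: near_in_itvoo; rewrite in_itv/= u0.
  by rewrite in_itv.
have dw : is_derive u 1 w (1 - 2 * u).
  have D := is_deriveM (is_derive_id u (1:R))
    (is_deriveB (is_derive_cst (1:R) u (1:R)) (is_derive_id u (1:R))).
  by apply: (is_derive_eq D); rewrite /GRing.scale/= -[X in _ + X * _]/(1 - u); ring.
pose z v := (w v)^-1.
have dz : is_derive u 1 z (- (1 - 2 * u) * z u ^+ 2).
  have derw : derivable w u 1 by exact: ex_derive.
  apply: DeriveDef; first exact: derivableV.
  rewrite deriveV//.
  rewrite (@derive_val _ _ _ _ _ _ _ dw) /GRing.scale/= /z exprVn.
  by move: ((w u ^+ 2)^-1) => t; ring.
have dQ : is_derive u 1 (horner mQ.2) (mQ.2^`()).[u] by exact: is_derive_poly.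
have de : is_derive u 1 (fun v => expR (- z v)) (expR (- z u) * ((1 - 2 * u) * z u ^+ 2)).
  have dNz : is_derive u 1 (fun v => - z v) ((1 - 2 * u) * z u ^+ 2).
    by apply: is_derive_eq; rewrite mulNr opprK.
  exact: (@is_derive1_comp _ expR (fun v => - z v) u).
have D := is_deriveM (is_deriveM dQ (@is_deriveX _ _ z mQ.1 u 1 _ dz)) de.
have -> : g = horner mQ.2 * z ^+ mQ.1 * (fun v => expR (- z v)).
  apply/funext => v; rewrite /g.
  rewrite -[RHS]/(mQ.2.[v] * (z ^+ mQ.1) v * expR (- z v)) exprfctE.
  by rewrite /z exprVn.
move: D; set D := (X in is_derive _ _ _ X).
suff -> : D = bump (bump_next mQ) u by [].
rewrite {}/D /bump u01 /bump_next/= !(hornerE, hornerW, hornerW1).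
rewrite -[(horner _ * _) u]/(mQ.2.[u] * (z ^+ mQ.1) u) !exprfctE.
rewrite /GRing.scale/=.
have -> : z u = (w u)^-1 by [].
have -> : u - u ^+ 2 = w u by rewrite /w; ring.
move: (expR _) (mQ.2.[u]) (mQ.2^`()).[u] => e Q0 Q1.
move: (w u) wN0 => x x0 {dQ de dz dw}.
case: (mQ.1) => [|k]/=.
  by rewrite !expr0; field.
by rewrite !exprS !exprVn; move: (x ^+ k) (expf_neq0 k x0) => t t0; field; rewrite ?x0 ?t0.
Unshelve. all: by end_near. Qed.

End bump.

Section weak_derivative_increment.
Context {R : realType}.
Local Notation lam := (@lebesgue_measure R).

Lemma integrable_continuous_compact_support (g : R -> R) (c d : R) :
  continuous g -> (forall u, ~~ (c <= u <= d) -> g u = 0) ->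
  lam.-integrable setT (EFin \o g).
Proof.
move=> cg g0; have ig : lam.-integrable `[c, d] (EFin \o g).
  apply: continuous_compact_integrable; first exact: segment_compact.
  exact: continuous_subspaceT.
have -> : EFin \o g = (EFin \o g) \_ (`[c, d]).
  apply/funext => u; rewrite patchE; case: ifPn => //.
  by rewrite notin_setE/= in_itv/= => /negP/g0 /= ->.
by apply: (@integrable_mkcond _ _ _ lam _ _ _).1.
Qed.

Let jet : nat -> nat * {poly R} := fix jet k := if k is k.+1 then bump_next (jet k) else (0%N, 1).
Let s k : R -> R := bump (jet k).

Let ds k (u : R) : is_derive u 1 (s k) (s k.+1 u).
Proof. exact: is_derive_bump. Qed.

Let cs k : continuous (s k).
Proof. exact: is_derive_continuous (ds k). Qed.

Let s_out k u : ~~ (0 <= u <= 1) -> s k u = 0.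
Proof.
rewrite /s /bump; case: ifP => // /andP[/ltW -> /ltW ->]//.
Qed.

Let s0_ge0 u : 0 <= s 0 u.
Proof.
rewrite /s /bump/=; case: ifP => // _.
by rewrite expr0 divr1 hornerC mul1r expR_ge0.
Qed.

Let is_ k : lam.-integrable setT (EFin \o s k).
Proof. exact: (@integrable_continuous_compact_support (s k) 0 1 (@cs k) (@s_out k)). Qed.

Let S := \int[lam]_u s 0 u.

Let S_gt0 : 0 < S.
Proof.
(* On [[1/4, 3/4]] one has u(1 - u) >= 3/16 >= 1/6, so the bump is at least e^(-6) there. *)
pose c : R := expR (- 6).
apply: (@lt_le_trans _ _ (\int[lam]_(u in `[1/4, 3/4]) c)).
  rewrite Rintegral_cst//= lebesgue_measure_itv/= lte_fin ifT; last by lra.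
  by rewrite mulr_gt0 ?expR_gt0//=; lra.
rewrite Rintegral_mkcond; apply: le_Rintegral => //.
  apply: integrable_patch => //.
  apply: continuous_compact_integrable; first exact: segment_compact.
  by apply: continuous_subspaceT => u; exact: cvg_cst.
move=> u _; rewrite patchE; case: ifPn => [|_]; last exact: s0_ge0.
move/set_mem; rewrite /= in_itv/= => /andP[u1 u2].
rewrite /s /bump ifT; last by apply/andP; split; lra.
rewrite /= expr0 divr1 hornerC mul1r ler_expR lerN2.
have w16 : 1 / 6 <= u * (1 - u).
  have : 0 <= (u - 1/4) * (3/4 - u) by apply: mulr_ge0; lra.
  lra.
rewrite invf_ple ?posrE//; last by apply: lt_le_trans w16; lra.
by rewrite -div1r.
Qed.

(** A smooth step from 0 to [S]. It is not normalised: the factor [S] is carried along and cancelled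
    at the end. *)
Let chi (u : R) := \int[lam]_(v in `]-oo, u]) s 0 v.

Let dchi (u : R) : is_derive u 1 chi (s 0 u).
Proof.
have iu : lam.-integrable `]-oo, (u + 1)] (EFin \o s 0).
  by apply: (integrableS _ _ _ (is_ 0)) => //; exact: measurableT.
have uu1 : u < u + 1 by rewrite ltrDl.
have [dc cE] := continuous_FTC1 uu1 iu (ltNyr u) (@cs 0%N u).
by apply: DeriveDef; [exact: dc|rewrite -derive1E; exact: cE].
Qed.

Let chi_le0 u : u <= 0 -> chi u = 0.
Proof.
move=> u0; rewrite /chi (_ : \int[lam]_(v in _) _ = \int[lam]_(v in `]-oo, u]) 0).
  by rewrite Rintegral_cst//= mul0r.
apply: eq_Rintegral => v; rewrite inE/= in_itv/= => vu.
by rewrite /s /bump ifF// ltNge (le_trans vu u0).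
Qed.

Let chi_ge1 u : 1 <= u -> chi u = S.
Proof.
move=> u1; rewrite /chi Rintegral_mkcond; apply: eq_Rintegral => v _.
rewrite patchE; case: ifPn => //; rewrite notin_setE/= in_itv/= => /negP.
rewrite -ltNge => uv; rewrite s_out// negb_and -!ltNge (le_lt_trans u1 uv).
by rewrite orbT.
Qed.

Let chi_bound u : 0 <= chi u <= S.
Proof.
rewrite Rintegral_ge0/=; last by move=> v _; exact: s0_ge0.
rewrite /chi Rintegral_mkcond; apply: le_Rintegral => //.
  apply: integrable_patch => //.
  by apply: (integrableS _ _ _ (is_ 0)) => //; exact: measurableT.
by move=> v _; rewrite patchE; case: ifP.
Qed.

Variables (f1 f2 : R -> R).
Hypothesis cf1 : continuous f1.
Hypothesis if2 : forall c d, lam.-integrable `[c, d] (EFin \o f2).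
Hypothesis wf : weak_derivative f1 f2.

Let al (n : nat) : R := n.+1%:R.

Let out a n u : ~~ (a <= u <= a + 1) -> s 0 (al n * (u - a)) = 0.
Proof.
rewrite negb_and -!ltNge => /orP[ua|au]; apply: s_out; rewrite negb_and -!ltNge.
  by rewrite pmulr_rlt0// subr_lt0 ua.
apply/orP; right; apply: (@lt_le_trans _ _ (u - a)); first by lra.
by rewrite ler_peMl ?ler1n//; lra.
Qed.

Let is_f1 a n : lam.-integrable setT
  (EFin \o (fun u => f1 u * (al n * s 0 (al n * (u - a))))).
Proof.
apply: (@integrable_continuous_compact_support _ a (a + 1)); last first.
  by move=> u /out ->; rewrite !mulr0.
move=> u; apply: cvgM; first exact: cf1.
apply: cvgM; first exact: cvg_cst.
exact: (is_derive_continuous (fun v => is_derive_affine (ds 0 (al n * (v - a))))).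
Qed.

(** After the substitution [v = al n * (u - a)] the bump stays fixed on [[0, 1]] and only the
    argument of [f1] moves, towards [a]. *)
Let cvg_left a : \int[lam]_u (f1 u * (al n * s 0 (al n * (u - a)))) @[n --> \oo] --> f1 a * S.
Proof.
have E n : \int[lam]_u (f1 u * (al n * s 0 (al n * (u - a)))) =
    \int[lam]_v (f1 ((al n)^-1 * v + a) * s 0 v).
  have alV0 : (al n)^-1 != 0 by rewrite invr_eq0 gt_eqF.
  rewrite (@Rintegral_affine _ _ _ a alV0 (@is_f1 a n)) -RintegralZl//; last first.
    exact: (@integrable_affine _ _ _ a alV0 (@is_f1 a n)).
  apply: eq_Rintegral => v _; rewrite addrK mulVKf ?gt_eqF//.
  rewrite gtr0_norm ?invr_gt0// mulrCA; congr (_ * _).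
  by rewrite mulKf ?gt_eqF.
under eq_cvg do rewrite E.
rewrite /S -RintegralZl//.
have [B [_ /(_ (B + 1))]] : bounded_set (f1 @` `[a, a + 1]%classic).
  apply: compact_bounded; apply: continuous_compact; last exact: segment_compact.
  exact: continuous_subspaceT.
rewrite ltrDl => /(_ ltr01) fB.
apply: (@Rintegral_dominated_cvg _ _ _ (fun v => (B + 1) * s 0 v)).
- move=> n; apply: measurable_funM; apply: continuous_measurable_fun; last exact: (@cs 0%N).
  move=> v; apply: continuous_comp; last exact: cf1.
  apply: cvgD; last exact: cvg_cst.
  by apply: cvgM; [exact: cvg_cst|exact: cvg_id].
- move=> v; apply: cvgM; last exact: cvg_cst.
  have cva : (al n)^-1 * v + a @[n --> \oo] --> a.
    rewrite -[X in _ --> X]add0r; apply: cvgD; last exact: cvg_cst.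
    rewrite -(mul0r v); apply: cvgM; last exact: cvg_cst.
    exact: cvg_harmonic.
  exact: (cvg_comp _ _ cva (@cf1 a)).
- rewrite (_ : _ \o _ = (fun v => (B + 1)%:E * (EFin \o s 0) v)%E)//.
  by apply: integrableZl => //; exact: (@is_ 0%N).
- move=> n v; rewrite normrM (ger0_norm (s0_ge0 v)).
  have [v01|/s_out ->] := boolP (0 <= v <= 1); last by rewrite !mulr0.
  case/andP: v01 => v0 v1.
  apply: ler_wpM2r => //; apply: fB; exists ((al n)^-1 * v + a) => //=.
  have : (al n)^-1 * v <= 1.
    by rewrite mulrC ler_pdivrMr// mul1r (le_trans v1)// ler1n.
  have : 0 <= (al n)^-1 * v by rewrite mulr_ge0// invr_ge0 ltW.
  by move=> h1 h2; rewrite in_itv/= lerDr h1/= addrC lerD2l.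
Qed.

Let cvg_right a b : a < b ->
  \int[lam]_u (f2 u * (chi (al n * (u - a)) - chi (al n * (u - b)))) @[n --> \oo] -->
   S * \int[lam]_(u in `[a, b]) f2 u.
Proof.
move=> ab; pose D : set R := `[a, b + 1]%classic.
have mD : measurable D by exact: measurable_itv.
pose g := f2 \_ D.
have ig : lam.-integrable setT (EFin \o g) by apply: integrable_patch => //; exact: if2.
have mg : measurable_fun setT g by apply/measurable_EFinP; exact: measurable_int ig.
have chi0 n u : ~~ (a <= u <= b + 1) -> chi (al n * (u - a)) - chi (al n * (u - b)) = 0.
  rewrite negb_and -!ltNge => /orP[ua|bu].
    by rewrite !chi_le0 ?subrr// pmulr_rle0// subr_le0 ltW// (lt_trans ua).
  have al1 : 1 <= al n by rewrite ler1n.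
  rewrite !chi_ge1 ?subrr//.
    by rewrite -[leLHS]mul1r ler_pM//; lra.
  by rewrite -[leLHS]mul1r ler_pM//; lra.
have E n : \int[lam]_u (f2 u * (chi (al n * (u - a)) - chi (al n * (u - b)))) =
    \int[lam]_u (g u * (chi (al n * (u - a)) - chi (al n * (u - b)))).
  apply: eq_Rintegral => u _; rewrite /g patchE; case: ifPn => //.
  by rewrite notin_setE /D/= in_itv/= => /negP/chi0 ->; rewrite !mulr0.
under eq_cvg do rewrite E.
(* At [u = a] the first step is 0 for every [n], while at [u = b] it ends up at [S] and the second
   is 0: the limit of the test functions lives on []a, b]]. The truncation [g] to [[a, b + 1]]
   supplies an integrable dominating function where [f2] is only locally integrable. *)
have -> : S * \int[lam]_(u in `[a, b]) f2 u = \int[lam]_u (g u * (S * \1_(`]a, b]) u)).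
  rewrite -Rintegral_itv_obnd_cbnd; last first.
    by apply: (integrableS _ _ _ (if2 a b)) => //; exact: subset_itv_oc_cc.
  rewrite -RintegralZl//; last first.
    by apply: (integrableS _ _ _ (if2 a b)) => //; exact: subset_itv_oc_cc.
  rewrite Rintegral_mkcond; apply: eq_Rintegral => u _.
  rewrite patchE indicE; case: ifPn => [/set_mem|_]; last by rewrite !mulr0.
  rewrite /= in_itv/= => /andP[au ub]; rewrite mulr1 mulrC /g patchE mem_set//.
  by rewrite /D/= in_itv/= (ltW au) (le_trans ub)// lerDl.
apply: (@Rintegral_dominated_cvg _ _ _ (fun u => S * `|g u|)).
- move=> n; apply: measurable_funM => //; apply: measurable_funB;
    apply: continuous_measurable_fun;
    exact: (is_derive_continuous (fun v => is_derive_affine (dchi (al n * (v - _))))).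
- move=> u; apply: cvgM; first exact: cvg_cst.
  have lim_chi c : chi (al n * (u - c)) @[n --> \oo] --> S * ((c < u)%R)%:R.
    have [cu|uc] := ltP c u; last first.
      rewrite mulr0; apply: cvg_near_cst; apply: nearW => n.
      by rewrite chi_le0// pmulr_rle0// subr_le0.
    rewrite mulr1; apply: cvg_near_cst; near=> n.
    rewrite chi_ge1// -ler_pdivrMr ?subr_gt0//.
    rewrite (@le_trans _ _ n%:R)// ?ler_nat//.
    by near: n; exact: nbhs_infty_ger.
  rewrite (_ : S * _ = S * ((a < u)%R)%:R - S * ((b < u)%R)%:R).
    exact: (cvgB (lim_chi a) (lim_chi b)).
  rewrite -mulrBr; congr (_ * _); rewrite indic_itvE in_itv/= [u <= b]leNgt.
  by have [bu|ub] := ltP b u; rewrite ?(lt_trans ab bu) ?subrr ?andbF//= subr0 andbT.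
- rewrite (_ : _ \o _ = (fun v => S%:E * (EFin \o (fun u => `|g u|%R)) v)%E)//.
  by apply: integrableZl => //; exact: integrable_norm.
- move=> n u; rewrite normrM mulrC ler_wpM2r//.
  have /andP[h1 h2] := chi_bound (al n * (u - a)).
  have /andP[h3 h4] := chi_bound (al n * (u - b)).
  by apply/ler_normlP; split; lra.
Unshelve. all: by end_near. Qed.

(** The test functions [chi (al n * (u - a)) - chi (al n * (u - b))] tend to [S] times the indicator
    of []a, b]], and their derivatives concentrate at [a] and [b] with masses [S] and [- S]. The
    weak derivative identity passes to the limit on both sides. *)
Lemma weak_derivative_increment a b : a <= b -> f1 b - f1 a = \int[lam]_(u in `[a, b]) f2 u.
Proof.
rewrite le_eqVlt => /predU1P[->|ab]; first by rewrite subrr set_itv1 Rintegral_set1.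
(* The test function together with all its derivatives, so that [smooth_of_jet] yields smoothness at
   once. *)
pose d n k (u : R) : R := if k is k.+1 then
    al n ^+ k.+1 * (s k (al n * (u - a)) - s k (al n * (u - b)))
  else chi (al n * (u - a)) - chi (al n * (u - b)).
have dd n k (u : R) : is_derive u 1 (d n k) (d n k.+1 u).
  have D g g1 : (forall u : R, is_derive u 1 g (g1 u)) -> forall u : R, is_derive u 1
      (fun u => g (al n * (u - a)) - g (al n * (u - b)))
      (al n * (g1 (al n * (u - a)) - g1 (al n * (u - b)))).
    move=> dg v; have := is_deriveB (is_derive_affine (dg (al n * (v - a))))
      (is_derive_affine (dg (al n * (v - b)))).
    by rewrite -mulrBr.
  case: k => [|k]; first by rewrite /d expr1; exact: D.
  have := is_deriveZ (al n ^+ k.+1) (D _ _ (ds k) u).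
  by rewrite /GRing.scale/= mulrA -exprSr.
have cpt n : compact_support (d n 0).
  apply: (subclosed_compact _ (@segment_compact R a (b + 1))); first exact: closed_closure.
  have cl : closed `[a, b + 1] by exact: itv_closed.
  apply: (@subset_trans _ (closure `[a, b + 1]%classic)); last first.
    by move/closure_id : cl => <-.
  apply: closure_subset => u /= /eqP du.
  rewrite in_itv/=; apply/andP; split; rewrite leNgt; apply/negP => h; apply: du.
    by rewrite !chi_le0 ?subrr// pmulr_rle0// subr_le0 ltW// (lt_trans h).
  rewrite !chi_ge1 ?subrr//.
    by rewrite -[leLHS]mul1r ler_pM//; [rewrite ler1n|lra].
  by rewrite -[leLHS]mul1r ler_pM//; [rewrite ler1n|lra].
have H n := wf (smooth_of_jet (dd n)) (cpt n).
have E n : \int[lam]_u (f1 u * (al n * s 0 (al n * (u - a)))) -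
    \int[lam]_u (f1 u * (al n * s 0 (al n * (u - b)))) =
    - \int[lam]_u (f2 u * (chi (al n * (u - a)) - chi (al n * (u - b)))).
  rewrite -[RHS](H n) (derive1_is_derive (dd n 0%N)) -RintegralB//.
  by apply: eq_Rintegral => u _; rewrite /d expr1; ring.
pose A n := \int[lam]_u (f1 u * (al n * s 0 (al n * (u - a)))) -
    \int[lam]_u (f1 u * (al n * s 0 (al n * (u - b)))).
have lA : A n @[n --> \oo] --> f1 a * S - f1 b * S.
  exact: cvgB (@cvg_left a) (@cvg_left b).
have lA' : A n @[n --> \oo] --> - (S * \int[lam]_(u in `[a, b]) f2 u).
  by rewrite /A; under eq_cvg do rewrite E; exact: cvgN (@cvg_right a b ab).
have h : f1 a * S - f1 b * S = - (S * \int[lam]_(u in `[a, b]) f2 u).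
  by rewrite -(cvg_lim (@Rhausdorff R) lA); exact: cvg_lim lA'.
apply: (mulfI (lt0r_neq0 S_gt0)); lra.
Qed.

End weak_derivative_increment.

(** * Quadratic variation and its jumps *)

Section esum_facts.
Context {R : realType} {I : choiceType}.

Lemma esum_subset_le (A B : set I) (a : I -> \bar R) :
  (forall i, 0 <= a i)%E -> A `<=` B -> (\esum_(i in A) a i <= \esum_(i in B) a i)%E.
Proof.
move=> a0 AB; rewrite (esumID A B)// (_ : B `&` A = A); last exact/setIidr.
by rewrite leeDl// esum_ge0.
Qed.

Lemma esumZl (c : R) (A : set I) (a : I -> \bar R) : 0 <= c -> (forall i, 0 <= a i)%E ->
  (\esum_(i in A) (c%:E * a i) = c%:E * \esum_(i in A) a i)%E.
Proof.
rewrite le_eqVlt => /predU1P[<-|c0] a0.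
  by rewrite mul0e esum1// => i _; rewrite mul0e.
have le (d : R) (b : I -> \bar R) : 0 < d -> (forall i, 0 <= b i)%E ->
    (\esum_(i in A) (d%:E * b i) <= d%:E * \esum_(i in A) b i)%E.
  move=> d0 b0; apply: ge_ereal_sup => _ [X [finX XA]] <-.
  rewrite -ge0_mule_fsumr// lee_pmul2l//; apply: esum_ge; exists X => //.
apply/eqP; rewrite eq_le le//=.
have cV0 : 0 < c^-1 by rewrite invr_gt0.
have H : (\esum_(i in A) a i <= c^-1%:E * \esum_(i in A) (c%:E * a i))%E.
  apply: le_trans (le _ _ cV0 _); last by move=> i; rewrite mule_ge0 ?lee_fin ?(ltW c0).
  by apply: le_esum => i Ai; rewrite muleA -EFinM mulVf ?gt_eqF// mul1e.
by rewrite -(@lee_pmul2l _ c^-1%:E)// muleA -EFinM mulVf ?gt_eqF// mul1e.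
Qed.

End esum_facts.


Section cumulative_jumps.
Context {R : realType}.
Variable F : cumulative R R.

Lemma cumulative_le a b : a <= b -> F a <= F b.
Proof. exact: cumulative_is_nondecreasing. Qed.

Lemma cumulative_left_cvg t : cvg (F r @[r --> t^'-]).
Proof.
apply: nondecreasing_at_left_is_cvgr; first by near=> s => a b _ _; exact: cumulative_le.
near=> s; exists (F t) => _ /= [r + <-].
by rewrite in_itv/= => /andP[_ /ltW]; exact: cumulative_le.
Unshelve. all: by end_near. Qed.

Lemma cumulative_jump_le a t : a < t -> jump F t <= F t - F a.
Proof.
move=> lat; rewrite lerD2l lerN2; apply: limr_ge; first exact: cumulative_left_cvg.
by near=> r; apply/cumulative_le/ltW; near: r; exact: nbhs_left_gt.
Unshelve. all: by end_near. Qed.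

Lemma cumulative_jump_ge0 t : 0 <= jump F t.
Proof.
rewrite subr_ge0; apply: limr_le; first exact: cumulative_left_cvg.
by near=> r; apply/cumulative_le/ltW; near: r; exact: nbhs_left_lt.
Unshelve. all: by end_near. Qed.

Lemma cumulative_left_increment b e : 0 < e ->
  exists2 d, 0 < d & forall a, b - d < a < b -> F b - F a - jump F b <= e.
Proof.
move=> e0; have /cvgrPdist_le/(_ _ e0) := @cumulative_left_cvg b.
rewrite near_withinE => -[d /= d0 Fd]; exists d => // a /andP[da ab].
have : `|lim (F r @[r --> b^'-]) - F a| <= e.
  by apply: Fd => //=; rewrite ger0_norm ?subr_ge0 ?ltW//; lra.
by rewrite /jump => /ler_normlP[_]; lra.
Qed.

Lemma lebesgue_stieltjes_itv_oc a b : a <= b ->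
  lebesgue_stieltjes_measure F `]a, b] = (F b - F a)%:E.
Proof.
move=> ab; rewrite /lebesgue_stieltjes_measure/= /measure_extension.
rewrite measurable_mu_extE/=; last exact: is_ocitv.
by rewrite wlength_itv_bnd// EFinB.
Qed.

Lemma jump_le_lebesgue_stieltjes t :
  ((jump F t)%:E <= lebesgue_stieltjes_measure F [set t])%E.
Proof.
pose A n : set (measurableTypeR R) := `](t - n.+1%:R^-1), t]%classic.
have LA n : lebesgue_stieltjes_measure F (A n) = (F t - F (t - n.+1%:R^-1))%:E.
  by apply: lebesgue_stieltjes_itv_oc; rewrite gerBl.
have capA : \bigcap_n A n = [set t].
  apply/seteqP; split => [r Ar|r -> n _]; last by rewrite /A/= in_itv/= lexx andbT ltrBlDr ltrDl.
  have := Ar 0%N I; rewrite /A/= in_itv/= => /andP[_ rt].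
  apply/eqP; rewrite eq_le rt/=; apply/ler_addgt0Pr => d d0.
  have := Ar (Num.truncn d^-1) I; rewrite /A/= in_itv/= => /andP[+ _].
  rewrite ltrBlDr => /ltW/le_trans; apply; rewrite lerD2l.
  by rewrite invf_ple ?posrE//; exact/ltW/truncnS_gt.
have : lebesgue_stieltjes_measure F (A n) @[n --> \oo] -->
    lebesgue_stieltjes_measure F (\bigcap_n A n).
  apply: nonincreasing_cvg_mu.
  - exact: (@eq_ind_r _ _ (fun z => (z < +oo)%E) (ltry _) _ (LA 0%N)).
  - by move=> n; exact: measurable_itv.
  - by rewrite capA; exact: measurable_set1.
  - move=> m n mn; apply/subsetPset; apply: subset_itvr.
    by rewrite bnd_simp lerB// lef_pV2 ?posrE// ler_nat.
rewrite capA => cvgA; rewrite -(cvg_lim (@ereal_hausdorff R) cvgA).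
apply: lime_ge; first by apply/cvg_ex; eexists; exact: cvgA.
apply: nearW => n.
apply: (@eq_ind_r _ _ (fun z => ((jump F t)%:E <= z)%E) _ _ (LA n)); rewrite lee_fin.
by apply: cumulative_jump_le; rewrite ltrBlDr ltrDl.
Qed.

Lemma esum_jump_le a b : a <= b ->
  (\esum_(t in `]a, b]) (jump F t)%:E <= (F b - F a)%:E)%E.
Proof.
move=> ab; apply: ge_ereal_sup => _ [X [finX Xab]] <-.
rewrite -lebesgue_stieltjes_itv_oc//.
apply: (@le_trans _ _ (\sum_(t \in X) lebesgue_stieltjes_measure F [set t])%E).
  by apply: lee_fsum => // t _; exact: jump_le_lebesgue_stieltjes.
have tX : trivIset X (fun t : R => [set t]).
  by apply/trivIsetP => s t _ _ /eqP st; apply/seteqP; split => // r [/= ->].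
have mX t : X t -> measurable [set t] by move=> _; exact: measurable_set1.
rewrite -(measure_fin_bigcup (lebesgue_stieltjes_measure F) finX tX mX).
apply: le_measure; rewrite ?inE//.
- by apply: fin_bigcup_measurable => // t _; exact: measurable_set1.
- by move=> r [t Xt ->]; exact: Xab.
Qed.

Lemma esum_jump_fin a b : (\esum_(t in `]a, b]) (jump F t)%:E \is a fin_num)%E.
Proof.
have [ab|ba] := leP a b; last by rewrite set_itv_ge ?esum_set0// bnd_simp -leNgt ltW.
rewrite ge0_fin_numE; last by apply: esum_ge0 => t _; rewrite lee_fin cumulative_jump_ge0.
exact: le_lt_trans (esum_jump_le ab) (ltry _).
Qed.

Lemma continuous_part_increment a b : 0 <= a <= b ->
  (\esum_(t in `]a, b]) (jump F t)%:E =
   ((F b - F a) - (continuous_part F b - continuous_part F a))%:E)%E.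
Proof.
move=> /andP[a0 ab]; rewrite /continuous_part.
have jump0 t : (0 <= (jump F t)%:E)%E by rewrite lee_fin cumulative_jump_ge0.
(* [continuous_part] counts the jump at 0, which []0, t]] would miss; []-1, t]] contains it and has
   a bounded sum of jumps. *)
have fin0 t : (\esum_(s in `[0%R, t]) (jump F s)%:E \is a fin_num)%E.
  rewrite ge0_fin_numE; last exact: esum_ge0.
  apply: (@le_lt_trans _ _ (\esum_(s in `]((-1)%R), t]) (jump F s)%:E)%E); last first.
    by rewrite -ge0_fin_numE ?esum_jump_fin//; exact: esum_ge0.
  apply: esum_subset_le => // s /=; rewrite !in_itv/= => /andP[s0 ->].
  by rewrite andbT (lt_le_trans _ s0)// ltrN10.
have -> : (\esum_(s in `[0%R, b]) (jump F s)%:E =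
    \esum_(s in `[0%R, a]) (jump F s)%:E + \esum_(s in `]a, b]) (jump F s)%:E)%E.
  rewrite (esumID `[0%R, a])//; congr (_ + _)%E; congr esum; apply/seteqP; split => t /=; rewrite !in_itv/=.
  - by case.
  - by move=> /andP[-> ta]; rewrite (le_trans ta ab).
  - by case=> /andP[-> ->] /= /negP; rewrite andbT -ltNge.
  - by move=> /andP[lat ->]; rewrite andbT (le_trans a0 (ltW lat)); split => //; apply/negP; rewrite -ltNge.
rewrite fineD ?esum_jump_fin//.
set A := fine (\esum_(s in `[0%R, a]) _); set B := fine _.
rewrite (_ : _ - _ = B); last by ring.
by rewrite fineK// esum_jump_fin.
Qed.

End cumulative_jumps.

Section ramp.
Context {R : realType}.

(* Equal to [1] on ]-oo, a], to [0] on [a + d, +oo[ and affine in between. *)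
Definition ramp (a d r : R) : R :=
  (`|(a + d - r) / d| - `|(a + d - r) / d - 1| + 1) / 2.

Lemma ramp_continuous a d : continuous (ramp a d).
Proof.
have c1 : continuous (fun r : R => (a + d - r) / d).
  by move=> r; apply: cvgM; [apply: cvgB; [exact: cvg_cst|exact: cvg_id]|exact: cvg_cst].
move=> r; apply: cvgM; last exact: cvg_cst.
apply: cvgD; last exact: cvg_cst.
apply: cvgB; first by apply: cvg_norm; exact: c1.
by apply: cvg_norm; apply: cvgB; [exact: c1|exact: cvg_cst].
Qed.

Lemma ramp_itv a d r : 0 <= ramp a d r <= 1.
Proof.
rewrite /ramp; set z := (_ / d); have := ler_distD 0 z 1; have := ler_distD z 0 1.
rewrite !subr0 !sub0r !normrN normr1 => h1 h2.
have := ler_norm z; have := ler_norm (z - 1); have := ler_norm (- (z - 1)).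
have := lerB_dist z 1; have := lerB_dist 1 z; rewrite normr1 (distrC 1 z).
by rewrite normrN => *; apply/andP; split; lra.
Qed.

Lemma ramp_left a d r : 0 < d -> r <= a -> ramp a d r = 1.
Proof.
move=> d0 ra; rewrite /ramp; have z1 : 1 <= (a + d - r) / d.
  by rewrite ler_pdivlMr// mul1r; lra.
move: z1; set z := _ / d => z1.
by rewrite (ger0_norm (_ : 0 <= z)) ?(ger0_norm (_ : 0 <= z - 1)); lra.
Qed.

Lemma ramp_right a d r : 0 < d -> a + d <= r -> ramp a d r = 0.
Proof.
move=> d0 ra; rewrite /ramp; have z0 : (a + d - r) / d <= 0.
  by rewrite pmulr_lle0 ?invr_gt0//; lra.
move: z0; set z := _ / d => z0.
by rewrite (ler0_norm (_ : z <= 0)) ?(ler0_norm (_ : z - 1 <= 0)); lra.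
Qed.

End ramp.

Section quadratic_variation_limit.
Context {R : realType}.
Variables (T : R) (pi : nat -> seq R).
Hypothesis T_gt0 : 0 < T.
Hypothesis pi_partition : forall n, itv_partition 0 T (pi n).
Hypothesis pi_mesh : mesh (pi n) @[n --> \oo] --> 0.
Variable x : R -> R.
Hypothesis x_cadlag : cadlag T x.
Variable mu : {finite_measure set (measurableTypeR R) -> \bar R}.
Hypothesis mu_qv : is_qv_measure T pi x mu.

Local Notation F := (qv mu).
Local Notation y := (stopped T x).
Local Notation yl := (stopped_left T x).

Lemma qvE t : (F t)%:E = mu `[0, t]%classic.
Proof. by rewrite /qv fineK// fin_num_measure. Qed.

Lemma qv_lt0 t : t < 0 -> F t = 0.
Proof. by move=> t0; rewrite /qv set_itv_ge ?measure0// bnd_simp -ltNge. Qed.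

Lemma jump_qv t : 0 <= t <= T -> jump F t = (y t - yl t) ^+ 2.
Proof.
move=> tT; rewrite (proj2 mu_qv)// stoppedE//; have [->|tN0] := eqVneq t 0.
  by rewrite /left_value eqxx /stopped_left lexx.
rewrite stopped_leftE//; case/andP: tT => t0 ->.
by rewrite lt_neqAle eq_sym tN0 t0.
Qed.

(** The left value at 0 is [x 0] by convention, so the jump condition rules out an atom of [mu] at
    0, and [qv mu] is 0 before 0. *)
Lemma qv0 : F 0 = 0.
Proof.
have T0 : (0 : R) <= 0 <= T by apply/andP; split => //; exact: ltW.
have yl0 : yl 0 = x 0 by rewrite /stopped_left ifT.
have := jump_qv T0; rewrite stoppedE// yl0 subrr expr0n/= /jump.
rewrite (_ : lim _ = 0) ?subr0//; apply/cvg_lim; first exact: Rhausdorff.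
by apply: cvg_near_cst; near=> r; apply: qv_lt0; near: r; exact: nbhs_left_lt.
Unshelve. all: by end_near. Qed.

Let sqsum (g : R -> R) n := \sum_(j < size (pi n)) g (pt (pi n) j) *
      (y (pt (pi n) j.+1) - y (pt (pi n) j)) ^+ 2.

Let y_pt n j : (j <= size (pi n))%N -> y (pt (pi n) j) = x (pt (pi n) j).
Proof.
by move=> js; rewrite stoppedE// (pt_ge0 (pi_partition n))// (pt_leT (pi_partition n)).
Qed.

Lemma discrete_qv_integral (g : R -> R) n : continuous g -> (forall r, 0 <= g r) ->
  (\int[discrete_qv x (pi n)]_(r in `[0%R, T]) (g r)%:E)%E = (sqsum g n)%:E.
Proof.
move=> cg g0.
have mg : measurable_fun (`[0, T] : set (measurableTypeR R)) (EFin \o g).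
  apply/measurable_EFinP; apply: measurable_funTS; exact: continuous_measurable_fun.
rewrite /discrete_qv ge0_integral_measure_sum//=; last by move=> r _; rewrite lee_fin.
rewrite /sqsum -sumEFin; apply: eq_bigr => j _; have js := ltn_ord j.
rewrite ge0_integral_mscale//=; last by move=> r _; rewrite lee_fin.
rewrite integral_dirac//= diracE mem_set ?mul1e.
  by rewrite -EFinM mulrC !y_pt// ltnW.
by rewrite /= in_itv/= (pt_ge0 (pi_partition n) (ltnW js))
  (pt_leT (pi_partition n) (ltnW js)).
Qed.

Lemma sqsum_cvg_integral (g : R -> R) : continuous g -> (forall r, 0 <= g r <= 1) ->
  (\int[mu]_(r in `[0%R, T]) (g r)%:E \is a fin_num)%E /\
  sqsum g n @[n --> \oo] --> fine (\int[mu]_(r in `[0%R, T]) (g r)%:E)%E.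
Proof.
move=> cg g01; have g0 r : 0 <= g r by have /andP[] := g01 r.
have fin : (\int[mu]_(r in `[0%R, T]) (g r)%:E \is a fin_num)%E.
  rewrite ge0_fin_numE; last by apply: integral_ge0 => r _; rewrite lee_fin.
  apply: (@le_lt_trans _ _ (\int[mu]_(r in `[0%R, T]) 1)%E).
    apply: ge0_le_integral => //.
    - by move=> r _; rewrite lee_fin.
    - apply/measurable_EFinP; apply: measurable_funTS; exact: continuous_measurable_fun.
    - by move=> r _; rewrite lee_fin; have /andP[] := g01 r.
  by rewrite integral_cst//= mul1e ltey_eq fin_num_measure.
split => //; have := (proj1 mu_qv) g (continuous_subspaceT cg).
under eq_cvg do rewrite discrete_qv_integral//.
move=> cvgI; have : (sqsum g n)%:E @[n --> \oo] -->
    (fine (\int[mu]_(r in `[0%R, T]) (g r)%:E)%E)%:E by rewrite fineK.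
by move/fine_cvg.
Qed.

(** A ramp descending on [[t, t + d]] has integral at most [F (t + d)], which is close to [F t] by
    right continuity. *)
Lemma qv_test_above t e : 0 <= t <= T -> 0 < e ->
  exists g : R -> R, [/\ forall s, 0 <= g s, forall s, 0 <= s <= t -> 1 <= g s &
    \forall n \near \oo, sqsum g n <= F t + e].
Proof.
move=> /andP[t0 tT] e0; have e20 : 0 < e / 2 by rewrite divr_gt0.
have /cvgrPdist_le/(_ _ e20) := @cumulative_is_right_continuous _ _ _ F t.
rewrite near_withinE => -[d0 /= d00 Fd0].
pose d := d0 / 2; have d_gt0 : 0 < d by rewrite divr_gt0.
have Fd : F (t + d) <= F t + e / 2.
  have : `|F t - F (t + d)| <= e / 2.
    apply: Fd0; last by rewrite ltrDl.
    by rewrite /= opprD addNKr normrN gtr0_norm// /d; lra.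
  by move=> /ler_normlP[]; lra.
exists (ramp t d); have r01 s := ramp_itv t d s; split.
- by move=> s; have /andP[] := r01 s.
- by move=> s /andP[_ st]; rewrite ramp_left.
have [fin cvg] := sqsum_cvg_integral (@ramp_continuous _ t d) r01.
have le : fine (\int[mu]_(r in `[0%R, T]) (ramp t d r)%:E)%E <= F (t + d).
  rewrite -lee_fin qvE fineK//.
  apply: (@le_trans _ _ (\int[mu]_(r in `[0%R, T]) (\1_(`[0%R, (t + d)%R]) r)%:E)%E).
    apply: ge0_le_integral => //.
    - by move=> r _; rewrite lee_fin; have /andP[] := r01 r.
    - apply/measurable_EFinP; apply: measurable_funTS; exact: continuous_measurable_fun (@ramp_continuous _ _ _).
    - by apply/measurable_EFinP; apply: measurable_indic.
    - move=> r; rewrite /= in_itv/= => /andP[r0 rT]; rewrite lee_fin indic_itvE in_itv/= r0/=.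
      have [_|rtd] := leP r (t + d); first by have /andP[] := r01 r.
      by rewrite ramp_right// ltW.
  rewrite integral_indic//; apply: le_measure; rewrite ?inE//.
  by apply: measurableI; exact: measurable_itv.
have /cvgrPdist_le/(_ _ e20) := cvg; apply: filterS => n /ler_normlP[].
by lra.
Qed.

Lemma qv_left b e : 0 < b <= T -> 0 < e ->
  exists2 d, 0 < d & forall a, b - d < a < b -> F b - F a - (y b - yl b) ^+ 2 <= e.
Proof.
move=> /andP[b0 bT] e0; have [d d0 Fd] := cumulative_left_increment F b e0.
by exists d => // a /Fd; rewrite jump_qv// ltW.
Qed.

(** A ramp descending on [[t - 2d, t - d]] has integral at least [F (t - 2d)], close to the left
    limit of [F] at [t], which is [F t] minus the squared jump of the path. *)
Lemma qv_test_below t e : 0 < t <= T -> 0 < e ->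
  exists g : R -> R, [/\ forall s, 0 <= g s <= 1,
    exists2 d, 0 < d & forall s, t - d <= s -> g s = 0 &
    \forall n \near \oo, F t - (y t - yl t) ^+ 2 - e <= sqsum g n].
Proof.
move=> tT e0; have e20 : 0 < e / 2 by rewrite divr_gt0.
have [d0 d00 Fd0] := qv_left tT e20.
case/andP: tT => t0 tT.
pose d := Num.min (d0 / 4) (t / 2).
have d_gt0 : 0 < d by rewrite lt_min !divr_gt0.
have dd0 : d <= d0 / 4 by rewrite ge_min lexx.
have dt : d <= t / 2 by rewrite ge_min lexx orbT.
have Fd : F t - F (t - d - d) - (y t - yl t) ^+ 2 <= e / 2.
  by apply: Fd0; apply/andP; split; lra.
pose g := ramp (t - d - d) d; have r01 s : 0 <= g s <= 1 := ramp_itv _ _ s.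
exists g; split => //.
  by exists d => // s ts; rewrite /g ramp_right//; lra.
have [fin cvg] := sqsum_cvg_integral (@ramp_continuous _ (t - d - d) d) r01.
have le : F (t - d - d) <= fine (\int[mu]_(r in `[0%R, T]) (g r)%:E)%E.
  rewrite -lee_fin qvE fineK//.
  apply: (@le_trans _ _ (\int[mu]_(r in `[0%R, T]) (\1_(`[0%R, (t - d - d)%R]) r)%:E)%E).
    rewrite integral_indic//; apply: le_measure; rewrite ?inE//.
    - by apply: measurableI; exact: measurable_itv.
    - move=> r /=; rewrite !in_itv/= => /andP[r0 rt]; rewrite r0 rt; split => //.
      by rewrite (le_trans rt)//; lra.
  apply: ge0_le_integral => //.
  - by apply/measurable_EFinP; apply: measurable_indic.
  - apply/measurable_EFinP; apply: measurable_funTS; exact: continuous_measurable_fun (@ramp_continuous _ _ _).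
  - move=> r; rewrite /= in_itv/= => /andP[r0 rT]; rewrite lee_fin indic_itvE in_itv/= r0/=.
    have [rtd|_] := leP r (t - d - d); first by rewrite /g ramp_left.
    by have /andP[] := r01 r.
have /cvgrPdist_le/(_ _ e20) := cvg; apply: filterS => n /ler_normlP[].
by lra.
Qed.

Lemma stopped_sqsum_cvg_qv t e : 0 <= t <= T -> 0 < e ->
  \forall n \near \oo, `|stopped_sum sqdist y (pi n) 0 t - F t| <= e.
Proof.
have [N yN] := stopped_bounded T_gt0 x_cadlag.
exact: (stopped_sqsum_cvg pi_partition pi_mesh (stopped_right T_gt0 x_cadlag)
  (stopped_left_limit T_gt0 x_cadlag) yN (stopped_left_bounded T_gt0 x_cadlag yN)
  qv_test_above qv_test_below qv0).
Qed.

End quadratic_variation_limit.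

(** * Limits of the sums of Taylor remainders *)

Section taylor_kernel_estimates.
Context {R : realType}.
Local Notation lam := (@lebesgue_measure R).
Local Notation w := (@taylor_kernel R).

Lemma integrable_cst_itv (c a b : R) : lam.-integrable `[a, b] (EFin \o cst c).
Proof.
apply: continuous_compact_integrable; first exact: segment_compact.
by apply: continuous_subspaceT => u; exact: cvg_cst.
Qed.

(** Taylor's formula for s^2 / 2, whose second derivative is 1. *)
Lemma Rintegral_taylor_kernel u v : \int[lam]_r w u v r = (v - u) ^+ 2 / 2.
Proof.
have df (s : R) : is_derive s 1 (fun s => s ^+ 2 / 2) s.
  have D := is_deriveM (is_deriveX 2 (is_derive_id s (1:R))) (is_derive_cst (2^-1 : R) s (1:R)).
  apply: (is_derive_eq D); rewrite /GRing.scale/= expr1 mulr1 mulr0 add0r.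
  by rewrite mulrC -mulrA [s * _]mulrC mulrA divff ?mul1r// pnatr_eq0.
have H := @taylor_remainder R (fun s => s ^+ 2 / 2) id (cst 1) df.
have <- : v ^+ 2 / 2 - u ^+ 2 / 2 - u * (v - u) = (v - u) ^+ 2 / 2 by field.
rewrite H; first by apply: eq_Rintegral => r _; rewrite mul1r.
- by move=> s; exact: cvg_id.
- by move=> c d; exact: integrable_cst_itv.
- move=> c d cd; rewrite Rintegral_cst// mul1r.
  rewrite [X in fine X](_ : _ = lebesgue_measure (`[c, d]%classic : set R))//.
  rewrite lebesgue_measure_itv/= lte_fin; move: cd; rewrite le_eqVlt => /predU1P[->|->]; first by rewrite ltxx subrr.
  by rewrite -EFinB.
Qed.

(** With w_{a,b}(r) = (b - r)(1_{a <= r} - 1_{b <= r}), the difference w_{u,v} - w_{u,m} - w_{m,v}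
    equals (v - m)(1_{u <= r} - 1_{m <= r}), whose absolute value is |v - m| on <u,m> and 0
    elsewhere. The proof checks this over all orderings. *)
Lemma taylor_kernel_split u m v r :
  w u v r <= w u m r + w m v r + `|v - m| * \1_(between u m) r /\
  w u m r + w m v r <= w u v r + `|v - m| * \1_(between u m) r.
Proof.
have bE a b : \1_(between a b) r =
    (if a <= b then ((a <= r) && (r < b))%R else ((b <= r) && (r < a))%R)%:R :> R.
  by rewrite /between; case: ifP => _; rewrite indic_itvE in_itv.
have wE a b : w a b r = if a <= b then
    (if (a <= r) && (r < b) then b - r else 0)
    else (if (b <= r) && (r < a) then r - b else 0).
  rewrite /taylor_kernel bE; case: ifP => _; case: ifP => h; rewrite ?mulr0 ?mulr1//.
    by case/andP: h => _ rb; rewrite ger0_norm// subr_ge0 ltW.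
  by case/andP: h => br _; rewrite distrC ger0_norm// subr_ge0.
rewrite !wE bE; have := ler_norm (v - m); have := ler_norm (- (v - m)); rewrite normrN.
move: `|v - m| => z h1 h2.
case: (leP u v) => uv; case: (leP u m) => um; case: (leP m v) => mv;
  case: (leP u r) => ur; case: (leP m r) => mr; case: (leP v r) => vr /=;
  by split; lra.
Qed.

Lemma Rintegral_between (u m : R) : \int[lam]_r \1_(between u m) r = `|m - u|.
Proof.
rewrite /Rintegral integral_indic//; last exact: measurable_between.
rewrite setIT.
rewrite [X in fine X](_ : _ = lebesgue_measure (between u m : set R))//.
rewrite /between; case: leP => um; rewrite lebesgue_measure_itv/= lte_fin.
  move: um; rewrite le_eqVlt => /predU1P[->|um]; first by rewrite ltxx subrr normr0.
  by rewrite um -EFinB gtr0_norm ?subr_gt0.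
by rewrite um -EFinB distrC gtr0_norm ?subr_gt0.
Qed.

Section bounded_density.
Variables (k : R -> R) (N B : R).
Hypothesis mk : forall c d, lam.-integrable `[c, d] (EFin \o k).
Hypothesis k_ge0 : forall r, 0 <= k r.
Hypothesis k_bound : forall r, `|r| <= N -> k r <= B.
Hypothesis B_ge0 : 0 <= B.

Definition taylor_integral u v := \int[lam]_r (k r * w u v r).

Local Notation G := taylor_integral.

Lemma taylor_integral_cmp u v c1 c2 :
  (forall r, Num.min u v <= r <= Num.max u v -> c1 <= k r <= c2) ->
  c1 / 2 * (v - u) ^+ 2 <= G u v <= c2 / 2 * (v - u) ^+ 2.
Proof.
move=> kc.
have E c : c / 2 * (v - u) ^+ 2 = \int[lam]_r (c * w u v r).
  rewrite RintegralZl//; last first.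
    rewrite (_ : _ \o _ = (fun r => (cst 1 r * w u v r)%:E)); last first.
      by apply/funext => r; rewrite /= mul1r.
    by apply: integrable_mul_taylor_kernel => *; exact: integrable_cst_itv.
  by rewrite Rintegral_taylor_kernel; field.
have ic c : lam.-integrable setT (fun r => (cst c r * w u v r)%:E).
  by apply: integrable_mul_taylor_kernel => *; exact: integrable_cst_itv.
have ik : lam.-integrable setT (fun r => (k r * w u v r)%:E).
  exact: integrable_mul_taylor_kernel.
have le r : c1 * w u v r <= k r * w u v r <= c2 * w u v r.
  have [h|h] := boolP (Num.min u v <= r <= Num.max u v).
    by have /andP[h1 h2] := kc _ h; rewrite !ler_wpM2r ?taylor_kernel_ge0.
  rewrite taylor_kernel_out ?mulr0 ?lexx//.
  by move: h; rewrite negb_and -!ltNge => /orP.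
rewrite !E /G; apply/andP; split; apply: le_Rintegral => //;
  by [exact: ic|exact: ik|move=> r _; have /andP[] := le r].
Qed.

Let abs_between u v r : `|u| <= N -> `|v| <= N ->
  Num.min u v <= r <= Num.max u v -> `|r| <= N.
Proof.
rewrite !ler_norml ge_min le_max => /andP[h1 h2] /andP[h3 h4] /andP[/orP h5 /orP h6].
by apply/andP; split; [case: h5|case: h6] => h; lra.
Qed.

Lemma taylor_integral_bound u v : `|u| <= N -> `|v| <= N ->
  0 <= G u v <= B * (v - u) ^+ 2.
Proof.
move=> uN vN; have kB r : Num.min u v <= r <= Num.max u v -> 0 <= k r <= B.
  by move=> /(abs_between uN vN) /k_bound ->; rewrite k_ge0.
have /andP[h1 h2] := taylor_integral_cmp kB.
move: h1; rewrite mul0r mul0r => ->/=; apply: (le_trans h2).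
apply: ler_wpM2r; first exact: sqr_ge0.
by move: B_ge0; lra.
Qed.

Lemma taylor_integral_split u m v : `|u| <= N -> `|m| <= N -> `|v| <= N ->
  `|G u v - G u m - G m v| <= B * `|m - u| * `|v - m|.
Proof.
move=> uN mN vN.
have iw a b : lam.-integrable setT (EFin \o (fun r => k r * w a b r)).
  exact: integrable_mul_taylor_kernel.
have i1 : lam.-integrable setT (EFin \o \1_(between u m)).
  by rewrite /between; case: ifP => _; exact: integrable_indic_itv.
have ib : lam.-integrable setT (EFin \o (fun r => B * `|v - m| * \1_(between u m) r)).
  rewrite (_ : _ \o _ = (fun r => (B * `|v - m|)%:E * (EFin \o \1_(between u m)) r)%E)//.
  exact: integrableZl.
have -> : B * `|m - u| * `|v - m| = \int[lam]_r (B * `|v - m| * \1_(between u m) r).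
  by rewrite RintegralZl// Rintegral_between mulrAC.
have le r : k r * w u v r <= k r * w u m r + k r * w m v r + B * `|v - m| * \1_(between u m) r /\
    k r * w u m r + k r * w m v r <= k r * w u v r + B * `|v - m| * \1_(between u m) r.
  have [h1 h2] := taylor_kernel_split u m v r.
  have h3 : k r * (`|v - m| * \1_(between u m) r) <= B * `|v - m| * \1_(between u m) r.
    rewrite -mulrA; have [/set_mem rb|rb] := boolP (r \in between u m); last first.
      by rewrite indicE (negbTE rb) !mulr0.
    apply: ler_wpM2r; first by rewrite mulr_ge0// indicE.
    apply: k_bound; move: uN mN; rewrite !ler_norml => /andP[a1 a2] /andP[a3 a4].
    move: rb; rewrite /between; case: leP => um; rewrite /= in_itv/= => /andP[b1 b2];
      by apply/andP; split; lra.
  have := ler_wpM2l (k_ge0 r) h1; have := ler_wpM2l (k_ge0 r) h2.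
  by rewrite !mulrDr => h4 h5; split; lra.
set I := \int[lam]_r (B * _ * _).
have i2 := integrable_addR (iw u m) (iw m v).
have H1 : G u v <= G u m + G m v + I.
  rewrite /G /I -RintegralD//= -RintegralD//=.
  apply: le_Rintegral => //; first exact: integrable_addR.
  by move=> r _; have [] := le r.
have H2 : G u m + G m v <= G u v + I.
  rewrite /G /I -RintegralD//= -RintegralD//=.
  apply: le_Rintegral => //; first exact: integrable_addR.
  by move=> r _; have [] := le r.
by apply/ler_normlP; split; lra.
Qed.

End bounded_density.

End taylor_kernel_estimates.

Section jump_decomposition.
Context {R : realType}.
Variables (F : cumulative R R) (h q : R -> R).
Hypothesis mh : measurable_fun setT h.
Hypothesis h_ge0 : forall s, 0 <= h s.
Hypothesis q_ge0 : forall s, 0 <= q s.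

Local Notation nu := (lebesgue_stieltjes_measure (continuous_part F)).

(** For [h = c] and [q = c * jump F] the two terms recombine into [c * (F b - F a)]. The estimates
    below compare with this model separately on the continuous part and on the jumps. *)
Definition decomposed a b : \bar R :=
  (\int[nu]_(s in `]a, b]) (h s)%:E + \esum_(s in `]a, b]) (q s)%:E)%E.

Local Notation psi := decomposed.

Let mI (a b : R) : measurable (`]a, b]%classic : set (measurableTypeR R)).
Proof. exact: measurable_itv. Qed.

Let mhI (a b : R) : measurable_fun (`]a, b] : set (measurableTypeR R)) (EFin \o h).
Proof. by apply/measurable_EFinP; apply: measurable_funTS. Qed.

Let jump0 s : (0 <= (jump F s)%:E)%E.
Proof. by rewrite lee_fin cumulative_jump_ge0. Qed.

Let nuI a b : a <= b -> nu `]a, b] = (continuous_part F b - continuous_part F a)%:E.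
Proof. exact: lebesgue_stieltjes_itv_oc. Qed.

Let int_cst (c a b : R) : a <= b -> (\int[nu]_(s in `]a, b]) c%:E =
  (c * (continuous_part F b - continuous_part F a))%:E)%E.
Proof. by move=> ab; rewrite integral_cst// EFinM; congr (_ * _)%E; exact: nuI. Qed.

Let esum_cst c a b : 0 <= c -> 0 <= a <= b ->
  (\esum_(s in `]a, b]) (c * jump F s)%:E =
   (c * (F b - F a - (continuous_part F b - continuous_part F a)))%:E)%E.
Proof.
move=> c0 ab; under eq_esum do rewrite EFinM.
by rewrite esumZl// continuous_part_increment.
Qed.

Lemma decomposed_ge0 a b : (0 <= psi a b)%E.
Proof.
rewrite adde_ge0//; first by apply: integral_ge0 => s _; rewrite lee_fin.
by apply: esum_ge0 => s _; rewrite lee_fin.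
Qed.

Lemma decomposed_le c a b : 0 <= c -> 0 <= a <= b ->
  (forall s, a < s <= b -> h s <= c /\ q s <= c * jump F s) ->
  (psi a b <= (c * (F b - F a))%:E)%E.
Proof.
move=> c0 ab hq; have lab : a <= b by case/andP: ab.
set C := continuous_part F b - continuous_part F a.
rewrite (_ : c * (F b - F a) = c * C + c * (F b - F a - C)); last by ring.
rewrite EFinD -int_cst// -esum_cst// leeD//.
  apply: ge0_le_integral => //.
  - by move=> s _; rewrite lee_fin.
  - by move=> s; rewrite /= in_itv/= lee_fin => /hq[].
apply: le_esum => s; rewrite /= in_itv/= lee_fin => /hq[]//.
Qed.

(** The error is added on the larger side: [c - w] may be negative, and all terms are kept
    nonnegative. *)
Lemma decomposed_ge c w a b : 0 <= c -> 0 <= w -> 0 <= a <= b ->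
  (forall s, a < s <= b -> c <= h s + w /\ c * jump F s <= q s + w * jump F s) ->
  ((c * (F b - F a))%:E <= psi a b + (w * (F b - F a))%:E)%E.
Proof.
move=> c0 w0 ab hq; have lab : a <= b by case/andP: ab.
set C := continuous_part F b - continuous_part F a.
rewrite (_ : c * (F b - F a) = c * C + c * (F b - F a - C)); last by ring.
rewrite (_ : w * (F b - F a) = w * C + w * (F b - F a - C)); last by ring.
rewrite !EFinD -!int_cst// -!esum_cst// /psi addeACA leeD//.
  rewrite -ge0_integralD//=; last by move=> s _; rewrite lee_fin.
  apply: ge0_le_integral => //.
  - by apply/emeasurable_funD => //; exact: mhI.
  - by move=> s; rewrite /= in_itv/= -EFinD lee_fin => /hq[].
rewrite -esumD; first last.
- by move=> s _; rewrite lee_fin mulr_ge0// cumulative_jump_ge0.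
- by move=> s _; rewrite lee_fin.
by apply: le_esum => s; rewrite /= in_itv/= -EFinD lee_fin => /hq[].
Qed.

Lemma decomposed_add a b : 0 <= a <= b -> (psi 0%R b = psi 0%R a + psi a b)%E.
Proof.
move=> /andP[a0 ab].
have E : `]0, b]%classic = `]0, a]%classic `|` `]a, b]%classic :> set R.
  by rewrite -itv_bndbnd_setU// bnd_simp.
have D : [disjoint `]0, a]%classic & (`]a, b]%classic : set R)].
  apply/disj_set2P; rewrite -subset0 => s [] /=; rewrite !in_itv/=.
  by move=> /andP[_ sa] /andP[]; rewrite ltNge sa.
rewrite /psi addeACA; congr (_ + _)%E.
  rewrite E ge0_integral_setU//=.
    by apply/measurable_EFinP; apply: measurable_funTS.
  by move=> s _; rewrite lee_fin.
rewrite (esumID `]0, a]%classic)//; last by move=> s _; rewrite lee_fin.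
congr (_ + _)%E; congr esum; apply/seteqP; split => s /=; rewrite !in_itv/=.
- by case.
- by move=> /andP[-> sa]; split => //=; exact: le_trans ab.
- by case=> /andP[-> ->] /= /negP; rewrite andbT -ltNge.
- move=> /andP[as_ ->]; rewrite (le_lt_trans a0 as_); split => //.
  by apply/negP; rewrite /= -ltNge.
Qed.

Lemma decomposed_ge_jump a b : a < b -> ((q b)%:E <= psi a b)%E.
Proof.
move=> ab; apply: (@le_trans _ _ (\esum_(s in `]a, b]) (q s)%:E)%E); last first.
  by rewrite leeDr// integral_ge0// => s _; rewrite lee_fin.
rewrite -(@esum_set1 _ _ b (fun s => (q s)%:E))//; last by rewrite lee_fin.
by apply: esum_subset_le => [s|s ->]; rewrite ?lee_fin//= in_itv/= ab lexx.
Qed.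

(** The jump at [b] is kept exact, so that what remains in the bound tends to 0 as [a] increases to
    [b]. *)
Lemma decomposed_le_jump c a b : 0 <= c -> 0 <= a < b ->
  (forall s, a < s <= b -> h s <= c /\ q s <= c * jump F s) ->
  (psi a b <= (q b + c * (F b - F a - jump F b))%:E)%E.
Proof.
move=> c0 /andP[a0 ab] hq.
set C := continuous_part F b - continuous_part F a.
have split (g : R -> R) : (forall s, 0 <= g s) -> (\esum_(s in `]a, b]) (g s)%:E =
    (g b)%:E + \esum_(s in `]a, b[) (g s)%:E)%E.
  move=> g0; rewrite (esumID [set b])//; last by move=> s _; rewrite lee_fin.
  congr (_ + _)%E.
    rewrite (_ : _ `&` _ = [set b]) ?esum_set1 ?lee_fin//.
    by apply/setIidr => s ->; rewrite /= in_itv/= ab lexx.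
  congr esum; apply/seteqP; split => s /=; rewrite !in_itv/=.
    by case=> /andP[-> sb] /eqP nsb; rewrite lt_neqAle nsb.
  by move=> /andP[-> sb]; rewrite ltW//; split => // sb'; move: sb; rewrite sb' ltxx.
have c_jump s : 0 <= c * jump F s by rewrite mulr_ge0// cumulative_jump_ge0.
have := esum_cst c0 (_ : 0 <= a <= b); rewrite a0 (ltW ab) -/C => /(_ isT).
rewrite (split _ c_jump) => Ec.
have rest : (\esum_(s in `]a, b[) (c * jump F s)%:E =
    (c * (F b - F a - C) - c * jump F b)%:E)%E.
  by rewrite EFinB -Ec addeAC subee// add0e.
rewrite /psi (split _ q_ge0).
rewrite (_ : q b + _ = c * C + (q b + (c * (F b - F a - C) - c * jump F b))); last by ring.
rewrite [leRHS]EFinD; apply: leeD; first rewrite -(int_cst c (ltW ab)).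
  apply: ge0_le_integral => //.
  - by move=> s _; rewrite lee_fin.
  - by move=> s; rewrite /= in_itv/= lee_fin => /hq[].
rewrite EFinD leeD2l// -rest; apply: le_esum => s.
by rewrite /= in_itv/= lee_fin => /andP[as_ /ltW sb]; case: (hq s); rewrite ?as_.
Qed.

End jump_decomposition.

Section taylor_sums.
Context {R : realType}.
Variables (T : R) (pi : nat -> seq R).
Hypothesis T_gt0 : 0 < T.
Hypothesis pi_partition : forall n, itv_partition 0 T (pi n).
Hypothesis pi_mesh : mesh (pi n) @[n --> \oo] --> 0.
Variable x : R -> R.
Hypothesis x_cadlag : cadlag T x.
Variable mu : {finite_measure set (measurableTypeR R) -> \bar R}.
Hypothesis mu_qv : is_qv_measure T pi x mu.
Variable k : R -> R.
Hypothesis ck : continuous k.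
Hypothesis k_ge0 : forall r, 0 <= k r.

Local Notation F := (qv mu).
Local Notation y := (stopped T x).
Local Notation yl := (stopped_left T x).
Local Notation G := (taylor_integral k).

Definition taylor_limit a b : \bar R :=
  decomposed (qv mu) (fun s => k (y s) / 2) (fun s => G (yl s) (y s)) a b.

Local Notation psi := taylor_limit.

Lemma continuous_integrable_itv (g : R -> R) c d : continuous g ->
  (@lebesgue_measure R).-integrable `[c, d] (EFin \o g).
Proof.
move=> cg; apply: continuous_compact_integrable; first exact: segment_compact.
exact: continuous_subspaceT.
Qed.

Let mk c d : (@lebesgue_measure R).-integrable `[c, d] (EFin \o k).
Proof. exact: continuous_integrable_itv. Qed.

Let mky : measurable_fun setT (fun s => k (y s) / 2).
Proof.
apply: measurable_funM => //; apply: measurableT_comp.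
  exact: continuous_measurable_fun.
exact: measurable_stopped.
Qed.

Let ky_ge0 s : 0 <= k (y s) / 2.
Proof. by rewrite divr_ge0. Qed.

Let q_ge0 s : 0 <= G (yl s) (y s).
Proof.
by apply: Rintegral_ge0 => // r _; rewrite mulr_ge0// taylor_kernel_ge0.
Qed.

Let k_near u w : 0 < w -> exists2 d, 0 < d & forall r, `|r - u| <= d ->
  k u - w <= k r <= k u + w.
Proof.
move=> w0; have /cvgrPdist_le/(_ _ w0) := @ck u.
rewrite -nbhs_nbhs_norm => -[d /= d0 kd]; exists (d / 2); first by rewrite divr_gt0.
move=> r rd; have : `|k u - k r| <= w.
  apply: kd; rewrite /= distrC (le_lt_trans rd)// ltr_pdivrMr// ltr_pMr// ltr1n//.
by move=> /ler_normlP[]; lra.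
Qed.

Let G_near u w : 0 < w -> exists2 d, 0 < d & forall a b, `|a - u| <= d -> `|b - u| <= d ->
  (k u - w) / 2 * (b - a) ^+ 2 <= G a b <= (k u + w) / 2 * (b - a) ^+ 2.
Proof.
move=> w0; have [d d0 kd] := k_near u w0; exists d => // a b ad bd.
apply: taylor_integral_cmp => // r rab; apply: kd.
move: ad bd rab; rewrite !ler_norml ge_min le_max.
by move=> /andP[? ?] /andP[? ?] /andP[/orP h1 /orP h2]; apply/andP; split;
  [case: h1|case: h2]; lra.
Qed.

Lemma stopped_left_near a d e : 0 <= e ->
  (forall r, a <= r < a + d -> `|y r - y a| <= e) ->
  forall s, a < s < a + d -> `|yl s - y a| <= e.
Proof.
move=> e0 yd s /andP[as_ sd]; apply/ler_addgt0Pr => w w0.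
have [d' d'0 yd'] := stopped_left_limit T_gt0 x_cadlag s w0.
pose r := s - Num.min (d' / 2) (s - a).
have h1 : 0 < Num.min (d' / 2) (s - a) by rewrite lt_min divr_gt0//= subr_gt0.
have h2 : Num.min (d' / 2) (s - a) <= d' / 2 by rewrite ge_min lexx.
have h3 : Num.min (d' / 2) (s - a) <= s - a by rewrite ge_min lexx orbT.
have hr : s - d' < r < s by rewrite /r; apply/andP; split; lra.
have ha : a <= r < a + d by rewrite /r; apply/andP; split; lra.
have := yd' _ hr; have := yd _ ha; rewrite !ler_norml => /andP[? ?] /andP[? ?].
by apply/andP; split; lra.
Qed.

(** Near a point [a] the path stays where [k] is within [w] of [k (y a)]. There the integrand
    [k (y s) / 2] and the ratio of each jump term to the squared jump both lie between
    [(k (y a) - w) / 2] and [(k (y a) + w) / 2], so the limit grows like [k (y a) / 2] times [F],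
    just as the sums do. *)
Lemma taylor_sum_cvg t : 0 <= t <= T ->
  psi 0 t \is a fin_num /\
  forall e, 0 < e -> \forall n \near \oo,
    `|stopped_sum G y (pi n) 0 t - fine (psi 0 t)| <= e.
Proof.
have [N yN] := stopped_bounded T_gt0 x_cadlag.
have ylN := stopped_left_bounded T_gt0 x_cadlag yN.
have N0 : 0 <= N by exact: le_trans (yN 0).
have [m _ kB] : exists2 c, c \in `[- N, N]%R & forall r, r \in `[- N, N]%R -> k r <= k c.
  by apply: EVT_max; [rewrite -subr_ge0 opprK addr_ge0|exact: continuous_subspaceT].
set B := k m in kB; have B0 : 0 <= B by exact: k_ge0.
have {}kB r : `|r| <= N -> k r <= B by move=> rN; apply: kB; rewrite in_itv/= -ler_norml.
have Gb u v : `|u| <= N -> `|v| <= N -> 0 <= G u v <= B * (v - u) ^+ 2.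
  exact: taylor_integral_bound.
(* The condition on the jumps of [x] enters here: it turns the bound of [G] by a squared increment
   into a bound of the jump terms by the jumps of [F]. *)
have jumpE s : 0 <= s <= T -> jump F s = (y s - yl s) ^+ 2; first exact: (jump_qv mu_qv).
have bnd a b : 0 <= a -> b <= T -> forall s, a < s <= b ->
    k (y s) / 2 <= B /\ G (yl s) (y s) <= B * jump F s.
  move=> a0 bT s /andP[as_ sb]; split.
    by have := kB _ (yN s); have := k_ge0 (y s); lra.
  rewrite jumpE; last by rewrite (le_trans a0 (ltW as_)) (le_trans sb bT).
  by have /andP[] := Gb _ _ (ylN s) (yN s).
have psi_fin a b : 0 <= a <= b -> b <= T -> psi a b \is a fin_num.
  move=> ab bT; rewrite ge0_fin_numE; last exact: decomposed_ge0.
  apply: (@le_lt_trans _ _ (B * (F b - F a))%:E); last exact: ltry.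
  by apply: decomposed_le => //; apply: bnd => //; case/andP: ab.
have psiB a b : 0 <= a <= b -> b <= T ->
    fine (psi 0 b) - fine (psi 0 a) = fine (psi a b).
  move=> ab bT; case/andP: (ab) => a0 ab'.
  rewrite {1}/psi (decomposed_add _ mky ky_ge0 q_ge0 ab) fineD ?psi_fin ?lexx//.
    by rewrite addrC addKr.
  exact: le_trans ab' bT.
move=> tT; split; first by apply: psi_fin; case/andP: tT => // ->; rewrite lexx.
move=> e e0.
refine (stopped_sum_cvg pi_partition pi_mesh (stopped_right T_gt0 x_cadlag)
  (stopped_left_limit T_gt0 x_cadlag) yN B0 Gb _ ylN _ _
  (qv_left mu_qv)
  (stopped_sqsum_cvg_qv T_gt0 pi_partition pi_mesh x_cadlag mu_qv)
  (c := fun s => k (y s) / 2) (Phi := fun s => fine (psi 0 s)) (F := F) _ _ _ _ tT e0).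
- move=> u v w uN vN wN; exact: (taylor_integral_split mk k_ge0 kB).
- by rewrite (qv0 T_gt0 mu_qv).
- by move=> a b /andP[_ ab] _; exact: cumulative_le.
- move=> s w w0; have [d d0 Gd] := G_near (y s) w0; exists d => // u v ud vd.
  have /andP[h1 h2] := Gd _ _ ud vd; have := sqr_ge0 (v - u).
  set Q := (v - u) ^+ 2 in h1 h2 * => Q0.
  have wQ : 0 <= w * Q by rewrite mulr_ge0// ltW.
  by rewrite ler_norml; apply/andP; split; nra.
- rewrite /psi /decomposed set_itv_ge ?bnd_simp ?ltxx// integral_set0 esum_set0 add0e.
  by [].
- move=> a w /andP[a0 aT] w0.
  have [d1 d10 kd] := k_near (y a) w0; have [d2 d20 Gd] := G_near (y a) w0.
  have d_gt0 : 0 < Num.min d1 d2 by rewrite lt_min d10.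
  have [d d0 yd] := stopped_right T_gt0 x_cadlag a d_gt0.
  exists d => // b /andP[ab bd] bT.
  have ab' : 0 <= a <= b by rewrite a0 ltW.
  have ybnd s : a < s <= b -> `|y s - y a| <= Num.min d1 d2.
    by move=> /andP[as_ sb]; apply: yd; rewrite ltW//= (le_lt_trans sb).
  have ylbnd s : a < s <= b -> `|yl s - y a| <= Num.min d1 d2.
    move=> /andP[as_ sb]; apply: (stopped_left_near (ltW d_gt0) yd).
    by rewrite as_ (le_lt_trans sb).
  have kab s : a < s <= b -> k (y a) - w <= k (y s) <= k (y a) + w.
    by move=> /ybnd; rewrite le_min => /andP[/kd].
  have Gab s : a < s <= b -> (k (y a) - w) / 2 * jump F s <= G (yl s) (y s)
      <= (k (y a) + w) / 2 * jump F s.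
    move=> asb; rewrite jumpE; last first.
      by case/andP: asb => as_ sb; rewrite (le_trans a0 (ltW as_)) (le_trans sb).
    by have := ybnd _ asb; have := ylbnd _ asb; rewrite !le_min => /andP[_ ?] /andP[_ ?]; exact: Gd.
  have upper : (psi a b <= ((k (y a) + w) / 2 * (F b - F a))%:E)%E.
    apply: decomposed_le => //; first by have := k_ge0 (y a); lra.
    by move=> s sab; have /andP[_ ?] := kab _ sab; have /andP[_ ?] := Gab _ sab; split => //; lra.
  have lower : ((k (y a) / 2 * (F b - F a))%:E <= psi a b + (w / 2 * (F b - F a))%:E)%E.
    apply: decomposed_ge => //; first by rewrite divr_ge0// ltW.
    move=> s sab; have /andP[? _] := kab _ sab; have /andP[? _] := Gab _ sab; split => //; first by lra.
    by nra.
  have Fab : 0 <= F b - F a by rewrite subr_ge0 cumulative_le// ltW.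
  have wF : 0 <= w * (F b - F a) by rewrite mulr_ge0// ltW.
  have pfin := psi_fin _ _ ab' bT.
  rewrite psiB//; move: upper lower; rewrite -(fineK pfin) -EFinD !lee_fin => u l.
  move: wF u l; set wF := w * _; set A := k (y a) / 2 * _.
  rewrite (_ : (k (y a) + w) / 2 * _ = A + wF / 2); last by rewrite /A /wF; field.
  rewrite (_ : w / 2 * _ = wF / 2); last by rewrite /wF; field.
  by move=> wF0 u l; rewrite ler_norml; apply/andP; split; lra.
- move=> a b /andP[a0 ab] bT.
  have ab' : 0 <= a <= b by rewrite a0 ltW.
  have pfin := psi_fin _ _ ab' bT.
  rewrite psiB//.
  have : ((G (yl b) (y b))%:E <= psi a b)%E.
    by apply: (@decomposed_ge_jump _ _ (fun s => k (y s) / 2) (fun s => G (yl s) (y s))).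
  have : (psi a b <= (G (yl b) (y b) + B * (F b - F a - jump F b))%:E)%E.
    apply: (@decomposed_le_jump _ _ (fun s => k (y s) / 2) (fun s => G (yl s) (y s)) mky
      ky_ge0 q_ge0 _ _ _ B0) => //; [by rewrite a0|exact: bnd].
  rewrite -(fineK pfin) !lee_fin => h1 h2.
  rewrite ger0_norm ?subr_ge0//; move: h1; rewrite jumpE; last by rewrite (le_trans a0 (ltW ab)).
  by lra.
Qed.

End taylor_sums.

(** * Occupation formula and Riemann sums *)

Section countable_sums.
Context {R : realType}.
Local Notation lam := (@lebesgue_measure R).

(** The enumeration is chosen before the summand, so one series represents the sum for all
    parameters [u] at once, as exchanging it with an integral in [u] requires. *)
Lemma esum_countable (A : set R) : countable A -> exists (B : set nat) (g : nat -> R),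
  (forall n, B n -> A (g n)) /\
  forall b : R -> \bar R, (forall s, 0 <= b s)%E ->
    (\esum_(s in A) b s = \sum_(n <oo) if n \in B then b (g n) else 0)%E.
Proof.
move=> /countable_injP[e einj].
exists (e @` A), (pinv A e); split.
  by move=> _ [s As <-]; rewrite pinvKV ?inE.
move=> b b0; rewrite nneseries_esumT; last by move=> n; case: ifP.
rewrite -esum_mkcond esum_image//.
by apply: eq_esum => s As; rewrite pinvKV ?inE.
Qed.

Lemma ge0_integral_esum (A : set R) (a : R -> R -> \bar R) : countable A ->
  (forall s, measurable_fun setT (a s)) -> (forall s u, 0 <= a s u)%E ->
  measurable_fun setT (fun u => \esum_(s in A) a s u)%E /\
  (\int[lam]_u (\esum_(s in A) a s u) = \esum_(s in A) (\int[lam]_u a s u))%E.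
Proof.
move=> /esum_countable[B [g [_ E]]] ma a0.
under eq_fun do rewrite E//.
have m n : measurable_fun setT (fun u => if n \in B then a (g n) u else 0%E).
  by case: (n \in B).
have ge0 n u : (0 <= if n \in B then a (g n) u else 0)%E by case: ifP.
split; first exact: ge0_emeasurable_sum.
rewrite integral_nneseries// E; last by move=> s; apply: integral_ge0.
apply: eq_eseriesr => n _; case: ifP => // _; exact: integral0.
Qed.

Lemma countable_jumps (F : cumulative R R) (a b : R) :
  countable [set s | a < s < b /\ jump F s != 0].
Proof.
have nd : {in `[a, b] &, nondecreasing_fun F}.
  by move=> r s _ _; exact: cumulative_le.
apply: sub_countable (discontinuity_countable nd); apply: subset_card_le.
move=> s /= [sab]; rewrite in_itv/= sab => js; split => //.
have Fs : F r @[r --> s^'+] --> F s by exact: cumulative_is_right_continuous.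
split; first exact: cumulative_left_cvg.
  by apply/cvg_ex; exists (F s).
rewrite (cvg_lim _ Fs)//; apply: contra js => /eqP E.
by rewrite /jump E subrr.
Qed.

End countable_sums.

Section occupation.
Context {R : realType}.
Variables (T : R) (pi : nat -> seq R).
Variable x : R -> R.
Variable mu : {finite_measure set (measurableTypeR R) -> \bar R}.
Hypothesis mu_qv : is_qv_measure T pi x mu.
Local Notation lam := (@lebesgue_measure R).
Local Notation w s := (taylor_kernel (left_value x s) (x s)).

Lemma taylor_kernel_xx (a r : R) : taylor_kernel a a r = 0.
Proof.
by rewrite taylor_kernelE lexx indic_itvE in_itv/= -eq_le;
  have [->|_] := eqVneq a r; rewrite ?subrr ?mul0r ?mulr0.
Qed.

(** The sum over the uncountable []0, t]] has nonzero terms only at jump times of [x], which are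
    jump times of the monotone function [qv mu] and hence countably many; Tonelli applies to what is
    left. *)
Lemma ge0_integral_jumps (g : R -> R) t : measurable_fun setT g -> (forall u, 0 <= g u) ->
  0 <= t <= T ->
  measurable_fun setT (fun u => \esum_(s in `]0%R, t]) (g u * w s u)%:E)%E /\
  (\int[lam]_u (\esum_(s in `]0%R, t]) (g u * w s u)%:E) =
   \esum_(s in `]0%R, t]) \int[lam]_u (g u * w s u)%:E)%E.
Proof.
move=> mg g0 /andP[t0 tT].
pose A := [set s : R | 0 < s <= t /\ left_value x s != x s].
have cA : countable A.
  (* The upper end [T + 1] makes room for a jump at [T] in an open interval. *)
  apply: sub_countable (countable_jumps (qv mu) 0 (T + 1)); apply: subset_card_le.
  move=> s [/andP[s0 st] xs] /=.
  have sT : s <= T by exact: le_trans tT.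
  split; first by rewrite s0 (le_lt_trans sT)// ltrDl.
  by rewrite (proj2 mu_qv) ?sT ?ltW// sqrf_eq0 subr_eq0 eq_sym.
have E (b : R -> \bar R) : (forall s, 0 <= b s)%E ->
    (forall s, left_value x s = x s -> b s = 0%E) ->
    (\esum_(s in `]0%R, t]) b s = \esum_(s in A) b s)%E.
  move=> b0 bx; rewrite [LHS](esumID A)// [X in (_ + X)%E]esum1 ?adde0.
    by congr esum; apply/setIidr => s [+ _]; rewrite /= in_itv.
  by move=> s [] /=; rewrite in_itv/= => st nA; apply: bx; apply/eqP/negPn/negP => ?;
    apply: nA.
have w0 s u : (0 <= (g u * w s u)%:E)%E by rewrite lee_fin mulr_ge0// taylor_kernel_ge0.
have [m i] : measurable_fun setT (fun u => \esum_(s in A) (g u * w s u)%:E)%E /\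
    (\int[lam]_u (\esum_(s in A) (g u * w s u)%:E) =
     \esum_(s in A) \int[lam]_u (g u * w s u)%:E)%E.
  apply: ge0_integral_esum => // s; apply/measurable_EFinP; apply: measurable_funM => //.
  exact: measurable_taylor_kernel.
have EA u : (\esum_(s in `]0%R, t]) (g u * w s u)%:E = \esum_(s in A) (g u * w s u)%:E)%E.
  by apply: E => // s ->; rewrite taylor_kernel_xx mulr0.
under eq_fun do rewrite EA.
split => //; rewrite i; apply/esym/E => [s|s ->]; first exact: integral_ge0.
by under eq_integral do rewrite taylor_kernel_xx mulr0; exact: integral0.
Qed.

Lemma measurable_jump_local_time t : 0 <= t <= T ->
  measurable_fun setT (jump_local_time x t).
Proof.
move=> tT; have m1 : measurable_fun setT (fun _ : R => 1 : R) by exact: measurable_cst.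
have [+ _] := ge0_integral_jumps m1 (fun=> ler01) tT.
by under eq_fun do under eq_esum do rewrite mul1r.
Qed.

Lemma jump_local_time_ge0 t u : (0 <= jump_local_time x t u)%E.
Proof. by apply: esum_ge0 => s _; rewrite lee_fin taylor_kernel_ge0. Qed.

Lemma ge0_integral_jump_local_time (g : R -> R) t :
  measurable_fun setT g -> (forall u, 0 <= g u) -> 0 <= t <= T ->
  (\int[lam]_u ((g u)%:E * jump_local_time x t u) =
   \esum_(s in `]0%R, t]) \int[lam]_u (g u * w s u)%:E)%E.
Proof.
move=> mg g0 tT; have [_ <-] := ge0_integral_jumps mg g0 tT.
apply: eq_integral => u _; rewrite /jump_local_time -esumZl//.
Qed.

Variable L : R -> R -> R.
Hypothesis mL : measurable_fun (`[0, T] `*` [set: R]) (fun z : R * R => L z.1 z.2).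
Hypothesis L_ge0 : forall t u, 0 <= t <= T -> 0 <= L t u.

Lemma measurable_local_time t : 0 <= t <= T -> measurable_fun setT (L t).
Proof.
move=> tT; have E : L t = (fun z : R * R => L z.1 z.2) \o (fun u => (t, u)) by [].
rewrite E; apply: (measurable_comp _ _ mL).
- by apply: measurableX => //; exact: measurable_itv.
- by move=> _ [u _ <-]; split => //=; rewrite in_itv.
- exact: measurable_pair1.
Qed.

Lemma measurable_local_time_density t : 0 <= t <= T ->
  measurable_fun setT (local_time_density x L t).
Proof.
move=> tT; apply: emeasurable_funD; last exact: measurable_jump_local_time.
apply/measurable_EFinP; apply: measurable_funM => //; exact: measurable_local_time.
Qed.

Lemma local_time_density_ge0 t u : 0 <= t <= T -> (0 <= local_time_density x L t u)%E.
Proof. by move=> tT; rewrite adde_ge0 ?jump_local_time_ge0// lee_fin divr_ge0// L_ge0. Qed.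

Hypothesis occupation : forall t, 0 <= t <= T ->
  forall g : R -> R, measurable_fun setT g -> (forall u, 0 <= g u) ->
  (\int[lam]_u (g u * L t u)%:E =
   \int[lebesgue_stieltjes_measure (continuous_part (qv mu))]_(s in `]0%R, t]) (g (x s))%:E)%E.

Lemma ge0_integral_local_time_density (g : R -> R) t :
  measurable_fun setT g -> (forall u, 0 <= g u) -> 0 <= t <= T ->
  (\int[lam]_u ((g u)%:E * local_time_density x L t u) =
   \int[lebesgue_stieltjes_measure (continuous_part (qv mu))]_(s in `]0%R, t])
      (g (x s) / 2)%:E +
   \esum_(s in `]0%R, t]) \int[lam]_u (g u * w s u)%:E)%E.
Proof.
move=> mg g0 tT; rewrite -ge0_integral_jump_local_time//.
have mL' := measurable_local_time tT; have mJ := measurable_jump_local_time tT.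
rewrite -(@occupation t tT (fun r => g r / 2)); first last.
- by move=> u; rewrite divr_ge0.
- exact: measurable_funM.
rewrite -ge0_integralD//.
- apply: eq_integral => u _; rewrite ge0_muleDr ?jump_local_time_ge0 ?lee_fin ?divr_ge0 ?L_ge0//.
  by rewrite -EFinM; congr (_%:E + _)%E; rewrite mulrAC mulrA.
- by move=> u _; rewrite lee_fin mulr_ge0 ?divr_ge0 ?L_ge0.
- by apply/measurable_EFinP; apply: measurable_funM => //; exact: measurable_funM.
- by move=> u _; rewrite mule_ge0 ?lee_fin// jump_local_time_ge0.
- by apply: emeasurable_funM => //; exact/measurable_EFinP.
Qed.

End occupation.

Section class_C2.
Context {R : realType}.

Lemma increment_continuous_derivative (f f1 : R -> R) u v : u <= v -> continuous f1 ->
  (forall s : R, is_derive s 1 f (f1 s)) ->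
  f v - f u = \int[@lebesgue_measure R]_(s in `[u, v]) f1 s.
Proof.
rewrite le_eqVlt => /predU1P[-> _ _|uv cf1 df]; first by rewrite subrr set_itv1 Rintegral_set1.
rewrite /Rintegral (@continuous_FTC2 _ f1 f)//.
- exact: continuous_subspaceT.
- have cf := is_derive_continuous df.
  by split; [move=> s _; case: (df s)|exact/cvg_at_right_filter/cf|
    exact/cvg_at_left_filter/cf].
- by move=> s _; rewrite derive1E derive_val.
Qed.

Lemma class_C2_is_derive (h : R -> R) : class_C 2 h ->
  [/\ forall u : R, is_derive u 1 h (derive1 h u),
      forall u : R, is_derive u 1 (derive1 h) (derive1n 2 h u),
      continuous (derive1 h) & continuous (derive1n 2 h)].
Proof.
move=> [dh ch]; have D1 (u : R) : is_derive u 1 h (derive1 h u).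
  by rewrite derive1E; apply/derivableP; exact: (dh 0%N).
have D2 (u : R) : is_derive u 1 (derive1 h) (derive1n 2 h u).
  rewrite -[derive1n 2 h]/(derive1 (derive1 h)) derive1E; apply/derivableP.
  exact: (dh 1%N).
by split => //; exact: is_derive_continuous D2.
Qed.

Lemma taylor_remainder_C2 (h : R -> R) u v : class_C 2 h ->
  h v - h u - derive1 h u * (v - u) = taylor_integral (derive1n 2 h) u v.
Proof.
move=> /class_C2_is_derive[D1 D2 c1 c2]; apply: taylor_remainder => //.
- by move=> c d; exact: continuous_integrable_itv.
- by move=> c d cd; exact: increment_continuous_derivative.
Qed.

Lemma riemann_sumE (T : R) (s : seq R) (x h : R -> R) t :
  itv_partition 0 T s -> 0 <= t <= T -> class_C 2 h ->
  riemann_sum x h t s =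
  h (x t) - h (x 0) - stopped_sum (taylor_integral (derive1n 2 h)) (stopped T x) s 0 t.
Proof.
move=> ps /andP[t0 tT] hC; set y := stopped T x.
have telescope : \sum_(j < size s) (h (y (clamp 0 t (pt s j.+1))) - h (y (clamp 0 t (pt s j)))) =
    h (x t) - h (x 0).
  rewrite -(big_mkord xpredT (fun j => h (y (clamp 0 t (pt s j.+1))) - h (y (clamp 0 t (pt s j))))).
  rewrite telescope_sumr// (pt_size ps) clamp_r//= clamp_l// /y !stoppedE ?t0//.
  by rewrite lexx (le_trans t0).
rewrite -telescope /stopped_sum -sumrB /riemann_sum; apply: eq_bigr => j _.
have js := ltn_ord j; rewrite -/y -taylor_remainder_C2//.
have E i : (i <= size s)%N -> y (clamp 0 t (pt s i)) = x (Num.min (pt s i) t).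
  move=> si; rewrite /clamp max_l ?(pt_ge0 ps)// /y stoppedE//.
  by rewrite le_min (pt_ge0 ps)// t0/= ge_min tT orbT.
rewrite !E// 1?ltnW//.
(* The Riemann sum reads h' at the unstopped point [t_j], the telescoped sum at the stopped one.
   They differ only for [t_j > t], where the increment vanishes. *)
have [pjt|tpj] := leP (pt s j) t; first by ring.
have tpj1 : t <= pt s j.+1 by rewrite (le_trans (ltW tpj))// ltW// (pt_lt ps).
by rewrite (min_r tpj1) !subrr !mulr0 subr0 subrr.
Qed.

End class_C2.

Section follmer.
Context {R : realType}.
Variables (T : R) (pi : nat -> seq R).
Hypothesis T_gt0 : 0 < T.
Hypothesis pi_partition : forall n, itv_partition 0 T (pi n).
Hypothesis pi_mesh : mesh (pi n) @[n --> \oo] --> 0.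
Variable x : R -> R.
Hypothesis x_cadlag : cadlag T x.
Variable mu : {finite_measure set (measurableTypeR R) -> \bar R}.
Hypothesis mu_qv : is_qv_measure T pi x mu.
Local Notation lam := (@lebesgue_measure R).
Variable L : R -> R -> R.
Hypothesis mL : measurable_fun (`[0, T] `*` [set: R]) (fun z : R * R => L z.1 z.2).
Hypothesis L_ge0 : forall t u, 0 <= t <= T -> 0 <= L t u.
Hypothesis occupation : forall t, 0 <= t <= T ->
  forall g : R -> R, measurable_fun setT g -> (forall u, 0 <= g u) ->
  (\int[lam]_u (g u * L t u)%:E =
   \int[lebesgue_stieltjes_measure (continuous_part (qv mu))]_(s in `]0%R, t]) (g (x s))%:E)%E.

Local Notation K := (local_time_density x L).

Lemma taylor_limitE (k : R -> R) t : continuous k -> (forall u, 0 <= k u) -> 0 <= t <= T ->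
  taylor_limit T x mu k 0 t = (\int[lam]_u ((k u)%:E * K t u))%E.
Proof.
move=> ck k0 tT.
have mk : measurable_fun setT k by exact: continuous_measurable_fun.
rewrite (ge0_integral_local_time_density mu_qv mL L_ge0 occupation)//.
have onI s : s \in (`]0, t]%classic : set R) -> 0 < s <= T.
  rewrite inE/= in_itv/= => /andP[-> st]/=; apply: le_trans st _; by case/andP: tT.
rewrite /taylor_limit /decomposed; congr (_ + _)%E.
  apply: eq_integral => s /onI /andP[s0 sT]; rewrite stoppedE// sT andbT; exact: ltW.
apply: eq_esum => s st; have /onI /andP[s0 sT] : s \in (`]0, t]%classic : set R) by rewrite inE.
rewrite stoppedE; last by rewrite (ltW s0).
rewrite stopped_leftE ?s0// /taylor_integral /Rintegral fineK//.
apply: integrable_fin_num => //; apply: integrable_mul_taylor_kernel => c d.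
exact: continuous_integrable_itv.
Qed.

Lemma integral_local_time_density_lty (k : R -> R) t : continuous k -> (forall u, 0 <= k u) ->
  0 <= t <= T -> (\int[lam]_u ((k u)%:E * K t u) < +oo)%E.
Proof.
move=> ck k0 tT; rewrite -taylor_limitE//.
have [+ _] := taylor_sum_cvg T_gt0 pi_partition pi_mesh x_cadlag mu_qv ck k0 tT.
by rewrite ltey_eq => ->.
Qed.

Lemma local_time_density_ae_fin t : 0 <= t <= T -> {ae lam, forall u, K t u \is a fin_num}.
Proof.
move=> tT; have mK := measurable_local_time_density mu_qv mL tT.
have : lam.-integrable setT (K t).
  apply/integrableP; split => //.
  (* The density 1 shows that [K t] is integrable, whatever [p] is. *)
  have c1 : continuous (fun _ : R => 1 : R) by move=> u; exact: cvg_cst.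
  have := integral_local_time_density_lty c1 (fun=> ler01) tT.
  congr (_ < _)%E; apply: eq_integral => u _.
  by rewrite mul1e gee0_abs// (local_time_density_ge0 _ L_ge0).
by move/(integrable_ae measurableT); apply: filterS => u; exact.
Qed.

Lemma ge0_integral_fine_density (g : R -> R) t : measurable_fun setT g ->
  (forall u, 0 <= g u) -> 0 <= t <= T ->
  (\int[lam]_u (g u * fine (K t u))%:E = \int[lam]_u ((g u)%:E * K t u))%E.
Proof.
move=> mg g0 tT; have mK := measurable_local_time_density mu_qv mL tT.
have mfK : measurable_fun setT (fine \o K t) by exact: measurableT_comp.
apply: ae_eq_integral => //.
- by apply/measurable_EFinP; exact: measurable_funM.
- by apply: emeasurable_funM => //; exact/measurable_EFinP.
have FF := ae_filter_ringOfSetsType lam.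
by have := local_time_density_ae_fin tT; apply: filterS => u fK _; rewrite EFinM fineK.
Qed.

Lemma integrable_fine_density (k : R -> R) t : continuous k -> 0 <= t <= T ->
  lam.-integrable setT (fun u => (k u * fine (K t u))%:E).
Proof.
move=> ck tT; have mK := measurable_local_time_density mu_qv mL tT.
have mfK : measurable_fun setT (fine \o K t) by exact: measurableT_comp.
have mk : measurable_fun setT k by exact: continuous_measurable_fun.
have ck' : continuous (fun u => `|k u|) by move=> u; apply: cvg_norm; exact: (@ck u).
have fK0 u : 0 <= fine (K t u) by rewrite fine_ge0// (local_time_density_ge0 _ L_ge0).
apply/integrableP; split; first by apply/measurable_EFinP; exact: measurable_funM.
under eq_integral => u _ do rewrite abse_EFin normrM (ger0_norm (fK0 u)).
rewrite ge0_integral_fine_density//; first exact: integral_local_time_density_lty.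
exact: continuous_measurable_fun.
Qed.

Lemma riemann_sum_cvg (h : R -> R) t : class_C 2 h -> 0 <= t <= T ->
  riemann_sum x h t (pi m) @[m --> \oo] -->
  h (x t) - h (x 0) - \int[lam]_u (derive1n 2 h u * fine (K t u)).
Proof.
move=> hC tT; have [_ _ _ ch] := class_C2_is_derive hC.
set h2 := derive1n 2 h in ch *.
(* The convergence of the Taylor sums is known for nonnegative continuous densities, and both parts
   of h'' stay continuous. *)
pose kp u := (`|h2 u| + h2 u) / 2; pose kn u := (`|h2 u| - h2 u) / 2.
have cabs : continuous (fun u => `|h2 u|) by move=> u; apply: cvg_norm; exact: (@ch u).
have ckp : continuous kp.
  by move=> u; apply: cvgM; [apply: cvgD; [exact: cabs|exact: (@ch u)]|exact: cvg_cst].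
have ckn : continuous kn.
  by move=> u; apply: cvgM; [apply: cvgB; [exact: cabs|exact: (@ch u)]|exact: cvg_cst].
have kp0 u : 0 <= kp u by rewrite divr_ge0// -lerBlDr sub0r ler_normr lexx orbT.
have kn0 u : 0 <= kn u by rewrite divr_ge0// subr_ge0 ler_norm.
have hE u : h2 u = kp u - kn u by rewrite /kp /kn; field.
have GE u v : taylor_integral (h2) u v = taylor_integral kp u v - taylor_integral kn u v.
  rewrite /taylor_integral -RintegralB//.
  - by apply: eq_Rintegral => r _; rewrite hE mulrBl.
  - by apply: integrable_mul_taylor_kernel => c d; exact: continuous_integrable_itv.
  - by apply: integrable_mul_taylor_kernel => c d; exact: continuous_integrable_itv.
have limE (k : R -> R) : continuous k -> (forall u, 0 <= k u) ->
    fine (taylor_limit T x mu k 0 t) = \int[lam]_u (k u * fine (K t u)).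
  move=> ck k0; rewrite taylor_limitE// /Rintegral ge0_integral_fine_density//.
  exact: continuous_measurable_fun.
have stopped_cvg (k : R -> R) : continuous k -> (forall u, 0 <= k u) ->
    stopped_sum (taylor_integral k) (stopped T x) (pi m) 0 t @[m --> \oo] -->
    \int[lam]_u (k u * fine (K t u)).
  move=> ck k0; rewrite -limE//; apply/cvgrPdist_le => e e0.
  have [_ /(_ _ e0)] := taylor_sum_cvg T_gt0 pi_partition pi_mesh x_cadlag mu_qv ck k0 tT.
  by apply: filterS => m; rewrite distrC.
have -> : \int[lam]_u (h2 u * fine (K t u)) =
    \int[lam]_u (kp u * fine (K t u)) - \int[lam]_u (kn u * fine (K t u)).
  rewrite -RintegralB//; [|exact: integrable_fine_density|exact: integrable_fine_density].
  by apply: eq_Rintegral => u _; rewrite hE mulrBl.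
under eq_cvg do rewrite (riemann_sumE _ (pi_partition _) tT hC).
apply: cvgB; first exact: cvg_cst.
have SE m : stopped_sum (taylor_integral (h2)) (stopped T x) (pi m) 0 t =
    stopped_sum (taylor_integral kp) (stopped T x) (pi m) 0 t -
    stopped_sum (taylor_integral kn) (stopped T x) (pi m) 0 t.
  by rewrite /stopped_sum -sumrB; apply: eq_bigr => j _.
under eq_cvg do rewrite SE.
by apply: cvgB; exact: stopped_cvg.
Qed.

End follmer.

(** * Pairing an L^q function with an L^p function *)

Section Lp_facts.
Context {R : realType}.
Local Notation lam := (@lebesgue_measure R).

Let len (a b : R) : a <= b -> lam `[a, b]%classic = (b - a)%:E.
Proof.
move=> ab; transitivity (lebesgue_measure (`[a, b]%classic : set R)) => //.
rewrite lebesgue_measure_itv/= lte_fin; case: ltP => // ba.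
by rewrite (_ : b = a) ?subrr//; apply/le_anti; rewrite ab ba.
Qed.

Let lamT_gt0 : (0 < lam setT)%E.
Proof.
apply: (@lt_le_trans _ _ (lam `[0, 1]%classic)); first by rewrite len// subr0 lte01.
by apply: le_measure; rewrite ?inE//; exact: measurable_itv.
Qed.

Lemma Lnorm_integral_lty (f : R -> \bar R) (p : R) : 0 < p ->
  (Lnorm lam p%:E f < +oo)%E -> (\int[lam]_u (`|f u| `^ p) < +oo)%E.
Proof.
move=> p0; by rewrite unlock; apply: lty_poweRy; rewrite invr_eq0 gt_eqF.
Qed.

Lemma Lnorm_ae_bounded (f : R -> \bar R) : (Lnorm lam +oo f < +oo)%E ->
  exists C : R, 0 <= C /\ {ae lam, forall u, (`|f u| <= C%:E)%E}.
Proof.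
rewrite unlock lamT_gt0 => lty; have FF := ae_filter_ringOfSetsType lam.
exists (Num.max 0 (fine (ess_sup lam (abse \o f)))); split; first by rewrite le_max lexx.
have := ess_sup_ge lam (abse \o f); apply: filterS => u /= /le_trans; apply.
move: lty; case: (ess_sup _ _) => [r _|//|_] /=; last exact: leNye.
by rewrite lee_fin le_max lexx orbT.
Qed.

Lemma Lfun_measurable (g : R -> R) q : g \in Lfun lam q -> measurable_fun setT g.
Proof. by move=> /sub_Lfun_mfun; rewrite inE. Qed.

Lemma Lfun_finite_norm (g : R -> R) q : g \in Lfun lam q ->
  (Lnorm lam q (EFin \o g) < +oo)%E.
Proof. by move=> /sub_Lfun_finLfun; rewrite inE. Qed.

Lemma Lfun_powR_lty (g : R -> R) (q : R) : 0 < q -> g \in Lfun lam q%:E ->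
  (\int[lam]_u (`|g u| `^ q)%:E < +oo)%E.
Proof. by move=> q0 /Lfun_finite_norm /(Lnorm_integral_lty q0). Qed.

(** For finite [q] this is |g| <= 1 + |g|^q integrated over the interval. The bound depends on the
    length of the interval and not on its position, which yields global bounds on f and f' and
    estimates uniform under translation. *)
Lemma Lfun_uniformly_integrable (g : R -> R) q : (1 <= q)%E -> g \in Lfun lam q ->
  exists C : R, 0 <= C /\ forall a b, a <= b ->
    (\int[lam]_(u in `[a, b]) `|g u|%:E <= (C * (b - a) + C)%:E)%E.
Proof.
have FF := ae_filter_ringOfSetsType lam.
move=> q1 gq; have mg := Lfun_measurable gq.
have mag : measurable_fun setT (fun u => `|g u|).
  by apply: (measurableT_comp (@normr_measurable _ _)).
have magI a b : measurable_fun (`[a, b] : set R) (fun u => `|g u|%:E).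
  by apply/measurable_EFinP; exact: measurable_funTS.
have icst (c a b : R) : a <= b -> (\int[lam]_(u in `[a, b]) c%:E = (c * (b - a))%:E)%E.
  by move=> ab; rewrite integral_cst// EFinM; congr (_ * _)%E; exact: len.
case: q q1 gq => [q| |//]; last first.
  move=> _ /Lfun_finite_norm/Lnorm_ae_bounded[C [C0 gC]]; exists C; split => // a b ab.
  apply: (@le_trans _ _ (C * (b - a))%:E); last by rewrite lee_fin lerDl.
  rewrite -icst//; apply: ae_ge0_le_integral => //; first exact: magI.
  by apply: filterS gC => u gC _.
rewrite lee_fin => q1 gq; have q0 : 0 < q by exact: lt_le_trans q1.
have I := Lfun_powR_lty q0 gq.
have mp : measurable_fun setT (fun u => `|g u| `^ q).
  by apply: (measurableT_comp (measurable_powR q)).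
have I0 : (0 <= \int[lam]_u (`|g u| `^ q)%:E)%E.
  by apply: integral_ge0 => u _; rewrite lee_fin powR_ge0.
set J := (\int[lam]_u _)%E in I I0.
have fJ : 0 <= fine J by rewrite fine_ge0.
exists (1 + fine J); split; first by rewrite addr_ge0.
move=> a b ab; apply: (@le_trans _ _ (1 * (b - a) + fine J)%:E); last first.
  by rewrite lee_fin lerD ?lerDr// ler_wpM2r ?subr_ge0// lerDl.
rewrite EFinD -icst// fineK ?ge0_fin_numE//.
apply: (@le_trans _ _ (\int[lam]_(u in `[a, b]) (1 + (`|g u| `^ q)%:E))%E).
  apply: ge0_le_integral => //.
    exact: magI.
    by apply: emeasurable_funD => //; apply/measurable_EFinP; exact: measurable_funTS.
  move=> u _; rewrite -EFinD lee_fin; have [g1|g1] := leP `|g u| 1.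
    by rewrite (le_trans g1)// lerDl powR_ge0.
  by rewrite (le_trans (le1r_powR (ltW g1) q1))// lerDr.
rewrite ge0_integralD//; last first.
  by apply/measurable_EFinP; exact: measurable_funTS.
apply: leeD => //.
by apply: ge0_subset_integral => //; exact/measurable_EFinP.
Qed.

(** If [k * c <= e^(q-1)], the first term suffices. Otherwise (c k)^(p-1) >= e^((p-1)(q-1)) >= e,
    because [e >= 1] and the exponent is at least 1, and the second term suffices. The condition (p
    - 1)(q - 1) >= 1 is 1/p + 1/q <= 1 with denominators cleared, so the exponents need not be
    conjugate. *)
Lemma young_scaled (p q c e k : R) : 1 < p -> 1 < q -> 1 <= (p - 1) * (q - 1) ->
  0 < c -> 1 <= e -> 0 <= k -> e * k <= c^-1 * e `^ q + c `^ (p - 1) * k `^ p.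
Proof.
move=> p1 q1 pq c0 e1 k0; have e0 : 0 < e by exact: lt_le_trans e1.
have [kc|kc] := leP (k * c) (e `^ (q - 1)).
  rewrite -[leLHS]addr0 lerD ?mulr_ge0 ?powR_ge0//.
  rewrite -(mulr_powRB1 (ltW e0))// ?(lt_trans ltr01)// mulrCA ler_wpM2l ?(ltW e0)// ler_pdivlMl// mulrC.
  exact: kc.
rewrite -[leLHS]add0r lerD ?mulr_ge0 ?invr_ge0 ?powR_ge0 ?(ltW c0)//.
rewrite -(mulr_powRB1 k0) ?(lt_trans ltr01)// [leRHS]mulrCA [e * k]mulrC ler_wpM2l//.
rewrite -powRM ?(ltW c0)// [c * k]mulrC.
apply: (@le_trans _ _ ((e `^ (q - 1)) `^ (p - 1))); last first.
  by rewrite ge0_ler_powR ?nnegrE ?powR_ge0 ?mulr_ge0 ?(ltW kc) ?(ltW c0)// subr_ge0 ltW.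
by rewrite -powRrM; apply: le1r_powR => //; rewrite mulrC.
Qed.

(** The scale [c] makes the contribution of [K] to the integral at most [e], at the price of a large
    [A]. This [A] multiplies only [s^q], which is then made small by raising the level above which
    f'' is considered. *)
Lemma Lnorm_young (K : R -> \bar R) (p : \bar R) (q e : R) :
  measurable_fun setT K -> (forall u, 0 <= K u)%E ->
  (1 <= p)%E -> 1 <= q -> (p^-1 + (q%:E)^-1 <= 1)%E ->
  (Lnorm lam p K < +oo)%E -> 0 < e ->
  exists A : R, exists psi : R -> R,
    [/\ 0 <= A, measurable_fun setT psi, forall u, 0 <= psi u,
        (\int[lam]_u (psi u)%:E <= e%:E)%E &
        {ae lam, forall u, forall s : R, 1 <= s -> s * fine (K u) <= A * s `^ q + psi u}].
Proof.
move=> mK K0 p1 q1 pq Kp e0; have q0 : 0 < q by exact: lt_le_trans q1.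
have FF := ae_filter_ringOfSetsType lam.
have fK0 u : 0 <= fine (K u) by rewrite fine_ge0.
case: p p1 pq Kp => [p| |//]; last first.
  move=> _ _ /Lnorm_ae_bounded[C [C0 KC]]; exists C, (fun=> 0); split => //.
    by rewrite integral0 lee_fin ltW.
  apply: filterS KC => u; rewrite gee0_abs// => KC s s1.
  rewrite addr0 mulrC ler_pM// ?le1r_powR//; first exact: le_trans s1.
  by move: KC (K0 u); case: (K u).
rewrite lee_fin => p1; have p0 : 0 < p by exact: lt_le_trans p1.
rewrite !inver !gt_eqF// -EFinD lee_fin => pq.
have p_gt1 : 1 < p.
  rewrite lt_neqAle p1 andbT; apply/eqP => p1E; move: pq; rewrite -p1E invr1.
  by rewrite gerDl leNgt invr_gt0 q0.
have q_gt1 : 1 < q.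
  rewrite lt_neqAle q1 andbT; apply/eqP => q1E; move: pq; rewrite -q1E invr1.
  by rewrite gerDr leNgt invr_gt0 p0.
have pq' : 1 <= (p - 1) * (q - 1).
  have : (p^-1 + q^-1) * (p * q) <= 1 * (p * q) by rewrite ler_wpM2r// mulr_ge0// ltW.
  rewrite (_ : (p^-1 + q^-1) * (p * q) = q + p); last by field; rewrite !gt_eqF.
  by lra.
move=> /(Lnorm_integral_lty p0) I.
pose I' := (\int[lam]_u (fine (K u) `^ p)%:E)%E.
have mfK : measurable_fun setT (fine \o K) by exact: measurableT_comp.
have mfp : measurable_fun setT (fun u => fine (K u) `^ p).
  by apply: (measurableT_comp (measurable_powR p)).
have I'_lty : (I' < +oo)%E.
  apply: le_lt_trans I; apply: ge0_le_integral => //.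
  - by move=> u _; rewrite lee_fin powR_ge0.
  - exact/measurable_EFinP.
  - apply: (measurableT_comp (measurable_poweR p)); exact: measurableT_comp.
  - move=> u _; rewrite gee0_abs//; move: (K0 u); case: (K u) => [r|/=|//] //.
    by rewrite powR0 ?gt_eqF// poweR_ge0.
have I'0 : (0 <= I')%E by apply: integral_ge0 => u _; rewrite lee_fin powR_ge0.
have I'f : I' \is a fin_num by rewrite ge0_fin_numE.
(* [d] times the integral of [K^p] is below [e], and adding [e] to the denominator keeps it positive
   when that integral is 0; [c] is then chosen so that c^(p-1) = d. *)
pose d := e / (fine I' + e).
have fI0 : 0 <= fine I' by rewrite fine_ge0.
have d0 : 0 < d by rewrite divr_gt0// ltr_wpDl.
pose c := d `^ (p - 1)^-1.
have c0 : 0 < c by rewrite powR_gt0.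
have cd : c `^ (p - 1) = d.
  by rewrite /c -powRrM mulVf ?powRr1 ?(ltW d0)// subr_eq0 gt_eqF.
exists c^-1, (fun u => d * fine (K u) `^ p); split.
- by rewrite invr_ge0 ltW.
- exact: measurable_funM.
- by move=> u; rewrite mulr_ge0 ?powR_ge0// ltW.
- under eq_integral do rewrite EFinM.
  rewrite ge0_integralZl//.
  + rewrite -/I' -(fineK I'f) -EFinM lee_fin /d mulrAC ler_pdivrMr ?ltr_wpDl//.
    by rewrite mulrDr lerDl mulr_ge0// ltW.
  + exact/measurable_EFinP.
  + by move=> u _; rewrite lee_fin powR_ge0.
  + by rewrite lee_fin ltW.
- by apply: aeW => u s s1; rewrite -cd; exact: young_scaled.
Qed.

End Lp_facts.

Section translated_pairing.
Context {R : realType}.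
Local Notation lam := (@lebesgue_measure R).
Variables (g phi : R -> R).
Hypothesis mg : measurable_fun setT g.
Hypothesis phi_ge0 : forall u, 0 <= phi u.
Hypothesis iphi : lam.-integrable setT (EFin \o phi).

Definition tail M (u : R) : R := if `|g u| <= M then 0 else `|g u|.

Let body M (u : R) : R := if `|g u| <= M then g u else 0.

Let mphi : measurable_fun setT phi.
Proof. by apply/measurable_EFinP; exact: measurable_int iphi. Qed.

Let mabs : measurable_fun setT (fun u => `|g u|).
Proof. by apply: (measurableT_comp (@normr_measurable _ _)). Qed.

Lemma measurable_tail M : measurable_fun setT (tail M).
Proof. by apply: measurable_fun_ifT => //; apply: measurable_fun_ler. Qed.

Let mbody M : measurable_fun setT (body M).
Proof. by apply: measurable_fun_ifT => //; apply: measurable_fun_ler. Qed.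

Lemma tail_ge0 M u : 0 <= tail M u. Proof. by rewrite /tail; case: ifP. Qed.

Let body_tail M u : `|g u - body M u| = tail M u.
Proof. by rewrite /body /tail; case: ifP; rewrite ?subrr ?normr0 ?subr0. Qed.

Let body_le M u : 0 <= M -> `|body M u| <= M.
Proof. by move=> M0; rewrite /body; case: ifP => //; rewrite normr0. Qed.

Let mshift (h : R -> R) (w : R) : measurable_fun setT h -> measurable_fun setT (fun u : R => h (u - w)).
Proof. by move=> mh; apply: (measurableT_comp mh); exact: measurable_funB. Qed.

Hypothesis tail_small : forall e : R, 0 < e -> exists M : R, 0 <= M /\
  forall w, (\int[lam]_u (tail M (u - w) * phi u)%:E <= e%:E)%E.

Lemma pairing_bounded : exists B : R, 0 <= B /\
  forall w, (\int[lam]_u `|g (u - w) * phi u|%:E <= B%:E)%E.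
Proof.
have [M [M0 tM]] := tail_small ltr01.
have iphi_lty : (\int[lam]_u (phi u)%:E < +oo)%E.
  move/integrableP : iphi => [_]; congr (_ < _)%E; apply: eq_integral => u _ /=.
  by rewrite ger0_norm.
have iphi0 : (0 <= \int[lam]_u (phi u)%:E)%E by apply: integral_ge0 => u _; rewrite lee_fin.
exists (M * fine (\int[lam]_u (phi u)%:E)%E + 1); split.
  by rewrite addr_ge0// mulr_ge0// fine_ge0.
move=> w; rewrite EFinD EFinM fineK ?ge0_fin_numE//.
rewrite -ge0_integralZl//; last 2 first.
- by apply/measurable_EFinP.
- by move=> u _; rewrite lee_fin.
apply: (@le_trans _ _ (\int[lam]_u (M%:E * (phi u)%:E) + \int[lam]_u (tail M (u - w) * phi u)%:E)%E);
  last by rewrite leeD2l.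
rewrite -ge0_integralD//; first last.
- by apply/measurable_EFinP; apply: measurable_funM => //; apply: mshift; exact: measurable_tail.
- by move=> u _; rewrite lee_fin mulr_ge0// tail_ge0.
- by apply: emeasurable_funM => //; exact/measurable_EFinP.
- by move=> u _; rewrite mule_ge0 ?lee_fin.
apply: ge0_le_integral => //.
- apply/measurable_EFinP; apply: (measurableT_comp (@normr_measurable _ _)).
  by apply: measurable_funM => //; exact: mshift.
- apply: emeasurable_funD; first by apply: emeasurable_funM => //; exact/measurable_EFinP.
  by apply/measurable_EFinP; apply: measurable_funM => //; apply: mshift; exact: measurable_tail.
move=> u _; rewrite -EFinM -EFinD lee_fin -mulrDl normrM (ger0_norm (phi_ge0 u)).
by rewrite ler_wpM2r// /tail; case: ifP => [gM|_]; rewrite ?addr0// lerDr.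
Qed.

Lemma pairing_integrable w : lam.-integrable setT (fun u => (g (u - w) * phi u)%:E).
Proof.
have [B [_ gB]] := pairing_bounded.
apply/integrableP; split.
  by apply/measurable_EFinP; apply: measurable_funM => //; exact: mshift.
apply: le_lt_trans (gB w) (ltry _).
Qed.

Definition pairing w : R := \int[lam]_u (g (u - w) * phi u).

Let int_body M w : 0 <= M -> lam.-integrable setT (fun u => (body M (u - w) * phi u)%:E).
Proof.
move=> M0; apply: (@le_integrable _ _ _ lam _ _ _ (fun u => (M * phi u)%:E)) => //.
- apply/measurable_EFinP; apply: measurable_funM => //; exact: mshift.
- move=> u _; rewrite lee_fin normrM (ger0_norm (phi_ge0 u)) [leRHS]ger0_norm ?mulr_ge0//.
  by rewrite ler_wpM2r// body_le.
- by under eq_fun do rewrite EFinM; exact: integrableZl.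
Qed.

Let pairing_tail M w e : 0 <= M -> (\int[lam]_u (tail M (u - w) * phi u)%:E <= e%:E)%E ->
  `|pairing w - \int[lam]_u (body M (u - w) * phi u)| <= e.
Proof.
move=> M0 te; rewrite /pairing -RintegralB//; [|exact: pairing_integrable|exact: int_body].
have ib : lam.-integrable setT (EFin \o (fun u => g (u - w) * phi u - body M (u - w) * phi u)).
  rewrite (_ : EFin \o _ = (fun u => (g (u - w) * phi u)%:E) \- (fun u => (body M (u - w) * phi u)%:E))%E//.
  by apply: integrableB => //; [exact: pairing_integrable|exact: int_body].
apply: (le_trans (le_normr_Rintegral _ ib)) => //.
rewrite /Rintegral -lee_fin fineK.
  apply: le_trans te; rewrite le_eqVlt; apply/orP; left; apply/eqP.
  by apply: eq_integral => u _; rewrite -mulrBl normrM body_tail (ger0_norm (phi_ge0 u)).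
by apply: integrable_fin_num => //; exact: (integrable_norm ib).
Qed.

Lemma pairing_cvg (w : nat -> R) : w m @[m --> \oo] --> 0 -> pairing (w m) @[m --> \oo] --> pairing 0.
Proof.
move=> w0; apply/cvgrPdist_le => e e0.
have e4 : 0 < e / 4 by rewrite divr_gt0.
have [M [M0 tM]] := tail_small e4.
have M1 : 0 < M + 1 by rewrite ltr_wpDl.
have /cvge0_lt := cvg_integral_translation iphi w0.
have e4M : 0 < e / 4 / (M + 1) by rewrite divr_gt0.
move=> /(_ _ e4M); apply: filterS => m Hm.
have h0 := pairing_tail M0 (tM 0); have h1 := pairing_tail M0 (tM (w m)).
set b0 := \int[lam]_u _ in h0; set b1 := \int[lam]_u _ in h1.
suff : `|b1 - b0| <= e / 4.
  by move: h0 h1; rewrite !ler_norml => /andP[? ?] /andP[? ?] /andP[? ?]; apply/andP; split; lra.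
(* A substitution moves the translation from [body M], which has no continuity, to the integrable
   [phi]. *)
have b1E : b1 = \int[lam]_u (body M u * phi (u + w m)).
  rewrite /b1 (@Rintegral_affine _ (fun u => body M (u - w m) * phi u) 1 (w m)) ?oner_neq0//; last exact: int_body.
  by rewrite normr1 mul1r; apply: eq_Rintegral => u _; rewrite mul1r addrK.
have b0E : b0 = \int[lam]_u (body M u * phi u).
  by apply: eq_Rintegral => u _; rewrite subr0.
have ib0 : lam.-integrable setT (fun u => (body M u * phi u)%:E).
  by have := int_body 0 M0; congr (lam.-integrable _ _); apply/funext => u; rewrite subr0.
have ib1 : lam.-integrable setT (fun u => (body M u * phi (u + w m))%:E).
  have := @integrable_affine _ (fun u => body M (u - w m) * phi u) 1 (w m) (oner_neq0 _) (int_body _ M0).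
  by congr (lam.-integrable _ _); apply/funext => u; rewrite mul1r addrK.
rewrite b1E b0E -RintegralB//.
have ib : lam.-integrable setT (EFin \o (fun u => body M u * phi (u + w m) - body M u * phi u)).
  rewrite (_ : EFin \o _ = (fun u => (body M u * phi (u + w m))%:E) \- (fun u => (body M u * phi u)%:E))%E//.
  exact: integrableB.
apply: (le_trans (le_normr_Rintegral _ ib)) => //.
rewrite /Rintegral -lee_fin fineK; last by apply: integrable_fin_num => //; exact: (integrable_norm ib).
have mdiff : measurable_fun setT (fun u : R => phi (u + w m) - phi u).
  by apply: measurable_funB => //; apply: (measurableT_comp mphi); exact: measurable_funD.
have mad : measurable_fun setT (fun u : R => `|phi (u + w m) - phi u|).
  by apply: (measurableT_comp (@normr_measurable _ _)).
apply: (@le_trans _ _ (\int[lam]_u ((M + 1)%:E * `|phi (u + w m)%R - phi u|%:E))%E).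
  apply: ge0_le_integral => //.
  - apply/measurable_EFinP; apply: (measurableT_comp (@normr_measurable _ _)).
    by apply/measurable_EFinP; exact: measurable_int ib.
  - by apply: emeasurable_funM => //; exact/measurable_EFinP.
  - move=> u _; rewrite -EFinM lee_fin -mulrBr normrM ler_wpM2r// (le_trans (body_le _ M0))//.
    by rewrite lerDl.
rewrite ge0_integralZl//; [|exact/measurable_EFinP|by rewrite lee_fin ltW].
rewrite (_ : (e / 4)%:E = ((M + 1)%:E * (e / 4 / (M + 1))%:E)%E); last first.
  by rewrite -EFinM; congr EFin; rewrite [RHS]mulrC divfK// gt_eqF.
by rewrite lee_pmul2l// ltW.
Qed.

End translated_pairing.

Section tail_of_Lq.
Context {R : realType}.
Local Notation lam := (@lebesgue_measure R).
Variables (p q : \bar R) (g : R -> R) (K : R -> \bar R).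
Hypothesis p_ge1 : (1 <= p)%E.
Hypothesis q_ge1 : (1 <= q)%E.
Hypothesis pq : (p^-1 + q^-1 <= 1)%E.
Hypothesis gq : g \in Lfun lam q.
Hypothesis mK : measurable_fun setT K.
Hypothesis K_ge0 : forall u, (0 <= K u)%E.
Hypothesis Kp : (Lnorm lam p K < +oo)%E.

Let mg := Lfun_measurable gq.

Let phi u := fine (K u).

Let phi_ge0 u : 0 <= phi u. Proof. by rewrite /phi fine_ge0. Qed.

Let mphi : measurable_fun setT phi. Proof. exact: measurableT_comp. Qed.

(** The scaled Young inequality with [e / 2] fixes [A] and [psi] before the level [M] and the
    translation [w]. The remaining term is the integral of the tail to the power [q'], which does
    not depend on [w] and vanishes as the level grows, by dominated convergence. *)
Lemma tail_Lq_small (e : R) : 0 < e -> exists M : R, 0 <= M /\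
  forall w, (\int[lam]_u (tail g M (u - w) * fine (K u))%:E <= e%:E)%E.
Proof.
move=> e0; have FF := ae_filter_ringOfSetsType lam.
have mshift (h : R -> R) (w : R) : measurable_fun setT h -> measurable_fun setT (fun u : R => h (u - w)).
  by move=> mh; apply: (measurableT_comp mh); exact: measurable_funB.
have mt M := measurable_tail mg M.
have t0 M u := tail_ge0 g M u.
have sm M w : measurable_fun setT (fun u : R => (tail g M (u - w) * phi u)%:E).
  by apply/measurable_EFinP; apply: measurable_funM => //; exact: mshift.
have mabs : measurable_fun setT (fun u => `|g u|).
  by apply: (measurableT_comp (@normr_measurable _ _)).
case: q q_ge1 pq gq => [q'| |//]; last first.
  move=> _ _ /Lfun_finite_norm/Lnorm_ae_bounded[C [C0 gC]]; exists C; split => // w.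
  (* Beyond an essential bound the tail is null; translation invariance of its integral passes this
     on to all translates. *)
  have z : (\int[lam]_u `|(tail g C (u - w))%:E| = 0)%E.
    transitivity (\int[lam]_u (tail g C u)%:E)%E.
      rewrite -[RHS](@ge0_integral_shift _ (fun u => (tail g C u)%:E) (- w))//.
      + by apply: eq_integral => u _; rewrite gee0_abs// lee_fin.
      + exact/measurable_EFinP.
      + by move=> u; rewrite lee_fin.
    transitivity (\int[lam]_(u in [set: R]) (cst 0%E u : \bar R))%E; last exact: integral0.
    apply: ae_eq_integral => //; first by apply/measurable_EFinP; exact: (mt C).
    by apply: filterS gC => u /=; rewrite lee_fin /tail => -> _.
  have ms : measurable_fun setT (fun u : R => (tail g C (u - w))%:E).
    by apply/measurable_EFinP; exact: mshift.
  have /(ae_eq_integral_abs lam measurableT ms) zae := z.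
  rewrite (_ : (\int[lam]_u _)%E = 0%E) ?lee_fin ?ltW//.
  transitivity (\int[lam]_(u in [set: R]) (cst 0%E u : \bar R))%E; last exact: integral0.
  apply: ae_eq_integral => //; first exact: sm.
  by apply: filterS zae => u /= zu _; move: (zu I) => [->]; rewrite mul0r.
rewrite lee_fin => q1 pq' gq'; have q0 : 0 < q' by exact: lt_le_trans q1.
have e2 : 0 < e / 2 by rewrite divr_gt0.
have [A [psi [A0 mpsi psi0 ipsi young]]] := Lnorm_young mK K_ge0 p_ge1 q1 pq' Kp e2.
have Ig := Lfun_powR_lty q0 gq'.
have mpow (h : R -> R) : measurable_fun setT h -> measurable_fun setT (fun u => h u `^ q').
  by move=> mh; apply: (measurableT_comp (measurable_powR q')).
have tpow M u : tail g M u `^ q' <= `|g u| `^ q'.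
  by rewrite ge0_ler_powR ?nnegrE ?(ltW q0)// /tail; case: ifP.
have igq : lam.-integrable setT (EFin \o (fun u => `|g u| `^ q')).
  apply/integrableP; split; first by apply/measurable_EFinP; exact: mpow.
  by under eq_integral do rewrite gee0_abs ?lee_fin ?powR_ge0//.
have cvgt : \int[lam]_u (tail g n%:R u `^ q') @[n --> \oo] --> \int[lam]_(u in [set: R]) (0 : R).
  apply: Rintegral_dominated_cvg igq _ => [n|u|n u].
  - by apply: mpow; exact: mt.
  - apply: cvg_near_cst; near=> n; rewrite /tail ifT ?powR0 ?gt_eqF//.
    by near: n; exact: nbhs_infty_ger.
  - by rewrite ger0_norm ?powR_ge0.
have z0 : \int[lam]_(u in [set: R]) (0 : R) = 0 by rewrite /Rintegral integral0.
rewrite z0 in cvgt.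
have A1 : 0 < A + 1 by rewrite ltr_wpDl.
have e2A : 0 < e / 2 / (A + 1) by rewrite divr_gt0.
move/cvgrPdist_lt: cvgt => /(_ _ e2A)[n0 _ Hn].
(* The maximum with 1 ensures that the tail exceeds 1 wherever it is nonzero, as the scaled Young
   inequality asks of [s]. *)
pose M : R := (maxn n0 1)%:R.
have M1 : 1 <= M by rewrite /M ler1n leq_max orbT.
exists M; split; first exact: le_trans M1.
move=> w; have {}Hn : (\int[lam]_u (tail g M u `^ q')%:E < (e / 2 / (A + 1))%:E)%E.
  have tf : (\int[lam]_u (tail g M u `^ q')%:E)%E \is a fin_num.
    rewrite ge0_fin_numE; last by apply: integral_ge0 => u _; rewrite lee_fin powR_ge0.
    apply: le_lt_trans Ig; apply: ge0_le_integral => //.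
    - by move=> u _; rewrite lee_fin powR_ge0.
    - by apply/measurable_EFinP; apply: mpow; exact: mt.
    - by apply/measurable_EFinP; exact: mpow.
    - by move=> u _; rewrite lee_fin.
  have H : `|0 - \int[lam]_u (tail g M u `^ q')| < e / 2 / (A + 1).
    by apply: Hn; rewrite /= leq_maxl.
  rewrite -(fineK tf) lte_fin; apply: le_lt_trans H.
  by rewrite sub0r normrN; exact: ler_norm.
apply: (@le_trans _ _ (\int[lam]_u ((A + 1)%:E * (tail g M (u - w) `^ q')%:E + (psi u)%:E))%E).
  apply: ae_ge0_le_integral => //.
  - by move=> u _; rewrite lee_fin mulr_ge0//; exact: phi_ge0.
  - exact: sm.
  - by move=> u _; rewrite -EFinM -EFinD lee_fin addr_ge0// mulr_ge0 ?powR_ge0// ltW.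
  - apply: emeasurable_funD; last exact/measurable_EFinP.
    by apply: emeasurable_funM => //; apply/measurable_EFinP; apply: mpow; exact: mshift.
  apply: filterS young => u yu _; rewrite -EFinM -EFinD lee_fin.
  rewrite {1}/tail; case: ifPn => [_|]; first by rewrite mul0r addr_ge0// mulr_ge0 ?powR_ge0// ltW.
  rewrite /tail => gM; rewrite (negbTE gM); move: gM; rewrite -ltNge => gM.
  apply: (le_trans (yu _ _)); first by rewrite (le_trans M1)// ltW.
  by rewrite lerD2r ler_wpM2r ?powR_ge0// lerDl.
rewrite ge0_integralD//; [|by move=> u _; rewrite -EFinM lee_fin mulr_ge0 ?powR_ge0// ltW
  |by apply: emeasurable_funM => //; apply/measurable_EFinP; apply: mpow; exact: mshift
  |by move=> u _; rewrite lee_fin|exact/measurable_EFinP].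
rewrite ge0_integralZl//; [|by apply/measurable_EFinP; apply: mpow; exact: mshift
  |by move=> u _; rewrite lee_fin powR_ge0|by rewrite lee_fin ltW].
rewrite (@ge0_integral_shift _ (fun u => (tail g M u `^ q')%:E) (- w)); first last.
- by move=> u; rewrite lee_fin powR_ge0.
- by apply/measurable_EFinP; exact: mpow.
rewrite (_ : e%:E = ((e / 2)%:E + (e / 2)%:E)%E); last by rewrite -EFinD -splitr.
apply: leeD => //.
rewrite (_ : (e / 2)%:E = ((A + 1)%:E * (e / 2 / (A + 1))%:E)%E); last first.
  by rewrite -EFinM; congr EFin; rewrite [RHS]mulrC divfK// gt_eqF.
by rewrite lee_pmul2l// ltW.
Unshelve. all: by end_near. Qed.

End tail_of_Lq.

(** * Mollification *)

(* No integrability is assumed: an infinite integral has a junk value on both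
   sides. *)
Lemma Rintegral_posZr (R : realType) (f : R -> R) (c : R) : measurable_fun setT f -> 0 < c ->
  \int[@lebesgue_measure R]_u (f u * c) = (\int[@lebesgue_measure R]_u f u) * c.
Proof.
move=> mf c0; rewrite /Rintegral [in LHS]integralE [in RHS]integralE.
have mEf : measurable_fun setT (EFin \o f) by exact/measurable_EFinP.
have Ep : (\int[@lebesgue_measure R]_u ((fun u => (f u * c)%:E)^\+ u) =
    c%:E * \int[@lebesgue_measure R]_u ((EFin \o f)^\+ u))%E.
  rewrite -ge0_integralZl//; [|exact: measurable_funepos|by rewrite lee_fin ltW].
  apply: eq_integral => u _; rewrite !funeposE -!EFin_max -EFinM maxr_pMr ?(ltW c0)//.
  by rewrite mulr0 mulrC.
have En : (\int[@lebesgue_measure R]_u ((fun u => (f u * c)%:E)^\- u) =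
    c%:E * \int[@lebesgue_measure R]_u ((EFin \o f)^\- u))%E.
  rewrite -ge0_integralZl//; [|exact: measurable_funeneg|by rewrite lee_fin ltW].
  apply: eq_integral => u _; rewrite !funenegE -!EFinN -!EFin_max -EFinM maxr_pMr ?(ltW c0)//.
  by rewrite mulr0 mulrN mulrC.
rewrite Ep En.
have : (0 <= \int[@lebesgue_measure R]_u ((EFin \o f)^\- u))%E by apply: integral_ge0.
have : (0 <= \int[@lebesgue_measure R]_u ((EFin \o f)^\+ u))%E by apply: integral_ge0.
case: (integral _ _ _) => [a| |]//; case: (integral _ _ _) => [b| |]// _ _;
  rewrite ?gt0_muley ?lte_fin//= ?mul0r//.
by rewrite -mulrBr mulrC.
Qed.

Section translated_fubini.
Context {R : realType}.
Local Notation lam := (@lebesgue_measure R).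
Variables (k h phi : R -> R) (B : R).
Hypothesis ik : lam.-integrable setT (EFin \o k).
Hypothesis mh : measurable_fun setT h.
Hypothesis mphi : measurable_fun setT phi.
Hypothesis phi_ge0 : forall u, 0 <= phi u.
Hypothesis bound : forall w, (\int[lam]_u `|h (u - w) * phi u|%:E <= B%:E)%E.

Let F (z : R * R) : R := k z.2 * (h (z.1 - z.2) * phi z.1).

Let mk : measurable_fun setT k.
Proof. by apply/measurable_EFinP; exact: measurable_int ik. Qed.

Let mF : measurable_fun setT F.
Proof.
apply: measurable_funM; first exact: (measurableT_comp mk measurable_snd).
apply: measurable_funM; last exact: (measurableT_comp mphi measurable_fst).
apply: (measurableT_comp mh); apply: measurable_funB; [exact: measurable_fst|exact: measurable_snd].
Qed.

Lemma translated_product_integrable : (lam \x lam)%E.-integrable setT (EFin \o F).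
Proof.
apply/integrable21ltyP; first exact/measurable_EFinP.
have mu' w : measurable_fun setT (fun u : R => `|h (u - w) * phi u|%:E).
  apply/measurable_EFinP; apply: (measurableT_comp (@normr_measurable _ _)).
  by apply: measurable_funM => //; apply: (measurableT_comp mh); exact: measurable_funB.
have E w : (\int[lam]_u `|(EFin \o F) (u, w)| = `|k w|%:E * \int[lam]_u `|h (u - w) * phi u|%:E)%E.
  rewrite -ge0_integralZl//; last exact: (mu' w).
  by apply: eq_integral => u _; rewrite /F/= normrM EFinM.
under eq_integral do rewrite E.
have B0 : 0 <= B.
  by rewrite -lee_fin; apply: le_trans (bound 0); apply: integral_ge0 => u _; rewrite lee_fin.
have mak : measurable_fun setT (fun w => `|k w|).
  by apply: (measurableT_comp (@normr_measurable _ _)).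
apply: (@le_lt_trans _ _ (\int[lam]_w (B%:E * `|k w|%:E))%E).
  apply: ge0_le_integral => //.
  - by move=> w _; rewrite mule_ge0 ?lee_fin// integral_ge0// => u _; rewrite lee_fin.
  - under eq_fun do rewrite -E.
    apply: (@measurable_fun_fubini_tonelli_G _ _ _ _ _ lam (abse \o (EFin \o F))) => //.
    by apply: measurableT_comp => //; exact/measurable_EFinP.
    by move=> z; exact: abse_ge0.
  - by apply: emeasurable_funM => //; exact/measurable_EFinP.
  - by move=> w _; rewrite muleC lee_pmul ?lee_fin// integral_ge0// => u _; rewrite lee_fin.
rewrite ge0_integralZl//; last first.
  exact/measurable_EFinP.
by rewrite lte_mul_pinfty//; move/integrableP: ik => [].
Qed.

(** For a single [u] the inner integral may diverge. A positive [phi u] can still be taken out by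
    [Rintegral_posZr], and for [phi u = 0] both sides vanish. *)
Let section_integral u :
  \int[lam]_w F (u, w) = (\int[lam]_w (k w * h (u - w))) * phi u.
Proof.
have [phi0|phi0] := eqVneq (phi u) 0.
  rewrite phi0 mulr0 /Rintegral integral0_eq// => w _.
  by rewrite /F/= phi0 !mulr0.
rewrite -Rintegral_posZr ?lt0r ?phi0 ?phi_ge0//; last first.
  apply: measurable_funM => //; apply: (measurableT_comp mh); exact: measurable_funB.
by apply: eq_Rintegral => w _; rewrite /F/= mulrA.
Qed.

Lemma translated_integrable :
  lam.-integrable setT (fun u => (\int[lam]_w (k w * h (u - w)) * phi u)%:E).
Proof.
have iG := integrable_fubini_F translated_product_integrable.
have mG := measurable_int _ iG.
apply: (le_integrable measurableT _ _ iG).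
  under eq_fun do rewrite -section_integral.
  by apply/measurable_EFinP; apply: (measurableT_comp (fine_measurable measurableT) mG).
move=> u _; rewrite -section_integral /Rintegral /fubini_F.
by case: (integral _ _ _) => [r| |] //=; rewrite ?normr0 ?leey ?lee_fin.
Qed.

Lemma translated_fubini :
  \int[lam]_w (k w * \int[lam]_u (h (u - w) * phi u)) =
  \int[lam]_u (\int[lam]_w (k w * h (u - w)) * phi u).
Proof.
have ih w : lam.-integrable setT (fun u : R => (h (u - w) * phi u)%:E).
  apply/integrableP; split; last exact: le_lt_trans (bound w) (ltry _).
  apply/measurable_EFinP; apply: measurable_funM => //.
  by apply: (measurableT_comp mh); exact: measurable_funB.
transitivity (\int[lam]_w \int[lam]_u F (u, w)).
  by apply: eq_Rintegral => w _; rewrite -(RintegralZl _ measurableT (ih w)).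
rewrite -(Rintegral_fubini translated_product_integrable); apply: eq_Rintegral => u _.
exact: section_integral.
Qed.

End translated_fubini.

Section smoothing.
Context {R : realType}.
Local Notation lam := (@lebesgue_measure R).
Variables (k f f1 f2 : R -> R) (C : R).
Hypothesis ck : continuous k.
Hypothesis k_ge0 : forall u, 0 <= k u.
Hypothesis ik : lam.-integrable setT (EFin \o k).
Hypothesis df : forall u : R, is_derive u 1 f (f1 u).
Hypothesis cf1 : continuous f1.
Hypothesis f1_increment : forall a b, a <= b -> f1 b - f1 a = \int[lam]_(r in `[a, b]) f2 r.
Hypothesis f_bound : forall u, `|f u| <= C.
Hypothesis f1_bound : forall u, `|f1 u| <= C.
Hypothesis mf2 : measurable_fun setT f2.
Hypothesis f2_bound : forall a b, a <= b ->
  (\int[lam]_(u in `[a, b]) `|f2 u|%:E <= (C * (b - a) + C)%:E)%E.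

(** The convolution with the translation placed on [g], so that derivatives fall on the function and
    not on the kernel [k]. *)
Definition smoothed (g : R -> R) u : R := \int[lam]_w (k w * g (u - w)).

Let C_ge0 : 0 <= C. Proof. exact: le_trans (f_bound 0). Qed.

Let mk : measurable_fun setT k. Proof. exact: continuous_measurable_fun. Qed.

Let cf : continuous f. Proof. exact: is_derive_continuous df. Qed.

Let mshift (g : R -> R) (u : R) : continuous g -> measurable_fun setT (fun w : R => g (u - w)).
Proof.
move=> cg; apply: (measurableT_comp (continuous_measurable_fun cg)).
exact: measurable_funB.
Qed.

Lemma integrable_mul_bounded (g : R -> R) u : continuous g -> (forall u, `|g u| <= C) ->
  lam.-integrable setT (fun w => (k w * g (u - w))%:E).
Proof.
move=> cg gC; apply: (@le_integrable _ _ _ lam _ _ _ (fun w => (C * k w)%:E)) => //.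
- by apply/measurable_EFinP; apply: measurable_funM => //; exact: mshift.
- move=> w _; rewrite lee_fin normrM [leRHS]ger0_norm ?mulr_ge0// (ger0_norm (k_ge0 w)).
  by rewrite mulrC ler_wpM2r.
- by under eq_fun do rewrite EFinM; exact: integrableZl.
Qed.

Lemma convolutionE u : convolution k f u = smoothed f u.
Proof.
have N1 : (-1 : R) != 0 by rewrite oppr_eq0 oner_eq0.
have i0 := integrable_mul_bounded u cf f_bound.
have i1 : lam.-integrable setT (EFin \o (fun v => k (u - v) * f v)).
  have := @integrable_affine _ (fun w => k w * f (u - w)) _ u N1 i0.
  congr (lam.-integrable _ _); apply/funext => v /=.
  by rewrite mulN1r addrC opprB addrCA subrr addr0.
rewrite /convolution (Rintegral_affine u N1 i1) normrN1 mul1r.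
by apply: eq_Rintegral => w _; rewrite mulN1r [- w + u]addrC opprB addrCA subrr addr0.
Qed.

Lemma smoothed_is_derive (u : R) : is_derive u 1 (smoothed f) (smoothed f1 u).
Proof.
pose G (v w : R) : R := k w * f (v - w).
have dG (v w : R) : is_derive v 1 (G ^~ w) (k w * f1 (v - w)).
  have D : is_derive v 1 (fun r => f (1 * (r - w))) (1 * f1 (v - w)).
    by apply: is_derive_affine; rewrite mul1r; exact: df.
  have D' : is_derive v 1 (fun r => f (r - w)) (f1 (v - w)).
    by move: D; rewrite mul1r; under eq_fun do rewrite mul1r.
  have := is_deriveZ (k w) D'; exact.
have dGE v w : (G ^~ w)^`()%classic v = k w * f1 (v - w).
  by rewrite derive1E (@derive_val _ _ _ _ _ _ _ (dG v w)).
pose I : set R := `]u - 1, u + 1[%classic.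
have Iu : I u by rewrite /I/= in_itv/= ltrBlDr !ltrDl ltr01.
have iG v : I v -> lam.-integrable setT (EFin \o G v).
  by move=> _; exact: integrable_mul_bounded.
have derG v w : I v -> setT w -> derivable (G ^~ w) v 1.
  by move=> _ _; have [] := dG v w.
have iM : lam.-integrable setT (EFin \o (fun w => C * k w)).
  rewrite (_ : EFin \o _ = (fun w => C%:E * (EFin \o k) w)%E)//; exact: integrableZl.
have M0 w : 0 <= C * k w by rewrite mulr_ge0.
have GM v w : I v -> setT w -> `|partial1of2 G v w| <= C * k w.
  move=> _ _; rewrite /partial1of2 dGE normrM (ger0_norm (k_ge0 w)) mulrC.
  by rewrite ler_wpM2r.
have D := @derivable_under_integral _ _ _ lam G setT measurableT u _ _ Iu iG derG _ M0 iM GM.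
have V := @differentiation_under_integral _ _ _ lam G setT measurableT u _ _ Iu iG derG _ M0 iM GM.
apply: DeriveDef => //; rewrite -derive1E [LHS]V.
by apply: eq_Rintegral => w _; rewrite /partial1of2 dGE.
Qed.

Let shift_bound a b : a <= b -> forall w,
  (\int[lam]_u `|f2 (u - w) * \1_(`[a, b]) u|%:E <= (C * (b - a) + C)%:E)%E.
Proof.
move=> ab w; have ab' : a - w <= b - w by rewrite lerB.
have mF : measurable_fun setT (fun u => `|f2 u * \1_(`[a - w, b - w]) u|%:E).
  apply/measurable_EFinP; apply: (measurableT_comp (@normr_measurable _ _)).
  by apply: measurable_funM => //; exact: measurable_indic.
have E : (\int[lam]_u `|f2 (u - w) * \1_(`[a, b]) u|%:E =
    \int[lam]_u `|f2 u * \1_(`[(a - w)%R, (b - w)%R]) u|%:E)%E.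
  rewrite -[RHS](@ge0_integral_shift _ _ (- w) mF); last by move=> u; rewrite lee_fin.
  by apply: eq_integral => u _; rewrite !indic_itvE !in_itv/= !lerD2r.
rewrite E (_ : C * (b - a) + C = C * ((b - w) - (a - w)) + C); last by ring.
apply: le_trans (f2_bound ab'); rewrite [leRHS]integral_mkcond le_eqVlt; apply/orP; left; apply/eqP.
apply: eq_integral => u _; rewrite patchE indicE; case: ifP => _.
  by rewrite mulr1.
by rewrite mulr0 normr0.
Qed.

Let indic_ge0 a b (u : R) : 0 <= \1_(`[a, b]) u :> R.
Proof. by rewrite indicE. Qed.

Lemma smoothed_integrable a b : a <= b -> lam.-integrable `[a, b] (EFin \o smoothed f2).
Proof.
move=> ab; have mI : measurable_fun setT (\1_(`[a, b] : set R) : R -> R) by exact: measurable_indic.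
have := translated_integrable ik mf2 mI (indic_ge0 a b) (shift_bound ab).
rewrite (_ : (fun u => _) = ((EFin \o smoothed f2) \_ `[a, b])).
  by move=> H; apply: (@integrable_mkcond _ _ _ lam _ _ _).2.
apply/funext => u; rewrite patchE indicE; case: ifP => _; first by rewrite mulr1.
by rewrite mulr0.
Qed.

Lemma smoothed_increment a b : a <= b ->
  smoothed f1 b - smoothed f1 a = \int[lam]_(r in `[a, b]) smoothed f2 r.
Proof.
move=> ab; have mI : measurable_fun setT (\1_(`[a, b] : set R) : R -> R) by exact: measurable_indic.
have := translated_fubini ik mf2 mI (indic_ge0 a b) (shift_bound ab).
have i1 u := integrable_mul_bounded u cf1 f1_bound.
rewrite /smoothed -RintegralB//; [|exact: (i1 b)|exact: (i1 a)].
rewrite (_ : \int[lam]_w (k w * \int[lam]_u (f2 (u - w) * \1_(`[a, b]) u)) =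
    \int[lam]_w (k w * f1 (b - w) - k w * f1 (a - w))); last first.
  apply: eq_Rintegral => w _; rewrite -mulrBr f1_increment ?lerB//; congr (_ * _).
  rewrite [RHS]Rintegral_mkcond.
  have ig : lam.-integrable setT (EFin \o (fun u => f2 (u - w) * \1_(`[a, b]) u)).
    apply/integrableP; split; last exact: le_lt_trans (shift_bound ab w) (ltry _).
    apply/measurable_EFinP; apply: measurable_funM => //; apply: (measurableT_comp mf2).
    exact: measurable_funB.
  rewrite (Rintegral_affine w (oner_neq0 R) ig) normr1 mul1r.
  apply: eq_Rintegral => u _; rewrite mul1r addrK patchE indic_itvE mem_setE !in_itv/=.
  by rewrite lerBlDr lerBrDr; case: ifP => _; rewrite ?mulr1 ?mulr0.
move=> ->; rewrite [RHS]Rintegral_mkcond; apply: eq_Rintegral => u _.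
by rewrite patchE indicE; case: ifP => _; rewrite ?mulr1 ?mulr0.
Qed.

Let is_derive_of_integral (c u : R) : c < u ->
  let F (y : R) := \int[lam]_(r in `[c, y]) smoothed f2 r in
  derivable F u 1 /\ F^`()%classic u = smoothed f2 u ->
  is_derive u 1 (smoothed f1) (smoothed f2 u).
Proof.
move=> cu F [dF FE].
have D : is_derive u 1 (fun y => F y + smoothed f1 c) (smoothed f2 u).
  have D0 : is_derive u 1 F (smoothed f2 u).
    by apply: DeriveDef; [exact: dF|rewrite -derive1E; exact: FE].
  have := is_deriveD D0 (is_derive_cst (smoothed f1 c) u (1 : R)).
  by rewrite addr0.
apply: near_eq_is_derive D; near=> y.
rewrite /F -smoothed_increment ?subrK//.
by apply/ltW; near: y; exact: lt_nbhsr.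
Unshelve. all: by end_near. Qed.

Let smoothed_integrable_itv a b : lam.-integrable `[a, b] (EFin \o smoothed f2).
Proof.
have [ab|ba] := leP a b; first exact: smoothed_integrable.
by rewrite set_itv_ge ?bnd_simp -?ltNge//; exact: integrable_set0.
Qed.

Lemma measurable_smoothed : measurable_fun setT (smoothed f2).
Proof.
have E : setT = \bigcup_(n : nat) (`[- n%:R, n%:R]%classic : set R).
  apply/seteqP; split => // u _; exists (Num.truncn `|u|).+1 => //=.
  by rewrite in_itv/= -ler_norml ltW// truncnS_gt.
rewrite E; apply/measurable_fun_bigcup => [n|n]; first exact: measurable_itv.
by apply/measurable_EFinP; exact: measurable_int (smoothed_integrable_itv _ _).
Qed.

(** The smoothing of [f2] is locally integrable and its integral gives the increments of the
    smoothing of [f1], so Lebesgue differentiation identifies the derivative almost everywhere. That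
    is enough under an integral, and it covers kernels without compact support. *)
Lemma smoothed_derive2_ae :
  {ae lam, forall u, derive1n 2 (smoothed f) u = smoothed f2 u}.
Proof.
have FF := ae_filter_ringOfSetsType lam.
have loc : locally_integrable [set: R] (smoothed f2).
  split; [exact: measurable_smoothed|exact: openT|move=> K _ cK].
  have [M [Mr KM]] := compact_bounded cK.
  have {}KM u : K u -> `|u| <= M + 1 by apply: KM; rewrite ltrDl.
  have := smoothed_integrable_itv (- (M + 1)) (M + 1).
  move=> /integrableP[mI]; apply: le_lt_trans.
  apply: ge0_subset_integral => //.
  - by apply: compact_measurable.
  - apply/measurable_EFinP; apply: (measurableT_comp (@normr_measurable _ _)).
    by apply: measurable_funTS; exact: measurable_smoothed.
  - by move=> u /KM; rewrite /= in_itv/= ler_norml.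
(* The primitive needs a finite starting point; the starting points [- n] together reach every
   [u]. *)
have D (n : nat) : {ae lam, forall u : R, - n%:R < u -> is_derive u 1 (smoothed f1) (smoothed f2 u)}.
  have := @FTC1 _ (smoothed f2) (BLeft (- n%:R)) (fun y => smoothed_integrable_itv _ _) loc.
  apply: filterS => u du nu; apply: (is_derive_of_integral nu).
  by apply: du; rewrite /= lte_fin.
have : {ae lam, forall (u : R) (n : nat), - n%:R < u -> is_derive u 1 (smoothed f1) (smoothed f2 u)}.
  by apply/ae_foralln.
apply: filterS => u du.
have {}du : is_derive u 1 (smoothed f1) (smoothed f2 u).
  apply: (du (Num.truncn `|u|).+1); rewrite ltrNl (le_lt_trans (ler_norm _))// normrN.
  exact: truncnS_gt.
rewrite -[derive1n 2 _]/(derive1 (derive1 (smoothed f))) (derive1_is_derive smoothed_is_derive).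
by rewrite derive1E derive_val.
Qed.

(** With compact support of [k], the translation can be put back on the continuous kernel: the
    smoothing of [f2] becomes a parameter integral continuous in the parameter, and the fundamental
    theorem of calculus then holds at every point. *)
Lemma smoothed_class_C2 s : (forall u, s < `|u| -> k u = 0) -> class_C 2 (smoothed f).
Proof.
move=> kS.
have [B kB] : exists B, forall u, k u <= B.
  have [s0|s0] := ltP s 0.
    exists 0 => u; rewrite kS//; exact: lt_le_trans s0 _.
  have [m _ km] : exists2 m, m \in `[- s, s]%R & forall r, r \in `[- s, s]%R -> k r <= k m.
    by apply: EVT_max; [rewrite -subr_ge0 opprK addr_ge0|exact: continuous_subspaceT].
  exists (k m) => u; have [us|us] := leP `|u| s; last by rewrite kS.
  by apply: km; rewrite in_itv/= -ler_norml.
have B0 : 0 <= B by exact: le_trans (kB 0).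
pose K (u v : R) : R := k (u - v) * f2 v.
have mK u : measurable_fun setT (K u).
  by apply: measurable_funM => //; exact: mshift.
have N1 : (-1 : R) != 0 by rewrite oppr_eq0 oner_eq0.
(* A common dominating function for all [r] within distance 1 of [u]: the kernel vanishes unless [v]
   is within [s] of [r]. *)
pose g (u v : R) : R := B * `|f2 v| * \1_(`[u - 1 - s, u + 1 + s]) v.
have ig u : lam.-integrable setT (EFin \o g u).
  apply/integrableP; split.
    apply/measurable_EFinP; apply: measurable_funM; last exact: measurable_indic.
    by apply: measurable_funM => //; apply: (measurableT_comp (@normr_measurable _ _)).
  have [ss|ss] := leP (u - 1 - s) (u + 1 + s); last first.
    rewrite integral0_eq ?ltry// => v _; rewrite /g/= indic_itvE in_itv/=.
    rewrite (_ : (_ && _) = false) ?mulr0 ?normr0//; apply/negP => /andP[h1 h2].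
    by move: (le_lt_trans (le_trans h1 h2) ss); rewrite ltxx.
  have : (B%:E * \int[lam]_(v in `[(u - 1 - s)%R, (u + 1 + s)%R]) `|f2 v|%:E < +oo)%E.
    rewrite lte_mul_pinfty//; exact: le_lt_trans (f2_bound ss) (ltry _).
  rewrite -ge0_integralZl//; last first.
    apply/measurable_EFinP; apply: measurable_funTS.
    by apply: (measurableT_comp (@normr_measurable _ _)).
  congr (_ < _)%E; rewrite integral_mkcond; apply: eq_integral => v _.
  rewrite patchE /g/= indicE; case: ifP => _.
    by rewrite mulr1 -EFinM normrM normr_id (ger0_norm B0).
  by rewrite mulr0 normr0.
have Kg u r : `|r - u| < 1 -> forall v, `|K r v| <= g u v.
  move=> ru v; rewrite /K /g normrM (ger0_norm (k_ge0 _)) indic_itvE in_itv/=.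
  have [rv|rv] := leP `|r - v| s; last first.
    by rewrite kS// mul0r mulr_ge0// ?mulr_ge0//.
  rewrite (_ : (_ && _) = true) ?mulr1 ?ler_wpM2r//.
  move: ru rv; rewrite ltr_norml ler_norml => /andP[? ?] /andP[? ?].
  by apply/andP; split; lra.
have iK u : lam.-integrable setT (EFin \o K u).
  apply: (le_integrable measurableT _ _ (ig u)).
    by apply/measurable_EFinP; exact: mK.
  move=> v _; rewrite lee_fin [leRHS]ger0_norm; last by rewrite /g mulr_ge0// ?mulr_ge0.
  by apply: Kg; rewrite subrr normr0.
have KE u : smoothed f2 u = \int[lam]_v K u v.
  rewrite (Rintegral_affine u N1 (iK u)) normrN1 mul1r /smoothed.
  by apply: eq_Rintegral => w _; rewrite /K mulN1r [- w + u]addrC opprB addrCA subrr addr0.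
have cont : continuous (smoothed f2).
  move=> u; have E : smoothed f2 = (fun r => \int[lam]_(v in setT) K r v) by apply/funext => r; exact: KE.
  rewrite E.
  apply: (@continuity_under_integral _ _ _ lam K setT measurableT (u - 1) (u + 1) _ _ (g u) (ig u)).
  - by move=> r _; exact: iK.
  - apply: aeW => v _ r _; apply: cvgM; last exact: cvg_cst.
    have cs' : r' - v @[r' --> r] --> r - v by apply: cvgB; [exact: cvg_id|exact: cvg_cst].
    by apply: (@cvg_comp _ _ _ (fun r' : R => r' - v) k _ _ _ cs'); exact: ck.
  - move=> r; rewrite /= in_itv/= => /andP[r1 r2]; apply: aeW => v _; apply: Kg.
    by rewrite ltr_norml; apply/andP; split; lra.
  - by rewrite inE/= in_itv/= ltrBlDr !ltrDl ltr01.
have D (u : R) : is_derive u 1 (smoothed f1) (smoothed f2 u).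
  apply: (@is_derive_of_integral (u - 1) u); first by rewrite ltrBlDr ltrDl.
  apply: (@continuous_FTC1 _ (smoothed f2) (BLeft (u - 1)) u (u + 1)).
  - by rewrite ltrDl.
  - exact: smoothed_integrable_itv.
  - by rewrite /= lte_fin ltrBlDr ltrDl.
  - exact: (@cont u).
have E1 : derive1 (smoothed f) = smoothed f1 := derive1_is_derive smoothed_is_derive.
have E2 : derive1 (smoothed f1) = smoothed f2 := derive1_is_derive D.
split; last by rewrite -[derive1n 2 _]/(derive1 (derive1 (smoothed f))) E1 E2.
move=> [|[|//]] u _.
  by rewrite derive1n0; have [] := smoothed_is_derive u.
by rewrite derive1n1 E1; have [] := D u.
Qed.

End smoothing.

Section mollification_limit.
Context {R : realType}.
Local Notation lam := (@lebesgue_measure R).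

(** On [[u, u + 1]] the value [f u] differs from [f r] by at most [2 * C]; averaging over [r] adds
    the mean of [|f|], again at most [2 * C]. *)
Lemma bounded_of_increment (f f1 : R -> R) (C : R) :
  measurable_fun setT f -> measurable_fun setT f1 ->
  (forall a b, a <= b -> f b - f a = \int[lam]_(r in `[a, b]) f1 r) ->
  (forall a b, a <= b -> (\int[lam]_(r in `[a, b]) `|f r|%:E <= (C * (b - a) + C)%:E)%E) ->
  (forall a b, a <= b -> (\int[lam]_(r in `[a, b]) `|f1 r|%:E <= (C * (b - a) + C)%:E)%E) ->
  forall u, `|f u| <= 4 * C.
Proof.
move=> mf mf1 inc fC f1C u.
have C0 : 0 <= C.
  have := f1C u u (lexx u); rewrite subrr mulr0 add0r -lee_fin; apply: le_trans.
  by apply: integral_ge0 => r _; rewrite lee_fin.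
have u1 : u <= u + 1 by rewrite lerDl.
have osc r : u <= r <= u + 1 -> `|f u| <= `|f r| + 2 * C.
  move=> /andP[ur ru]; have -> : f u = f r - (f r - f u) by rewrite subKr.
  apply: (le_trans (ler_normB _ _)); rewrite lerD2l inc//.
  have mI : measurable_fun (`[u, r] : set R) (EFin \o f1).
    by apply/measurable_EFinP; exact: measurable_funTS.
  have i1 : lam.-integrable `[u, r] (EFin \o f1).
    by apply/integrableP; split => //; exact: le_lt_trans (f1C _ _ ur) (ltry _).
  apply: (le_trans (le_normr_Rintegral _ i1)) => //.
  rewrite /Rintegral -lee_fin fineK; last first.
    by apply: integrable_fin_num => //; exact: (integrable_norm i1).
  apply: (le_trans (f1C _ _ ur)); rewrite lee_fin.
  by have : C * (r - u) <= C * 1 by [rewrite ler_wpM2l//; lra]; lra.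
have len (c : R) : (\int[lam]_(r in `[u, (u + 1)%R]) c%:E = c%:E)%E.
  rewrite integral_cst// -[RHS]mule1; congr (_ * _)%E.
  transitivity (lebesgue_measure (`[u, u + 1]%classic : set R)) => //.
  by rewrite lebesgue_measure_itv/= lte_fin ltrDl ltr01 -EFinB addrC addKr.
rewrite -lee_fin -len.
have ma : measurable_fun (`[u, u + 1] : set R) (fun r => `|f r|%:E).
  apply/measurable_EFinP; apply: measurable_funTS.
  by apply: (measurableT_comp (@normr_measurable _ _)).
apply: (@le_trans _ _ (\int[lam]_(r in `[u, (u + 1)%R]) (`|f r|%:E + (2 * C)%:E))%E).
  by apply: ge0_le_integral => //; exact: emeasurable_funD.
have C20 : (0 <= (2 * C)%:E)%E by rewrite lee_fin mulr_ge0.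
have a0 r : (`[u, u + 1]%classic : set R) r -> (0 <= `|f r|%:E)%E by rewrite lee_fin.
rewrite (ge0_integralD lam (measurable_itv _) a0 ma (fun _ _ => C20) (measurable_cst _)).
rewrite len (_ : 4 * C = C * ((u + 1) - u) + C + 2 * C); last by ring.
by rewrite EFinD leeD// fC.
Qed.

Variables (f f1 f2 phi : R -> R) (C : R).
Hypothesis df : forall u : R, is_derive u 1 f (f1 u).
Hypothesis cf1 : continuous f1.
Hypothesis f1_increment : forall a b, a <= b -> f1 b - f1 a = \int[lam]_(r in `[a, b]) f2 r.
Hypothesis f_bound : forall u, `|f u| <= C.
Hypothesis f1_bound : forall u, `|f1 u| <= C.
Hypothesis mf2 : measurable_fun setT f2.
Hypothesis f2_bound : forall a b, a <= b ->
  (\int[lam]_(u in `[a, b]) `|f2 u|%:E <= (C * (b - a) + C)%:E)%E.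
Hypothesis phi_ge0 : forall u, 0 <= phi u.
Hypothesis iphi : lam.-integrable setT (EFin \o phi).
Hypothesis tail_small : forall e : R, 0 < e -> exists M : R, 0 <= M /\
  forall w, (\int[lam]_u (tail f2 M (u - w) * phi u)%:E <= e%:E)%E.

Let mphi : measurable_fun setT phi.
Proof. by apply/measurable_EFinP; exact: measurable_int iphi. Qed.

Let cf : continuous f. Proof. exact: is_derive_continuous df. Qed.

(** Continuity at [w0] is convergence at 0 for the translate of [f2] by [w0], and [tail_small],
    being uniform in the translation, passes to that translate. *)
Let pairing_continuous : continuous (pairing f2 phi).
Proof.
move=> w0; apply/(@cvg_nbhsP _ R^o) => w ww0.
pose g' (u : R) := f2 (u - w0).
have mg' : measurable_fun setT g'.
  by apply: (measurableT_comp mf2); exact: measurable_funB.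
have E v : pairing f2 phi v = pairing g' phi (v - w0).
  by apply: eq_Rintegral => u _; rewrite /g'; congr (f2 _ * _); ring.
have tail' e : 0 < e -> exists M : R, 0 <= M /\
    forall w, (\int[lam]_u (tail g' M (u - w) * phi u)%:E <= e%:E)%E.
  move=> /tail_small[M [M0 tM]]; exists M; split => // v.
  apply: le_trans (tM (v + w0)); rewrite le_eqVlt; apply/orP; left; apply/eqP.
  by apply: eq_integral => u _; rewrite /tail /g' (_ : u - v - w0 = u - (v + w0)); last by ring.
have w0' : w m - w0 @[m --> \oo] --> 0.
  by rewrite -(subrr w0); apply: cvgB => //; exact: cvg_cst.
have := pairing_cvg mg' phi_ge0 iphi tail' w0'.
rewrite -[X in pairing g' phi X](subrr w0) -E.
by under eq_cvg do rewrite -E.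
Qed.

Variable rho : R -> R.
Hypothesis rho_mollifier : mollifier rho.

Let crho : continuous rho.
Proof. by case: rho_mollifier => /(_ 0%N)[_]. Qed.

Let rho_ge0 u : 0 <= rho u. Proof. by case: rho_mollifier. Qed.

Let irho : lam.-integrable setT (EFin \o rho).
Proof.
case: rho_mollifier => _ _ I1; apply/integrableP; split.
  by apply/measurable_EFinP; exact: continuous_measurable_fun.
under eq_integral do rewrite gee0_abs ?lee_fin//.
by rewrite [X in (X < _)%E]I1 ltry.
Qed.

Let rho1 : \int[lam]_u rho u = 1.
Proof. by case: rho_mollifier => _ _ I1; rewrite /Rintegral I1. Qed.

Let k (n : nat) (w : R) : R := n.+1%:R * rho (n.+1%:R * w).

Let ck n : continuous (k n).
Proof.
move=> w; apply: cvgM; first exact: cvg_cst.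
have c : n.+1%:R * w' @[w' --> w] --> n.+1%:R * w.
  by apply: cvgM; [exact: cvg_cst|exact: cvg_id].
by apply: (@cvg_comp _ _ _ (fun w' : R => n.+1%:R * w') rho _ _ _ c); exact: crho.
Qed.

Let k_ge0 n w : 0 <= k n w. Proof. by rewrite mulr_ge0. Qed.

Let nN0 (n : nat) : n.+1%:R != 0 :> R. Proof. by rewrite pnatr_eq0. Qed.

Let ik n : lam.-integrable setT (EFin \o k n).
Proof.
have := integrable_affine 0 (nN0 n) irho.
move=> /(integrableZl measurableT n.+1%:R).
by congr (lam.-integrable _ _); apply/funext => w; rewrite /k/= addr0 EFinM.
Qed.

Let rescale (g : R -> R) (B : R) n : measurable_fun setT g -> (forall u, `|g u| <= B) ->
  \int[lam]_w (k n w * g w) = \int[lam]_v (rho v * g (v / n.+1%:R)).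
Proof.
move=> mg gB; have iF : lam.-integrable setT (EFin \o (fun v => rho v * g (v / n.+1%:R))).
  have mg' : measurable_fun setT (fun v : R => g (v / n.+1%:R)).
    by apply: (measurableT_comp mg); exact: measurable_funM.
  apply: (@le_integrable _ _ _ lam _ _ _ (fun v => (B * rho v)%:E)) => //.
  - by apply/measurable_EFinP; apply: measurable_funM => //; exact: continuous_measurable_fun.
  - move=> v _; rewrite lee_fin normrM (ger0_norm (rho_ge0 v)) mulrC.
    by rewrite [leRHS]ger0_norm ?ler_wpM2r// mulr_ge0// (le_trans _ (gB 0)).
  - by under eq_fun do rewrite EFinM; exact: integrableZl.
rewrite [RHS](Rintegral_affine 0 (nN0 n) iF) ger0_norm//.
have mk : measurable_fun setT (fun w => k n w * g w).
  by apply: measurable_funM => //; exact: continuous_measurable_fun.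
rewrite mulrC -Rintegral_posZr ?ltr0n//; last first.
  apply: measurable_funM; apply: measurableT_comp => //.
  - exact: continuous_measurable_fun.
  - by apply: measurable_funD => //; exact: measurable_funM.
  - by apply: measurable_funM => //; apply: measurable_funD => //; exact: measurable_funM.
apply: eq_Rintegral => w _; rewrite /k addr0 [n.+1%:R * w / _]mulrAC divff// mul1r.
by rewrite -[RHS]mulrA [g w * _]mulrC mulrA [_ * n.+1%:R]mulrC.
Qed.

(** After rescaling, [g (v / (n + 1))] tends to [g 0] for each [v]. Boundedness of [g] makes
    [B * rho] a dominating function, so [rho] may have unbounded support. *)
Let rescale_cvg (g : R -> R) (B : R) : measurable_fun setT g -> (forall u, `|g u| <= B) ->
  {for 0, continuous g} -> \int[lam]_w (k n w * g w) @[n --> \oo] --> g 0.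
Proof.
move=> mg gB cg; under eq_cvg do rewrite (rescale _ mg gB).
have -> : g 0 = \int[lam]_v (rho v * g 0).
  by rewrite RintegralZr// rho1 mul1r.
apply: (@Rintegral_dominated_cvg _ _ _ (fun v => B * rho v)).
- move=> n; apply: measurable_funM; first exact: continuous_measurable_fun.
  by apply: (measurableT_comp mg); exact: measurable_funM.
- move=> v; apply: cvgM; first exact: cvg_cst.
  have c : v / n.+1%:R @[n --> \oo] --> (0 : R).
    rewrite -(mulr0 v); apply: cvgM; first exact: cvg_cst.
    exact: cvg_harmonic.
  by apply: (@cvg_comp _ _ _ (fun n => v / n.+1%:R) g _ _ _ c); exact: cg.
- rewrite (_ : EFin \o _ = (fun w => B%:E * (EFin \o rho) w)%E)//; exact: integrableZl.
- move=> n v; rewrite normrM (ger0_norm (rho_ge0 v)) mulrC.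
  by rewrite ler_wpM2r.
Qed.

Let mollifyE n : mollify rho f n.+1 = smoothed (k n) f.
Proof. by apply/funext => u; rewrite -(convolutionE (@ck n) (@k_ge0 n) (ik n) df f_bound). Qed.

Lemma mollify_class_C2 n : compact_support rho -> class_C 2 (mollify rho f n).
Proof.
case: n => [_|n cs].
  rewrite (_ : mollify rho f 0 = fun=> 0); last first.
    apply/funext => u; rewrite /mollify /convolution /Rintegral integral0_eq// => v _.
    by rewrite !mul0r.
  have : smooth (fun _ : R => 0 : R).
    by apply: (@smooth_of_jet _ (fun _ _ => 0)) => _ u; exact: is_derive_cst.
  exact.
have [S [_ kS]] := compact_bounded cs.
have {}kS u : S + 1 < `|u| -> rho u = 0.
  move=> su; apply/eqP/negPn/negP => ku.
  have : `|u| <= S + 1 by apply: kS; [rewrite ltrDl|exact: subset_closure].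
  by rewrite leNgt su.
rewrite mollifyE; apply: (smoothed_class_C2 (@ck n) (@k_ge0 n) (ik n) df cf1 f1_increment
  f_bound f1_bound mf2 f2_bound (s := S + 1)).
move=> u su; rewrite /k kS ?mulr0// normrM ger0_norm// (lt_le_trans su)//.
by rewrite ler_peMl// ler1n.
Qed.

Lemma mollification_cvg a b : (forall n, class_C 2 (mollify rho f n)) ->
  mollify rho f n b - mollify rho f n a -
    \int[lam]_u (derive1n 2 (mollify rho f n) u * phi u) @[n --> \oo] -->
  f b - f a - \int[lam]_u (f2 u * phi u).
Proof.
(* The term n = 0 is the zero function; dropping it leaves the kernels [k n] of scale n + 1. *)
move=> C2; rewrite -cvg_shiftS/=.
have [B [B0 pB]] := pairing_bounded mf2 phi_ge0 iphi tail_small.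
have fcvg u : mollify rho f n.+1 u @[n --> \oo] --> f u.
  under eq_cvg do rewrite mollifyE /smoothed.
  have cg : continuous (fun w => f (u - w)).
    move=> w; have c : u - w' @[w' --> w] --> u - w by apply: cvgB; [exact: cvg_cst|exact: cvg_id].
    by apply: (@cvg_comp _ _ _ (fun w' : R => u - w') f _ _ _ c); exact: cf.
  have := @rescale_cvg (fun w => f (u - w)) C (continuous_measurable_fun cg)
    (fun w => f_bound (u - w)) (cg 0).
  by rewrite subr0.
apply: cvgB; first by apply: cvgB; exact: fcvg.
have -> : \int[lam]_u (f2 u * phi u) = pairing f2 phi 0.
  by apply: eq_Rintegral => u _; rewrite subr0.
have pB' w : `|pairing f2 phi w| <= B.
  have ip := pairing_integrable mf2 phi_ge0 iphi tail_small w.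
  apply: (le_trans (le_normr_Rintegral _ ip)) => //.
  rewrite /Rintegral -lee_fin fineK; first exact: pB.
  by apply: integrable_fin_num => //; exact: (integrable_norm ip).
have := rescale_cvg (continuous_measurable_fun pairing_continuous) pB' (@pairing_continuous 0).
(* By Fubini the average of [pairing f2 phi] against [k n] is the integral of the smoothed [f2]
   times [phi], and the smoothed [f2] is the second derivative of the mollified function almost
   everywhere. *)
apply: cvg_trans; apply: near_eq_cvg; near=> n; rewrite /pairing.
rewrite (translated_fubini (ik n) mf2 mphi phi_ge0 pB) /Rintegral; congr fine.
have [_ _ _ cd] := class_C2_is_derive (C2 n.+1).
have iT := translated_integrable (ik n) mf2 mphi phi_ge0 pB.
apply: ae_eq_integral => //.
- exact: measurable_int iT.
- by apply/measurable_EFinP; apply: measurable_funM => //; exact: continuous_measurable_fun.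
have FF := ae_filter_ringOfSetsType lam.
have := smoothed_derive2_ae (@ck n) (@k_ge0 n) (ik n) df cf1 f1_increment f_bound f1_bound mf2 f2_bound.
apply: filterS => u; rewrite -mollifyE => E _.
by first [exact: (congr1 (fun z => (z * phi u)%:E) E)|exact: (congr1 (fun z => (z * phi u)%:E) (esym E))].
Unshelve. all: by end_near. Qed.

End mollification_limit.

(** * Uniqueness of the quadratic variation *)

Section local_time_uniqueness.
Context {R : realType}.

(** The functions agree on [[0, T]] only, so the measures are first restricted to []0, T]]; an
    interval meets it in another half-open interval with ends in [[0, T]], and measures equal on
    half-open intervals are equal. *)
Lemma lebesgue_stieltjes_eq (c1 c2 : cumulative R R) (T : R) : 0 <= T ->
  (forall s, 0 <= s <= T -> c1 s = c2 s) -> forall A, measurable A -> A `<=` `]0, T] ->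
  lebesgue_stieltjes_measure c1 A = lebesgue_stieltjes_measure c2 A.
Proof.
move=> T0 c12 A mA AD.
have mD : measurable (`]0, T]%classic : set (measurableTypeR R)) by exact: measurable_itv.
pose m (c : cumulative R R) : {measure set (measurableTypeR R) -> \bar R} :=
  measure_function_mrestr__canonical__measure_function_Measure
    (lebesgue_stieltjes_measure c) mD.
have mE (c : cumulative R R) (B : set R) : m c B = lebesgue_stieltjes_measure c (B `&` `]0, T]) by [].
have AE (c : cumulative R R) : lebesgue_stieltjes_measure c A = m c A.
  by rewrite mE; congr (lebesgue_stieltjes_measure c _); exact/esym/setIidl.
have main : forall B : set (measurableTypeR R), measurable B -> m c1 B = m c2 B; last first.
  by rewrite !AE; exact: main.
refine (@measure_unique _ R (measurableTypeR R) (@ocitv R)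
  (fun k => `](- k%:R)%R, k%:R]%classic) (erefl _) _ _ _ (m c1) (m c2) _ _).
- exact: ocitvI.
- by move=> k; exact: is_ocitv.
- apply/seteqP; split => // u _; exists (Num.truncn `|u|).+1 => //=.
  have := truncnS_gt `|u|; rewrite ltr_norml => /andP[h1 h2].
  by rewrite in_itv/= h1 ltW.
- move=> _ [[a b] _ <-]; rewrite !mE/=.
  have -> : `]a, b]%classic `&` `]0, T]%classic = `](Num.max a 0), (Num.min b T)]%classic :> set R.
    apply/seteqP; split => s /=; rewrite !in_itv/= gt_max le_min.
      by move=> [/andP[-> ->] /andP[-> ->]].
    by move=> /andP[/andP[-> ->] /andP[-> ->]].
  have [le|lt] := leP (Num.max a 0) (Num.min b T); last first.
    by rewrite set_itv_ge ?measure0// bnd_simp -leNgt ltW.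
  rewrite !lebesgue_stieltjes_itv_oc//; congr (_ - _)%:E; apply: c12.
    by rewrite ge_min lexx orbT andbT (le_trans _ le)// le_max lexx orbT.
  by rewrite le_max lexx orbT/= (le_trans le)// ge_min lexx orbT.
- move=> k; apply: (@le_lt_trans _ _ (lebesgue_stieltjes_measure c1 `]0, T])).
    by rewrite mE; apply: le_measure; rewrite ?inE//; apply: measurableI => //; exact: measurable_itv.
  by rewrite lebesgue_stieltjes_itv_oc// ltry.
Qed.

Variables (T : R) (pi : nat -> seq R).
Hypothesis T_gt0 : 0 < T.
Hypothesis pi_partition : forall n, itv_partition 0 T (pi n).
Hypothesis pi_mesh : mesh (pi n) @[n --> \oo] --> 0.
Variable x : R -> R.
Hypothesis x_cadlag : cadlag T x.
Variables mu mu' : {finite_measure set (measurableTypeR R) -> \bar R}.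
Hypothesis mu_qv : is_qv_measure T pi x mu.
Hypothesis mu'_qv : is_qv_measure T pi x mu'.

(** Both values are the limit of the same stopped sums of squared increments, which do not involve
    the measure. *)
Lemma qv_unique t : 0 <= t <= T -> qv mu t = qv mu' t.
Proof.
move=> tT; have cvg nu : is_qv_measure T pi x nu ->
    stopped_sum sqdist (stopped T x) (pi n) 0 t @[n --> \oo] --> qv nu t.
  move=> nu_qv; apply/cvgrPdist_le => e e0.
  have := stopped_sqsum_cvg_qv T_gt0 pi_partition pi_mesh x_cadlag nu_qv tT e0.
  by apply: filterS => n; rewrite distrC.
by apply: (cvg_unique _ (cvg _ mu_qv) (cvg _ mu'_qv)).
Qed.

Lemma continuous_part_qv_unique t : 0 <= t <= T ->
  continuous_part (qv mu) t = continuous_part (qv mu') t.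
Proof.
move=> tT; rewrite /continuous_part qv_unique//; congr (_ - fine _).
apply: eq_esum => s; rewrite /= in_itv/= => /andP[s0 st]; congr EFin.
have sT : 0 <= s <= T by rewrite s0 (le_trans st)//; case/andP: tT.
by rewrite (proj2 mu_qv)// (proj2 mu'_qv).
Qed.

Lemma integral_continuous_part_qv_unique (g : R -> \bar R) t : 0 <= t <= T ->
  (\int[lebesgue_stieltjes_measure (continuous_part (qv mu))]_(s in `]0%R, t]) g s =
   \int[lebesgue_stieltjes_measure (continuous_part (qv mu'))]_(s in `]0%R, t]) g s)%E.
Proof.
move=> /andP[t0 tT]; apply: eq_measure_integral => A mA At.
apply: (lebesgue_stieltjes_eq t0) => // s /andP[s0 st].
by apply: continuous_part_qv_unique; rewrite s0 (le_trans st).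
Qed.

End local_time_uniqueness.

(** * Splitting the local time density, and the Tanaka-Meyer formula *)

Section taylor_sobolev.
Context {R : realType}.
Variables (T : R) (pi : nat -> seq R).
Hypothesis T_gt0 : 0 < T.
Hypothesis pi_partition : forall n, itv_partition 0 T (pi n).
Hypothesis pi_mesh : mesh (pi n) @[n --> \oo] --> 0.
Variable x : R -> R.
Hypothesis x_cadlag : cadlag T x.
Local Notation lam := (@lebesgue_measure R).
Variables (L K : R -> R -> R).
Hypothesis L_local_time : occupation_local_time T pi x L.
Variable mu : {finite_measure set (measurableTypeR R) -> \bar R}.
Hypothesis mu_qv : is_qv_measure T pi x mu.
Hypothesis mK : measurable_fun (`[0, T] `*` [set: R]) (fun z : R * R => K z.1 z.2).
Hypothesis K_ge0 : forall t u, 0 <= t <= T -> 0 <= K t u.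
Hypothesis occupation : forall t, 0 <= t <= T ->
  forall g : R -> R, measurable_fun setT g -> (forall u, 0 <= g u) ->
  (\int[lam]_u (g u * K t u)%:E =
   \int[lebesgue_stieltjes_measure (continuous_part (qv mu))]_(s in `]0%R, t]) (g (x s))%:E)%E.

Local Notation phi t := (fun u => fine (local_time_density x K t u)).
Local Notation w s := (taylor_kernel (left_value x s) (x s)).

(** [K] is to be the local time with the L^p bound and [L] the one of the statement, each with its
    own quadratic variation measure. By uniqueness of the continuous part of [x] their occupation
    formulas give [g] the same integral, so [L] replaces [K] in the first term. Both terms are
    finite because they are nonnegative with a finite sum. *)
Lemma density_decomposition (g : R -> R) t : measurable_fun setT g ->
  (forall u, 0 <= g u) -> 0 <= t <= T ->
  lam.-integrable setT (fun u => (g u * phi t u)%:E) ->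
  exists A B : R,
    [/\ (\int[lam]_u (L t u * g u)%:E = A%:E)%E,
        (\esum_(s in `]0%R, t]) (\int[lam]_u (g u * w s u)%:E) = B%:E)%E &
        \int[lam]_u (g u * phi t u) = A / 2 + B].
Proof.
move=> mg g0 tT ig.
have [_ mL L0 [mu' mu'_qv occ']] := L_local_time.
have phi0 u : 0 <= phi t u by rewrite fine_ge0// (local_time_density_ge0 _ K_ge0).
have Ilty : (\int[lam]_u (g u * phi t u)%:E < +oo)%E.
  move/integrableP : ig => [_]; congr (_ < _)%E; apply: eq_integral => u _.
  by rewrite gee0_abs// lee_fin mulr_ge0.
have E : (\int[lam]_u (g u * phi t u)%:E =
    (2^-1)%:E * (\int[lam]_u (L t u * g u)%:E) +
    \esum_(s in `]0%R, t]) (\int[lam]_u (g u * w s u)%:E))%E.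
  rewrite (ge0_integral_fine_density T_gt0 pi_partition pi_mesh x_cadlag mu_qv mK K_ge0 occupation)//.
  rewrite (ge0_integral_local_time_density mu_qv mK K_ge0 occupation)//; congr (_ + _)%E.
  rewrite (integral_continuous_part_qv_unique T_gt0 pi_partition pi_mesh x_cadlag mu_qv mu'_qv _ tT).
  have mg2 : measurable_fun setT (fun u => g u / 2) by exact: measurable_funM.
  have g20 u : 0 <= g u / 2 by rewrite divr_ge0.
  rewrite -(occ' t tT _ mg2 g20) -ge0_integralZl//.
  - by apply: eq_integral => u _; rewrite -EFinM; congr EFin; ring.
  - apply/measurable_EFinP; apply: measurable_funM => //; exact: (measurable_local_time mL).
  - by move=> u _; rewrite lee_fin mulr_ge0// L0.
have I0 : (0 <= \int[lam]_u (L t u * g u)%:E)%E.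
  by apply: integral_ge0 => u _; rewrite lee_fin mulr_ge0// L0.
have S0 : (0 <= \esum_(s in `]0%R, t]) (\int[lam]_u (g u * w s u)%:E))%E.
  by apply: esum_ge0 => s _; apply: integral_ge0 => u _; rewrite lee_fin mulr_ge0// taylor_kernel_ge0.
rewrite /Rintegral E; rewrite E in Ilty; move: I0 S0 Ilty.
case: (integral _ _ _) => [A| |]//; case: (esum _ _) => [B| |]//;
  rewrite ?gt0_muley ?lte_fin ?invr_gt0//= => _ _ _.
by exists A, B; split => //=; rewrite mulrC.
Qed.

End taylor_sobolev.

(** [I] is quantified before [rho], which expresses that the limit does not depend on the mollifier.
    For a compactly supported mollifier the C^2 regularity of the mollified functions is derived;
    otherwise it is assumed. *)
Theorem proposition2p5 (R : realType) (T : R) (T_gt0 : 0 < T)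
    (pi : nat -> seq R) (pi_partition : forall n, itv_partition 0 T (pi n))
    (pi_mesh : mesh (pi n) @[n --> \oo] --> 0)
    (p q : \bar R) (p_ge1 : (1 <= p)%E) (q_ge1 : (1 <= q)%E)
    (pq : (p^-1 + q^-1 <= 1)%E)
    (x : R -> R) (x_Lp : has_Lp_local_time T pi p x)
    (L : R -> R -> R) (L_local_time : occupation_local_time T pi x L)
    (f f2 : R -> R) (f_C1 : class_C 1 f) (f_sobolev : sobolev2 q f (derive1 f) f2)
    (f2_continuous : q = +oo%E -> continuous f2) :
  (forall t, 0 <= t <= T ->
     summable `]0, t] (fun s => (jump_term x f s)%:E)) /\
  exists I : R -> R,
    (forall t, 0 <= t <= T -> forall rho : R -> R, mollifier rho ->
       compact_support rho \/ (forall n, class_C 2 (mollify rho f n)) ->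
       (forall n, cvgn (fun m => riemann_sum x (mollify rho f n) t (pi m))) /\
       follmer_integral pi x (mollify rho f n) t @[n --> \oo] --> I t) /\
    (forall t, 0 <= t <= T ->
       (f (x t) - f (x 0))%:E =
       ((I t)%:E + (2^-1)%:E * \int[lebesgue_measure]_u (L t u * f2 u)%:E
        + (jump_sum x f t)%:E)%E).
Proof.
have [[x_cadlag _] [K [_ mK K_ge0 [mu mu_qv occ]] K_Lp]] := x_Lp.
have [fq f1q f2q _ wf2] := f_sobolev.
have [_ mL L0 _] := L_local_time.
pose lam := @lebesgue_measure R; set f1 := derive1 f.
have cf1 : continuous f1 by case: f_C1.
have df (u : R) : is_derive u 1 f (f1 u).
  by rewrite /f1 derive1E; apply/derivableP; case: f_C1 => /(_ 0%N u isT).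
have [C0 [C00 fC0]] := Lfun_uniformly_integrable q_ge1 fq.
have [C1 [C10 fC1]] := Lfun_uniformly_integrable q_ge1 f1q.
have [C2 [C20 fC2]] := Lfun_uniformly_integrable q_ge1 f2q.
have mf := Lfun_measurable fq; have mf1 := Lfun_measurable f1q; have mf2 := Lfun_measurable f2q.
pose C := C0 + C1 + C2.
have weaken (g : R -> R) (c c' : R) : c <= c' ->
    (forall a b, a <= b -> (\int[lam]_(r in `[a, b]) `|g r|%:E <= (c * (b - a) + c)%:E)%E) ->
    forall a b, a <= b -> (\int[lam]_(r in `[a, b]) `|g r|%:E <= (c' * (b - a) + c')%:E)%E.
  move=> cc gc a b ab; apply: (le_trans (gc a b ab)).
  by rewrite lee_fin lerD// ler_wpM2r// subr_ge0.
have C0C : C0 <= C by rewrite /C -addrA lerDl addr_ge0.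
have C1C : C1 <= C by rewrite /C [C0 + C1]addrC -addrA lerDl addr_ge0.
have C2C : C2 <= C by rewrite /C lerDr addr_ge0.
(* The bounds on [f] and [f1] come out as [4 * C], and the mollification lemmas take a single
   constant. *)
have C2C4 : C2 <= 4 * C by apply: (le_trans C2C); rewrite ler_peMl ?ler1n// (le_trans C00).
have fC4 := weaken f2 C2 (4 * C) C2C4 fC2.
have {}fC2 := weaken f2 C2 C C2C fC2.
have {}fC0 := weaken f C0 C C0C fC0; have {}fC1 := weaken f1 C1 C C1C fC1.
have if2 c d : lam.-integrable `[c, d] (EFin \o f2).
  have [cd|dc] := leP c d; last first.
    by rewrite set_itv_ge ?bnd_simp -?ltNge//; exact: integrable_set0.
  apply/integrableP; split; first by apply/measurable_EFinP; exact: measurable_funTS.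
  exact: le_lt_trans (fC2 _ _ cd) (ltry _).
have f_inc a b : a <= b -> f b - f a = \int[lam]_(r in `[a, b]) f1 r.
  by move=> ab; exact: increment_continuous_derivative.
have f1_inc a b : a <= b -> f1 b - f1 a = \int[lam]_(r in `[a, b]) f2 r.
  by move=> ab; exact: weak_derivative_increment.
have f_bound := bounded_of_increment mf mf1 f_inc fC0 fC1.
have f1_bound := bounded_of_increment mf1 mf2 f1_inc fC1 fC2.
pose phi t u := fine (local_time_density x K t u).
have phi_ge0 t : 0 <= t <= T -> forall u, 0 <= phi t u.
  by move=> tT u; rewrite fine_ge0// (local_time_density_ge0 _ K_ge0).
have iphi t : 0 <= t <= T -> lam.-integrable setT (EFin \o phi t).
  move=> tT; have c1 : continuous (fun _ : R => 1 : R) by move=> u; exact: cvg_cst.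
  have := integrable_fine_density T_gt0 pi_partition pi_mesh x_cadlag mu_qv mK K_ge0 occ c1 tT.
  by congr (lam.-integrable _ _); apply/funext => u; rewrite mul1r.
have tails t : 0 <= t <= T -> forall e : R, 0 < e -> exists M : R, 0 <= M /\
    forall v, (\int[lam]_u (tail f2 M (u - v) * phi t u)%:E <= e%:E)%E.
  move=> tT e e0; have [mKt Kp] := K_Lp t tT.
  apply: (tail_Lq_small p_ge1 q_ge1 pq f2q mKt _ Kp e0) => u.
  exact: (local_time_density_ge0 _ K_ge0).
have if2phi t : 0 <= t <= T -> lam.-integrable setT (fun u => (f2 u * phi t u)%:E).
  move=> tT; have := pairing_integrable mf2 (phi_ge0 t tT) (iphi t tT) (tails t tT) 0.
  by congr (lam.-integrable _ _); apply/funext => u; rewrite subr0.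
have mphi t (tT : 0 <= t <= T) : measurable_fun setT (phi t).
  by apply/measurable_EFinP; exact: measurable_int (iphi t tT).
have mabs : measurable_fun setT (fun u => `|f2 u|).
  by apply: (measurableT_comp (@normr_measurable _ _)).
(* Positive and negative parts of f'': the splitting of the density applies to each of them, and the
   signed identities are differences. *)
pose gp u := (`|f2 u| + f2 u) / 2; pose gn u := (`|f2 u| - f2 u) / 2.
have gp0 u : 0 <= gp u by rewrite divr_ge0// -lerBlDr sub0r ler_normr lexx orbT.
have gn0 u : 0 <= gn u by rewrite divr_ge0// subr_ge0 ler_norm.
have mgp : measurable_fun setT gp by apply: measurable_funM => //; exact: measurable_funD.
have mgn : measurable_fun setT gn by apply: measurable_funM => //; exact: measurable_funB.
have f2E u : f2 u = gp u - gn u by rewrite /gp /gn; field.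
have absE u : `|f2 u| = gp u + gn u by rewrite /gp /gn; field.
have part_le (g : R -> R) t : (forall u, 0 <= g u) -> (forall u, g u <= `|f2 u|) ->
    measurable_fun setT g -> 0 <= t <= T -> lam.-integrable setT (fun u => (g u * phi t u)%:E).
  move=> g0 gle mg tT; apply: (le_integrable measurableT _ _ (if2phi t tT)).
    by apply/measurable_EFinP; apply: measurable_funM => //; exact: mphi.
  move=> u _; rewrite lee_fin !normrM ler_wpM2r// ger0_norm//; exact: gle.
have gple u : gp u <= `|f2 u| by rewrite absE lerDl.
have gnle u : gn u <= `|f2 u| by rewrite absE lerDr.
have decomp g t := @density_decomposition R T pi T_gt0 pi_partition pi_mesh x x_cadlag L K
  L_local_time mu mu_qv mK K_ge0 occ g t.
pose w s := taylor_kernel (left_value x s) (x s).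
have iw (g : R -> R) s : (forall u, 0 <= g u) -> (forall u, g u <= `|f2 u|) ->
    measurable_fun setT g -> lam.-integrable setT (EFin \o (fun u => g u * w s u)).
  move=> g0 gle mg; apply: (@integrable_mul_taylor_kernel _ g) => c d.
  apply: (@le_integrable _ _ _ lam `[c, d] _ _ (EFin \o f2)) => //.
    by apply/measurable_EFinP; exact: measurable_funTS.
  by move=> u _; rewrite lee_fin/= ger0_norm.
have wint_ge0 (g : R -> R) s : (forall u, 0 <= g u) -> 0 <= \int[lam]_u (g u * w s u).
  by move=> g0; apply: Rintegral_ge0 => u _; rewrite mulr_ge0// taylor_kernel_ge0.
have wintE (g : R -> R) s : (forall u, 0 <= g u) -> (forall u, g u <= `|f2 u|) ->
    measurable_fun setT g ->
    (\int[lam]_u (g u * w s u)%:E = (\int[lam]_u (g u * w s u))%:E)%E.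
  move=> g0 gle mg; rewrite /Rintegral fineK//.
  by apply: integrable_fin_num => //; exact: iw.
have jumpE s : jump_term x f s = \int[lam]_u (gp u * w s u) - \int[lam]_u (gn u * w s u).
  rewrite /jump_term (taylor_remainder df cf1 if2 f1_inc) -RintegralB//; [|exact: iw|exact: iw].
  by apply: eq_Rintegral => u _; rewrite f2E mulrBl.
have sums t (tT : 0 <= t <= T) := decomp gp t mgp gp0 tT (part_le gp t gp0 gple mgp tT).
have sumsn t (tT : 0 <= t <= T) := decomp gn t mgn gn0 tT (part_le gn t gn0 gnle mgn tT).
pose P s := (\int[lam]_u (gp u * w s u))%:E; pose N s := (\int[lam]_u (gn u * w s u))%:E.
have PE t (A : R) : (\esum_(s in `]0%R, t]) (\int[lam]_u (gp u * w s u)%:E) = A%:E)%E ->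
    (\esum_(s in `]0%R, t]) P s = A%:E)%E.
  by move=> <-; apply: eq_esum => s _; rewrite wintE.
have NE t (A : R) : (\esum_(s in `]0%R, t]) (\int[lam]_u (gn u * w s u)%:E) = A%:E)%E ->
    (\esum_(s in `]0%R, t]) N s = A%:E)%E.
  by move=> <-; apply: eq_esum => s _; rewrite wintE.
have P0 s : (0 <= P s)%E by rewrite lee_fin wint_ge0.
have N0 s : (0 <= N s)%E by rewrite lee_fin wint_ge0.
have summable_ge0 t (a : R -> \bar R) (A : R) : (forall s, 0 <= a s)%E ->
    (\esum_(s in `]0%R, t]) a s = A%:E)%E -> summable `]0, t] a.
  by move=> a0 aA; rewrite /summable; under eq_esum do rewrite gee0_abs//; rewrite aA ltry.
have sP t (tT : 0 <= t <= T) : summable `]0, t] P.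
  by have [A [B [_ /PE HB _]]] := sums t tT; exact: summable_ge0 HB.
have sN t (tT : 0 <= t <= T) : summable `]0, t] N.
  by have [A [B [_ /NE HB _]]] := sumsn t tT; exact: summable_ge0 HB.
(* The jump terms are differences of two nonnegative families with finite sums, whence their
   absolute convergence. *)
have jumpPN : (fun s => (jump_term x f s)%:E) = (P \- N)%E.
  by apply/funext => s; rewrite jumpE EFinB.
split; first by move=> t tT; rewrite jumpPN; apply: summableB; [exact: sP|exact: sN].
exists (fun t => f (x t) - f (x 0) - \int[lam]_u (f2 u * phi t u)); split.
  move=> t tT rho rho_mollifier rho_or.
  have C2n n : class_C 2 (mollify rho f n).
    case: rho_or => [cs|]; last exact.
    exact: (mollify_class_C2 df cf1 f1_inc f_bound f1_bound mf2 fC4 rho_mollifier n cs).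
  have lim n := riemann_sum_cvg T_gt0 pi_partition pi_mesh x_cadlag mu_qv mK K_ge0 occ (C2n n) tT.
  split; first by move=> n; apply/cvg_ex; eexists; exact: lim.
  have E n : follmer_integral pi x (mollify rho f n) t =
      mollify rho f n (x t) - mollify rho f n (x 0) -
      \int[lam]_u (derive1n 2 (mollify rho f n) u * phi t u).
    by apply/cvg_lim; [exact: Rhausdorff|exact: lim].
  under eq_cvg do rewrite E.
  exact: (mollification_cvg df cf1 f1_inc f_bound f1_bound mf2 fC4 (phi_ge0 t tT) (iphi t tT)
    (tails t tT) rho_mollifier).
move=> t tT.
have [A1 [B1 [LA1 /PE HB1 phi1]]] := sums t tT.
have [A2 [B2 [LA2 /NE HB2 phi2]]] := sumsn t tT.
have -> : jump_sum x f t = B1 - B2.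
  rewrite /jump_sum jumpPN esumB//; [|exact: sP|exact: sN].
  by rewrite HB1 HB2.
have mLt := measurable_local_time mL tT.
have iL (g : R -> R) (A : R) : measurable_fun setT g -> (forall u, 0 <= g u) ->
    (\int[lam]_u (L t u * g u)%:E = A%:E)%E ->
    lam.-integrable setT (fun u => (L t u * g u)%:E).
  move=> mg g0 gA; apply/integrableP; split.
    by apply/measurable_EFinP; exact: measurable_funM.
  have := ltry A; rewrite -gA; congr (_ < _)%E; apply: eq_integral => u _.
  by rewrite gee0_abs// lee_fin mulr_ge0// L0.
have -> : (\int[lam]_u (L t u * f2 u)%:E = (A1 - A2)%:E)%E.
  rewrite EFinB -LA1 -LA2 -integralB//; [|exact: (iL gp A1)|exact: (iL gn A2)].
  by apply: eq_integral => u _; rewrite f2E mulrBr EFinB.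
have -> : \int[lam]_u (f2 u * phi t u) = (A1 / 2 + B1) - (A2 / 2 + B2).
  rewrite -phi1 -phi2 -RintegralB//; [|exact: part_le|exact: part_le].
  by apply: eq_Rintegral => u _; rewrite f2E mulrBl.
by rewrite -EFinM -!EFinD; congr EFin; field.
Qed.
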